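(* Let $k\in\{1,2\}$ and let $\Delta_k(n)$ denote the broken $k$-diamond partition function. Then for every integer $n\geq 18$, $$\det\begin{pmatrix}\Delta_k(n+2)&\Delta_k(n+3)&\Delta_k(n+4)\\ \Delta_k(n+1)&\Delta_k(n+2)&\Delta_k(n+3)\\ \Delta_k(n)&\Delta_k(n+1)&\Delta_k(n+2)\end{pmatrix}>0.$$
   Context: For a positive integer $k$, $\Delta_k(n)$ denotes the number of broken $k$-diamond partitions of $n$ (Andrews and Paule). It is determined by its generating function, which may be taken as the definition: $$\sum_{n=0}^{\infty}\Delta_k(n)q^n=\prod_{n=1}^{\infty}\frac{(1-q^{2n})(1-q^{(2k+1)n})}{(1-q^n)^3(1-q^{(4k+2)n})}.$$ *)

(* Defs.v *)
From mathcomp Require Import all_boot all_order all_algebra.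

Set Implicit Arguments.
Unset Strict Implicit.
Unset Printing Implicit Defensive.

Import Order.TTheory GRing.Theory Num.Theory.
Local Open Scope ring_scope.

(* Formal power series over int in the indeterminate q: f n is the coefficient
   of q^n. *)
Definition fps := nat -> int.

Definition fps_one : fps := fun n => (n == 0%N)%:R.

Definition fps_mul (f g : fps) : fps :=
  fun n => \sum_(i < n.+1) f i * g (n - i)%N.

(* 1 - q^m *)
Definition fps_1subXn (m : nat) : fps :=
  fun n => (n == 0%N)%:R - (n == m)%:R.

(* 1 / (1 - q^m) = 1 + q^m + q^(2m) + ..., for 0 < m; see fps_geomK. *)
Definition fps_geom (m : nat) : fps := fun n => (m %| n)%:R.

(* \prod_(1 <= m <= N) F m *)
Fixpoint fps_prod (F : nat -> fps) (N : nat) : fps :=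
  if N is N'.+1 then fps_mul (fps_prod F N') (F N) else fps_one.

(* \prod_(m >= 1) F m.  When every F m is 1 + O(q^m), the coefficient of q^n
   in the partial products is constant from the n-th one on (fps_prod_stable),
   so this is the coefficientwise limit of the partial products. *)
Definition fps_infprod (F : nat -> fps) : fps := fun n => fps_prod F n n.

(* (1 - q^(2m)) (1 - q^((2k+1)m)) / ((1 - q^m)^3 (1 - q^((4k+2)m))) *)
Definition broken_diamond_factor (k m : nat) : fps :=
  fps_mul
    (fps_mul (fps_1subXn (2 * m)) (fps_1subXn ((2 * k + 1) * m)))
    (fps_mul
       (fps_mul (fps_geom m) (fps_mul (fps_geom m) (fps_geom m)))
       (fps_geom ((4 * k + 2) * m))).

(* The broken k-diamond partition function Delta_k(n), through its generating
   function. *)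
Definition broken_diamond (k : nat) : nat -> int :=
  fps_infprod (broken_diamond_factor k).

Lemma fps_geomK m : (0 < m)%N ->
  fps_mul (fps_1subXn m) (fps_geom m) =1 fps_one.
Proof.
move=> m_gt0 n; rewrite /fps_mul /fps_1subXn /fps_geom /fps_one.
under eq_bigr => i _ do rewrite mulrBl.
rewrite sumrB big_ord_recl big1 ?addr0 => [|i _]; last by rewrite mul0r.
rewrite eqxx mul1r subn0.
have [le_mn|lt_nm] := leqP m n; last first.
  rewrite big1 ?subr0 => [|i _].
    by case: n lt_nm => [|n] lt_nm; rewrite ?dvdn0 // gtnNdvd.
  by rewrite (ltn_eqF (leq_ltn_trans (ltn_ord i : (i <= n)%N) lt_nm)) mul0r.
have lt_mn1 : (m < n.+1)%N by [].
rewrite (bigD1 (Ordinal lt_mn1)) //= eqxx mul1r big1 ?addr0 => [|i ne_im].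
  by rewrite dvdn_subl // subrr eqn0Ngt (leq_trans m_gt0 le_mn).
by rewrite -(inj_eq val_inj) /= in ne_im; rewrite (negPf ne_im) mul0r.
Qed.

Definition fps_near1 (m : nat) (f : fps) :=
  forall i, (i < m)%N -> f i = fps_one i.

Lemma fps_mul_near1 m f g n :
  fps_near1 m g -> (n < m)%N -> fps_mul f g n = f n.
Proof.
move=> g1 lt_nm; rewrite /fps_mul big_ord_recr /= subnn.
rewrite g1 ?(leq_ltn_trans _ lt_nm) // mulr1 big1 ?add0r // => i _.
rewrite g1 /fps_one ?(leq_ltn_trans (leq_subr _ _) lt_nm) //.
by rewrite subn_eq0 leqNgt ltn_ord mulr0.
Qed.

Lemma fps_near1M m f g :
  fps_near1 m f -> fps_near1 m g -> fps_near1 m (fps_mul f g).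
Proof. by move=> f1 g1 i lt_im; rewrite (fps_mul_near1 _ g1) ?f1. Qed.

Lemma fps_prod_stable F n N : (forall m, (0 < m)%N -> fps_near1 m (F m)) ->
  (n <= N)%N -> fps_prod F N n = fps_infprod F n.
Proof.
move=> F1; elim: N => [|N IHN]; first by rewrite leqn0 => /eqP->.
rewrite leq_eqVlt => /predU1P[->//|lt_nN].
by rewrite /= (@fps_mul_near1 N.+1) ?IHN //; apply: F1.
Qed.

Lemma broken_diamond_factor_near1 k m : (0 < m)%N ->
  fps_near1 m (broken_diamond_factor k m).
Proof.
move=> m_gt0.
have sub1 a : (m <= a)%N -> fps_near1 m (fps_1subXn a).
  move=> le_ma i lt_im.
  by rewrite /fps_1subXn (ltn_eqF (leq_trans lt_im le_ma)) subr0.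
have geom1 a : (m <= a)%N -> fps_near1 m (fps_geom a).
  move=> le_ma [|i] lt_im; rewrite /fps_geom /fps_one ?dvdn0 //.
  by rewrite gtnNdvd // (leq_trans lt_im le_ma).
by do !apply: fps_near1M; (apply: sub1 || apply: geom1);
  rewrite // leq_pmull // ?addn1 ?addn2.
Qed.

Lemma broken_diamond_partial_prod k n N : (n <= N)%N ->
  fps_prod (broken_diamond_factor k) N n = broken_diamond k n.
Proof. by apply: fps_prod_stable => m; apply: broken_diamond_factor_near1. Qed.

(* Main.v *)
(** Write [D = 2k + 1], [f] for the generating function and [a n] for its
    coefficients.  Dodgson condensation gives
    [a (n+2) * det = (a (n+2)^2 - a (n+1) a (n+3))^2 - (a (n+1)^2 - a n a (n+2)) (a (n+3)^2 - a (n+2) a (n+4))],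
    so the claim is a log-concavity statement of second order.

    For large [n] it follows from the circle method.  The partial fractions of
    [1 / (4 sinh^2 (z/2))] yield the quasi-modularity of the Eisenstein series
    of weight two; integrating it along a segment gives the transformation law
    [f (e^-t) = t / (2 pi) * exp (A / t - s t) * (1 + small)] with
    [A = pi^2/6 (5/2 - 1/(2D))] and [s = (1 + D)/24].  Hence, with
    [x = n - s] and [X = sqrt (A x)], [a n] equals [M (A x) = A^2 / (2 pi) * sum_i (A x)^i / (i! (i+2)!)]
    up to a relative error [12 X^2 exp (-0.47 X)].  The logarithmic derivative
    of [M] obeys a Riccati equation, and barrier curves for it bound the second
    differences [p] of [- log M] and those of [log (1 - exp (- p))]; the
    resulting gap is of order [X^-3] and dominates the error from [X = 87],
    that is from [n = 2000] on.

    Below 2000 the coefficients are computed by dividing sparse series, which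
    the pentagonal number theorem provides, and the inequality is checked with
    rounded integers. *)

From Stdlib Require Reals Lra Lia ZArith FunctionalExtensionality.
From Coquelicot Require Coquelicot.
From HB Require Import structures.

(** Holomorphic function theory is avoided: functions are differentiated along real paths, contours
    are closed with explicit primitives of Laurent monomials, and a logarithm occurs only as a
    convergent series that is exponentiated. The multiplicities 3, -1, -1, 1 of the four Euler
    products have sum 2, so only the exponential of twice the logarithmic error of one Euler product
    is needed, and the square root in the transformation law of eta never occurs.

    The obstacle is a double cancellation. With [q] the ratio of M(u - A) M(u + A) to M(u)^2, a
    two-by-two minor is smaller than its terms by the factor 1 - q, of order X^-3, and the
    comparison of three minors loses another X^-3. The main term must be correct to relative order
    X^-6 with an explicit constant, so the full Bessel series is kept instead of an asymptotic
    expansion.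

    The restriction to D = 3 and D = 5 is felt in the inequality A <= 4 pi^2 / (2D), an equality for
    D = 5: it makes the decay of the dual terms pay for the growth of exp (A / t) off the saddle
    point. *)

Module Analytic.

Import Reals Lra Lia ZArith Coquelicot.
Open Scope R_scope.
Set Bullet Behavior "Strict Subproofs".

(** * The complex exponential and the modulus *)

Definition cexp (z : C) : C := (exp (Re z) * cos (Im z), exp (Re z) * sin (Im z)).

Lemma cexp_add (a b : C) : cexp (a + b)%C = (cexp a * cexp b)%C.
Proof.
  destruct a as [a1 a2], b as [b1 b2]; unfold cexp, Cmult, Cplus; cbn.
  rewrite exp_plus, cos_plus, sin_plus; f_equal; ring.
Qed.

Lemma cexp_R (x : R) : cexp (RtoC x) = RtoC (exp x).
Proof. unfold cexp, RtoC; cbn; rewrite cos_0, sin_0; f_equal; ring. Qed.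

Lemma cexp_0 : cexp 0 = 1%C.
Proof. rewrite cexp_R, exp_0; reflexivity. Qed.

Lemma cexp_mod (z : C) : Cmod (cexp z) = exp (Re z).
Proof.
  unfold Cmod, cexp; cbn [fst snd].
  replace (_ + _) with (exp (Re z) ^ 2).
  - apply sqrt_pow2; left; apply exp_pos.
  - generalize (sin2_cos2 (Im z)); unfold Rsqr; intro H.
    transitivity (exp (Re z) ^ 2 * (sin (Im z) * sin (Im z) + cos (Im z) * cos (Im z))).
    + rewrite H; ring.
    + ring.
Qed.

Lemma cexp_neq_0 (z : C) : cexp z <> 0%C.
Proof. apply Cmod_gt_0; rewrite cexp_mod; apply exp_pos. Qed.

Lemma cexp_opp (z : C) : cexp (- z)%C = (/ cexp z)%C.
Proof.
  assert (H : (cexp (- z) * cexp z)%C = 1%C).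
  { rewrite <- cexp_add; replace (- z + z)%C with (RtoC 0) by ring; apply cexp_0. }
  rewrite <- (Cmult_1_l (/ cexp z)), <- H; field; apply cexp_neq_0.
Qed.

Lemma cexp_pow (z : C) (n : nat) : cexp (INR n * z)%C = (cexp z ^ n)%C.
Proof.
  induction n as [|n IH].
  - cbn; rewrite Cmult_0_l; apply cexp_0.
  - rewrite Cpow_S, <- IH, <- cexp_add, S_INR, RtoC_plus; f_equal; ring.
Qed.

Lemma cexp_PI : cexp (0, PI) = (- (1))%C.
Proof. unfold cexp; cbn; rewrite exp_0, cos_PI, sin_PI; apply injective_projections; cbn; ring. Qed.

Lemma cexp_2PI : cexp (0, 2 * PI) = 1%C.
Proof. unfold cexp; cbn; rewrite exp_0, cos_2PI, sin_2PI; apply injective_projections; cbn; ring. Qed.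

Lemma im_le_Cmod (c : C) : Rabs (Im c) <= Cmod c.
Proof.
  replace (Im c) with (- Re (c * Ci)) by (rewrite re_mult_Ci; ring).
  rewrite Rabs_Ropp; eapply Rle_trans; [apply re_le_Cmod|].
  rewrite Cmod_mult; replace (Cmod Ci) with 1; [lra|].
  unfold Cmod, Ci; cbn; replace (0 * (0 * 1) + 1 * (1 * 1)) with 1 by ring; now rewrite sqrt_1.
Qed.

Lemma Cmod_le_ReIm (c : C) : Cmod c <= Rabs (Re c) + Rabs (Im c).
Proof.
  replace c with (RtoC (Re c) + Ci * RtoC (Im c))%C at 1
    by (destruct c; unfold RtoC, Ci; apply injective_projections; cbn; ring).
  eapply Rle_trans; [apply Cmod_triangle|].
  rewrite Cmod_mult, !Cmod_R; replace (Cmod Ci) with 1; [lra|].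
  unfold Cmod, Ci; cbn; replace (0 * (0 * 1) + 1 * (1 * 1)) with 1 by ring; now rewrite sqrt_1.
Qed.

Lemma re_le_Cmod' (c : C) : Re c <= Cmod c.
Proof. eapply Rle_trans; [apply Rle_abs|apply re_le_Cmod]. Qed.

Lemma Cmod_Rabs_triang (a b : C) : Cmod a - Cmod b <= Cmod (a + b)%C.
Proof.
  generalize (Cmod_triangle (a + b) (- b)); rewrite Cmod_opp.
  replace (a + b + - b)%C with a by ring; lra.
Qed.

Lemma Cmod_minus_comm (a b : C) : Cmod (a - b)%C = Cmod (b - a)%C.
Proof. rewrite <- Cmod_opp; f_equal; ring. Qed.

Lemma Cmod_minus_le (a b c : C) : Cmod (a - c)%C <= Cmod (a - b)%C + Cmod (b - c)%C.
Proof. replace (a - c)%C with ((a - b) + (b - c))%C by ring; apply Cmod_triangle. Qed.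

(** * Finite sums *)

Fixpoint csum (u : nat -> C) (n : nat) : C :=
  match n with O => RtoC 0 | S n => (csum u n + u n)%C end.

(** The range is half open, so that the empty sum exists; [rsum_sum_n] converts to the closed range
    of [sum_n]. *)
Fixpoint rsum (u : nat -> R) (n : nat) : R :=
  match n with O => 0 | S n => rsum u n + u n end.

Lemma csum_ext (u v : nat -> C) (n : nat) :
  (forall k, (k < n)%nat -> u k = v k) -> csum u n = csum v n.
Proof.
  induction n as [|n IH]; cbn; intro H; [reflexivity|].
  rewrite IH, (H n) by (intros; try apply H; lia); reflexivity.
Qed.

Lemma csum_0 (u : nat -> C) (n : nat) :
  (forall k, (k < n)%nat -> u k = RtoC 0) -> csum u n = RtoC 0.
Proof.
  induction n as [|n IH]; cbn; intro H; [reflexivity|].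
  rewrite IH, (H n) by (intros; try apply H; lia); ring.
Qed.

Lemma csum_plus (u v : nat -> C) (n : nat) :
  csum (fun k => (u k + v k)%C) n = (csum u n + csum v n)%C.
Proof. induction n as [|n IH]; cbn; [ring|rewrite IH; ring]. Qed.

Lemma csum_minus (u v : nat -> C) (n : nat) :
  csum (fun k => (u k - v k)%C) n = (csum u n - csum v n)%C.
Proof. induction n as [|n IH]; cbn; [ring|rewrite IH; ring]. Qed.

Lemma csum_scal (a : C) (u : nat -> C) (n : nat) :
  csum (fun k => (a * u k)%C) n = (a * csum u n)%C.
Proof. induction n as [|n IH]; cbn; [ring|rewrite IH; ring]. Qed.

Lemma csum_opp (u : nat -> C) (n : nat) :
  csum (fun k => (- u k)%C) n = (- csum u n)%C.
Proof. induction n as [|n IH]; cbn; [ring|rewrite IH; ring]. Qed.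

Lemma csum_swap (u : nat -> nat -> C) (n m : nat) :
  csum (fun i => csum (u i) m) n = csum (fun j => csum (fun i => u i j) n) m.
Proof.
  induction n as [|n IH]; cbn.
  - induction m as [|m IHm]; cbn; [reflexivity|rewrite <- IHm; ring].
  - rewrite IH, <- csum_plus; reflexivity.
Qed.

Lemma csum_add_index (u : nat -> C) (n m : nat) :
  csum u (n + m) = (csum u n + csum (fun k => u (n + k)%nat) m)%C.
Proof.
  induction m as [|m IH]; [rewrite Nat.add_0_r; cbn; ring|].
  rewrite Nat.add_succ_r; cbn; rewrite IH; ring.
Qed.

Lemma csum_recl (u : nat -> C) (n : nat) :
  csum u (S n) = (u O + csum (fun k => u (S k)) n)%C.
Proof. rewrite <- (Nat.add_1_l n), csum_add_index; cbn; ring. Qed.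

Lemma csum_rev (u : nat -> C) (n : nat) :
  csum (fun k => u (n - 1 - k)%nat) n = csum u n.
Proof.
  induction n as [|n IH]; [reflexivity|].
  rewrite csum_recl; cbn [csum]; rewrite <- IH, Cplus_comm; f_equal.
  - apply csum_ext; intros k Hk; f_equal; lia.
  - f_equal; lia.
Qed.

Lemma csum_telescope (u : nat -> C) (n : nat) :
  csum (fun k => (u (S k) - u k)%C) n = (u n - u O)%C.
Proof. induction n as [|n IH]; cbn; [ring|rewrite IH; ring]. Qed.

Lemma Cmod_csum_le (u : nat -> C) (n : nat) :
  Cmod (csum u n) <= rsum (fun k => Cmod (u k)) n.
Proof.
  induction n as [|n IH]; cbn; [rewrite Cmod_0; lra|].
  eapply Rle_trans; [apply Cmod_triangle|lra].
Qed.

Lemma rsum_le (u v : nat -> R) (n : nat) :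
  (forall k, (k < n)%nat -> u k <= v k) -> rsum u n <= rsum v n.
Proof.
  induction n as [|n IH]; cbn; intro H; [lra|].
  apply Rplus_le_compat; [apply IH; intros; apply H|apply H]; lia.
Qed.

Lemma rsum_ext (u v : nat -> R) (n : nat) :
  (forall k, (k < n)%nat -> u k = v k) -> rsum u n = rsum v n.
Proof. intro H; apply Rle_antisym; apply rsum_le; intros k Hk; rewrite H by easy; lra. Qed.

Lemma rsum_const (a : R) (n : nat) : rsum (fun _ => a) n = INR n * a.
Proof. induction n as [|n IH]; [cbn; ring|rewrite S_INR; cbn [rsum]; rewrite IH; ring]. Qed.

Lemma rsum_scal (a : R) (u : nat -> R) (n : nat) :
  rsum (fun k => a * u k) n = a * rsum u n.
Proof. induction n as [|n IH]; cbn; [ring|rewrite IH; ring]. Qed.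

Lemma csum_R (u : nat -> R) (n : nat) : csum (fun k => RtoC (u k)) n = RtoC (rsum u n).
Proof. induction n as [|n IH]; cbn; [reflexivity|rewrite IH, RtoC_plus; reflexivity]. Qed.

Lemma re_csum (u : nat -> C) (n : nat) : Re (csum u n) = rsum (fun k => Re (u k)) n.
Proof. induction n as [|n IH]; cbn; [reflexivity|unfold Re in *; cbn; rewrite IH; reflexivity]. Qed.

Lemma rsum_telescope (u : nat -> R) (n : nat) :
  rsum (fun k => u k - u (S k)) n = u O - u n.
Proof. induction n as [|n IH]; cbn; [ring|rewrite IH; ring]. Qed.

Lemma Cmod_csum_le' (u : nat -> C) (b : nat -> R) (n : nat) :
  (forall k, (k < n)%nat -> Cmod (u k) <= b k) -> Cmod (csum u n) <= rsum b n.
Proof. intro H; eapply Rle_trans; [apply Cmod_csum_le|now apply rsum_le]. Qed.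

(** * Limits *)

(** Stated through the modulus, so that every complex limit reduces to a real sequence squeezed to
    0. *)
Definition clim (u : nat -> C) (l : C) := is_lim_seq (fun n => Cmod (u n - l)%C) 0.

Lemma lim0_squeeze (u v : nat -> R) :
  eventually (fun n => 0 <= u n <= v n) -> is_lim_seq v 0 -> is_lim_seq u 0.
Proof.
  intros H Hv; apply is_lim_seq_le_le_loc with (fun _ => 0) v; auto; apply is_lim_seq_const.
Qed.

Lemma clim_bound (u : nat -> C) (l : C) (v : nat -> R) :
  eventually (fun n => Cmod (u n - l)%C <= v n) -> is_lim_seq v 0 -> clim u l.
Proof.
  intros [N H] Hv; apply lim0_squeeze with v; auto.
  exists N; intros n Hn; split; [apply Cmod_ge_0|now apply H].
Qed.

Lemma clim_ext (u v : nat -> C) (l : C) : (forall n, u n = v n) -> clim u l -> clim v l.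
Proof. intros H; apply is_lim_seq_ext; intro n; now rewrite H. Qed.

Lemma clim_const (a : C) : clim (fun _ => a) a.
Proof.
  apply clim_bound with (fun _ => 0); [|apply is_lim_seq_const].
  exists O; intros n _; replace (a - a)%C with (RtoC 0) by ring; rewrite Cmod_0; lra.
Qed.

Lemma is_lim_seq_0_plus (u v : nat -> R) :
  is_lim_seq u 0 -> is_lim_seq v 0 -> is_lim_seq (fun n => u n + v n) 0.
Proof. intros Hu Hv; replace 0 with (0 + 0) by ring; now apply is_lim_seq_plus'. Qed.

Lemma is_lim_seq_0_scal (a : R) (u : nat -> R) :
  is_lim_seq u 0 -> is_lim_seq (fun n => a * u n) 0.
Proof.
  intros Hu; replace 0 with (a * 0) by ring.
  apply is_lim_seq_mult'; [apply is_lim_seq_const|assumption].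
Qed.

Lemma clim_plus (u v : nat -> C) (a b : C) :
  clim u a -> clim v b -> clim (fun n => (u n + v n)%C) (a + b)%C.
Proof.
  intros Hu Hv; apply clim_bound with (fun n => Cmod (u n - a)%C + Cmod (v n - b)%C).
  - exists O; intros n _; replace (u n + v n - (a + b))%C with ((u n - a) + (v n - b))%C by ring.
    apply Cmod_triangle.
  - now apply is_lim_seq_0_plus.
Qed.

Lemma clim_mult (u v : nat -> C) (a b : C) :
  clim u a -> clim v b -> clim (fun n => (u n * v n)%C) (a * b)%C.
Proof.
  intros Hu Hv.
  apply clim_bound with (fun n => Cmod (u n - a)%C * Cmod (v n - b)%C
     + (Cmod b * Cmod (u n - a)%C + Cmod a * Cmod (v n - b)%C)).
  - exists O; intros n _.
    replace (u n * v n - a * b)%C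
      with ((u n - a) * (v n - b) + (b * (u n - a) + a * (v n - b)))%C by ring.
    eapply Rle_trans; [apply Cmod_triangle|rewrite Cmod_mult; apply Rplus_le_compat_l].
    eapply Rle_trans; [apply Cmod_triangle|rewrite !Cmod_mult; lra].
  - apply is_lim_seq_0_plus.
    + replace 0 with (0 * 0) by ring; now apply is_lim_seq_mult'.
    + apply is_lim_seq_0_plus; now apply is_lim_seq_0_scal.
Qed.

Lemma clim_scal (a : C) (u : nat -> C) (b : C) :
  clim u b -> clim (fun n => (a * u n)%C) (a * b)%C.
Proof. intro H; apply clim_mult; [apply clim_const|assumption]. Qed.

Lemma clim_opp (u : nat -> C) (b : C) : clim u b -> clim (fun n => (- u n)%C) (- b)%C.
Proof.
  intro H; apply clim_ext with (fun n => (- (1) * u n)%C); [intro; ring|].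
  replace (- b)%C with (- (1) * b)%C by ring; now apply clim_scal.
Qed.

Lemma clim_minus (u v : nat -> C) (a b : C) :
  clim u a -> clim v b -> clim (fun n => (u n - v n)%C) (a - b)%C.
Proof. intros Hu Hv; apply clim_plus; [assumption|now apply clim_opp]. Qed.

(** The triangle inequality through [u n] suffices. This is how estimates at finite level reach
    infinite sums and products. *)
Lemma clim_Cmod_le (u : nat -> C) (l a : C) (v : nat -> R) (b : R) :
  clim u l -> is_lim_seq v b -> eventually (fun n => Cmod (u n - a)%C <= v n) ->
  Cmod (l - a)%C <= b.
Proof.
  intros Hu Hv [N H].
  assert (Hs : is_lim_seq (fun n => Cmod (u n - l)%C + v n) b).
  { replace b with (0 + b) by ring; now apply is_lim_seq_plus'. }
  refine (is_lim_seq_le_loc (fun _ => Cmod (l - a)%C) _ (Cmod (l - a)%C) b _ _ Hs);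
    [|apply is_lim_seq_const].
  exists N; intros n Hn; specialize (H n Hn).
  generalize (Cmod_minus_le l (u n) a); rewrite (Cmod_minus_comm l (u n)); lra.
Qed.

Lemma clim_unique (u : nat -> C) (a b : C) : clim u a -> clim u b -> a = b.
Proof.
  intros Ha Hb; assert (H : Cmod (a - b)%C <= 0).
  { apply (clim_Cmod_le u a b _ 0 Ha Hb); exists O; intros; lra. }
  assert (E : (a - b)%C = 0%C) by (apply Cmod_eq_0; generalize (Cmod_ge_0 (a - b)%C); lra).
  now apply Ceq_minus.
Qed.

Lemma clim_re (u : nat -> C) (a : C) : clim u a -> is_lim_seq (fun n => Re (u n)) (Re a).
Proof.
  intro H; apply is_lim_seq_ext with (fun n => Re (u n - a)%C + Re a).
  - intro n; unfold Cminus; rewrite re_plus, re_opp; ring.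
  - replace (Finite (Re a)) with (Finite (0 + Re a)) by (f_equal; ring).
    apply is_lim_seq_plus'; [|apply is_lim_seq_const].
    apply is_lim_seq_abs_0; apply lim0_squeeze with (2 := H).
    exists O; intros n _; split; [apply Rabs_pos|apply re_le_Cmod].
Qed.

(** * Derivatives along a real parameter *)

(** Complex functions are differentiated only along a real parameter: on a segment, a vertical line
    or an arc. *)
Definition derC (f : R -> C) (x : R) (l : C) :=
  is_derive (fun s => Re (f s)) x (Re l) /\ is_derive (fun s => Im (f s)) x (Im l).

Lemma derC_ext (f g : R -> C) (x : R) (l : C) : (forall s, f s = g s) -> derC f x l -> derC g x l.
Proof.
  intros H [H1 H2]; split; eapply is_derive_ext; eauto; intro s; cbn; now rewrite H.
Qed.

Lemma derC_eq (f : R -> C) (x : R) (l l' : C) : derC f x l -> l = l' -> derC f x l'.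
Proof. now intros H <-. Qed.

Lemma derC_const (a : C) (x : R) : derC (fun _ => a) x 0%C.
Proof. split; cbn; apply (is_derive_const (V := R_NormedModule)). Qed.

Lemma derC_lin (a b : C) (x : R) : derC (fun s => (a + RtoC s * b)%C) x b.
Proof.
  destruct a as [a1 a2], b as [b1 b2]; split; cbn; auto_derive; auto; ring.
Qed.

Lemma derC_plus (f g : R -> C) (x : R) (a b : C) :
  derC f x a -> derC g x b -> derC (fun s => (f s + g s)%C) x (a + b)%C.
Proof.
  intros [H1 H2] [H3 H4]; split; cbn.
  - exact (is_derive_plus (fun s => Re (f s)) (fun s => Re (g s)) x _ _ H1 H3).
  - exact (is_derive_plus (fun s => Im (f s)) (fun s => Im (g s)) x _ _ H2 H4).
Qed.

Lemma is_derive_mult_R (f g : R -> R) (x a b : R) :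
  is_derive f x a -> is_derive g x b -> is_derive (fun s => f s * g s) x (a * g x + f x * b).
Proof. intros Hf Hg; apply (is_derive_mult f g x a b Hf Hg); intros; apply Rmult_comm. Qed.

Lemma is_derive_eq (f g : R -> R) (x l l' : R) :
  is_derive f x l -> (forall s, f s = g s) -> l = l' -> is_derive g x l'.
Proof. intros H E <-; exact (is_derive_ext f g x l E H). Qed.

Lemma derC_mult (f g : R -> C) (x : R) (a b : C) :
  derC f x a -> derC g x b -> derC (fun s => (f s * g s)%C) x (a * g x + f x * b)%C.
Proof.
  intros [H1 H2] [H3 H4]; split.
  - eapply is_derive_eq.
    + exact (is_derive_minus _ _ x _ _ (is_derive_mult_R _ _ _ _ _ H1 H3)
      (is_derive_mult_R _ _ _ _ _ H2 H4)).
    + reflexivity.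
    + unfold minus, plus, opp; cbn; unfold Re, Im; ring.
  - eapply is_derive_eq.
    + exact (is_derive_plus _ _ x _ _ (is_derive_mult_R _ _ _ _ _ H1 H4)
      (is_derive_mult_R _ _ _ _ _ H2 H3)).
    + intro s; cbn; unfold plus; cbn; unfold Re, Im; ring.
    + unfold plus; cbn; unfold Re, Im; ring.
Qed.

Lemma derC_scal (a : C) (f : R -> C) (x : R) (l : C) :
  derC f x l -> derC (fun s => (a * f s)%C) x (a * l)%C.
Proof.
  intro H; eapply derC_eq; [exact (derC_mult (fun _ => a) f x _ _ (derC_const a x) H)|cbn beta; ring].
Qed.

Lemma derC_opp (f : R -> C) (x : R) (l : C) : derC f x l -> derC (fun s => (- f s)%C) x (- l)%C.
Proof.
  intro H; apply derC_ext with (fun s => (- (1) * f s)%C); [intro; ring|].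
  eapply derC_eq; [apply derC_scal; exact H|ring].
Qed.

Lemma derC_minus (f g : R -> C) (x : R) (a b : C) :
  derC f x a -> derC g x b -> derC (fun s => (f s - g s)%C) x (a - b)%C.
Proof. intros; apply derC_plus; [assumption|now apply derC_opp]. Qed.

Lemma derC_cexp (f : R -> C) (x : R) (l : C) :
  derC f x l -> derC (fun s => cexp (f s)) x (l * cexp (f x))%C.
Proof.
  intros [H1 H2].
  assert (G : forall (u v : R -> R) a b, is_derive u x a -> is_derive v x b ->
    is_derive (fun s => exp (u s) * cos (v s)) x (a * (exp (u x) * cos (v x)) - b * (exp (u x) * sin (v x))) /\
    is_derive (fun s => exp (u s) * sin (v s)) x (a * (exp (u x) * sin (v x)) + b * (exp (u x) * cos (v x)))).
  { intros u v a b Hu Hv; split; auto_derive; try (repeat split; eexists; eassumption);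
      replace (Derive (fun s : R => u s) x) with a by (symmetry; exact (is_derive_unique u x a Hu));
        replace (Derive (fun s : R => v s) x) with b by (symmetry; exact (is_derive_unique v x b Hv)); ring. }
  exact (G _ _ _ _ H1 H2).
Qed.

Lemma derC_inv (f : R -> C) (x : R) (l : C) :
  f x <> 0%C -> derC f x l -> derC (fun s => (/ f s)%C) x (- l / (f x * f x))%C.
Proof.
  intros Hn [H1 H2].
  assert (Hp : Re (f x) ^ 2 + Im (f x) ^ 2 <> 0).
  { rewrite <- Cmod2_alt; apply pow_nonzero.
    apply Cmod_gt_0 in Hn; lra. }
  assert (G : forall (u v : R -> R) a b, is_derive u x a -> is_derive v x b ->
    u x ^ 2 + v x ^ 2 <> 0 ->
    is_derive (fun s => u s / (u s ^ 2 + v s ^ 2)) x (Re (- (a, b) / ((u x, v x) * (u x, v x)))%C) /\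
    is_derive (fun s => - v s / (u s ^ 2 + v s ^ 2)) x (Im (- (a, b) / ((u x, v x) * (u x, v x)))%C)).
  { clear; intros u v a b Hu Hv Hp.
    assert (Hp' : u x * (u x * 1) + v x * (v x * 1) <> 0) by (intro E; apply Hp; rewrite <- E; ring).
    assert (Hq : (u x * u x - v x * v x) * (u x * u x - v x * v x)
      + (u x * v x + v x * u x) * (u x * v x + v x * u x) <> 0).
    { replace (_ + _) with ((u x ^ 2 + v x ^ 2) ^ 2) by ring; now apply pow_nonzero. }
    split; auto_derive; try (repeat split; auto; eexists; eassumption);
      replace (Derive (fun s : R => u s) x) with a by (symmetry; exact (is_derive_unique u x a Hu));
        replace (Derive (fun s : R => v s) x) with b by (symmetry; exact (is_derive_unique v x b Hv));
      cbn; field; split; intro E; ((apply Hq; rewrite <- E; ring) || (apply Hp; rewrite <- E; ring)). }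
  destruct (G _ _ _ _ H1 H2 Hp) as [G1 G2].
  split.
  - eapply is_derive_eq; [exact G1|reflexivity|].
    destruct l, (f x); reflexivity.
  - eapply is_derive_eq; [exact G2|reflexivity|].
    destruct l, (f x); reflexivity.
Qed.

Lemma derC_csum (f : nat -> R -> C) (l : nat -> C) (x : R) (n : nat) :
  (forall k, (k < n)%nat -> derC (f k) x (l k)) ->
  derC (fun s => csum (fun k => f k s) n) x (csum l n).
Proof.
  induction n as [|n IH]; intro H; cbn; [apply derC_const|].
  apply derC_plus; [apply IH; intros; apply H; lia|apply H; lia].
Qed.

Lemma MVT_abs (f f' : R -> R) (B : R) :
  (forall s, 0 <= s <= 1 -> is_derive f s (f' s)) ->
  (forall s, 0 <= s <= 1 -> Rabs (f' s) <= B) -> Rabs (f 1 - f 0) <= B.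
Proof.
  intros Hd Hb.
  destruct (MVT_gen f 0 1 f') as [c [Hc E]].
  - intros s Hs; rewrite Rmin_left, Rmax_right in Hs by lra; apply Hd; lra.
  - intros s Hs; rewrite Rmin_left, Rmax_right in Hs by lra.
    apply continuity_pt_filterlim, (ex_derive_continuous f); eexists; apply Hd; lra.
  - rewrite Rmin_left, Rmax_right in Hc by lra.
    rewrite E, Rminus_0_r, Rmult_1_r; now apply Hb.
Qed.

(** The factor 2 comes from applying the real mean value theorem to the real and imaginary parts
    separately. *)
Lemma derC_MVT (f f' : R -> C) (B : R) :
  (forall s, 0 <= s <= 1 -> derC f s (f' s)) ->
  (forall s, 0 <= s <= 1 -> Cmod (f' s) <= B) -> Cmod (f 1 - f 0)%C <= 2 * B.
Proof.
  intros Hd Hb.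
  eapply Rle_trans; [apply Cmod_le_ReIm|].
  replace (2 * B) with (B + B) by ring; apply Rplus_le_compat.
  - unfold Cminus; rewrite re_plus, re_opp.
    apply (MVT_abs (fun s => Re (f s)) (fun s => Re (f' s))); intros s Hs; [now apply Hd|].
    eapply Rle_trans; [apply re_le_Cmod|now apply Hb].
  - unfold Cminus; rewrite im_plus, im_opp.
    apply (MVT_abs (fun s => Im (f s)) (fun s => Im (f' s))); intros s Hs; [now apply Hd|].
    eapply Rle_trans; [apply im_le_Cmod|now apply Hb].
Qed.

(** * The exponential series *)

Definition cexp_tr (n : nat) (z : C) : C := csum (fun k => (/ INR (fact k) * z ^ k)%C) n.

Lemma derC_pow_scal (z : C) (n : nat) (x : R) :
  derC (fun s => ((RtoC s * z) ^ S n)%C) x (INR (S n) * z * (RtoC x * z) ^ n)%C.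
Proof.
  assert (H0 : derC (fun s => (RtoC s * z)%C) x z).
  { apply derC_ext with (fun s => (0 + RtoC s * z)%C); [intro; ring|apply derC_lin]. }
  induction n as [|n IH].
  - apply derC_ext with (fun s => (RtoC s * z)%C); [intro; ring|].
    eapply derC_eq; [exact H0|cbn; ring].
  - apply derC_ext with (fun s => ((RtoC s * z) * (RtoC s * z) ^ S n)%C);
      [intro; cbn; ring|].
    eapply derC_eq; [apply derC_mult; [exact H0|exact IH]|].
    rewrite (S_INR (S n)), RtoC_plus, !Cpow_S; ring.
Qed.

Lemma derC_cexp_tr (n : nat) (z : C) (x : R) :
  derC (fun s => cexp_tr (S n) (RtoC s * z)%C) x (z * cexp_tr n (RtoC x * z))%C.
Proof.
  unfold cexp_tr.
  apply derC_ext with (fun s => (1 + csum (fun k => (/ INR (fact (S k)) * (RtoC s * z) ^ S k)%C) n)%C).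
  { intro s; rewrite csum_recl; cbn [Cpow fact INR]; f_equal; field. }
  eapply derC_eq.
  - apply derC_plus; [apply derC_const|].
    apply (derC_csum (fun k s => (/ INR (fact (S k)) * (RtoC s * z) ^ S k)%C)).
    intros k _; apply derC_scal, derC_pow_scal.
  - rewrite Cplus_0_l, <- csum_scal; apply csum_ext; intros k _.
    assert (H1 : RtoC (INR (fact k)) <> 0%C) by (intro E; apply RtoC_inj in E; apply (INR_fact_neq_0 k E)).
    assert (H2 : RtoC (INR (S k)) <> 0%C) by (intro E; apply RtoC_inj in E; apply (not_0_INR (S k)); auto).
    replace (INR (fact (S k))) with (INR (S k) * INR (fact k)) by (rewrite <- mult_INR; reflexivity).
    rewrite RtoC_mult; field; auto.
Qed.

Lemma derC_id (z : C) (x : R) : derC (fun s => (RtoC s * z)%C) x z.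
Proof. apply derC_ext with (fun s => (0 + RtoC s * z)%C); [intro; ring|apply derC_lin]. Qed.

Lemma cexp_tr_S (n : nat) (z : C) :
  cexp_tr (S n) z = (cexp_tr n z + / INR (fact n) * z ^ n)%C.
Proof. reflexivity. Qed.

Lemma exp_le (x y : R) : x <= y -> exp x <= exp y.
Proof. intros [H | ->]; [left; now apply exp_increasing|lra]. Qed.

Lemma exp_pow (x : R) (n : nat) : exp x ^ n = exp (INR n * x).
Proof.
  induction n as [|n IH]; [cbn; now rewrite Rmult_0_l, exp_0|].
  rewrite S_INR, Rmult_plus_distr_r, exp_plus, Rmult_1_l, <- IH; cbn; ring.
Qed.

Lemma cexp_mod_le (z : C) : Cmod (cexp z) <= exp (Cmod z).
Proof.
  rewrite cexp_mod; destruct (re_le_Cmod' z) as [H| ->]; [left; now apply exp_increasing|lra].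
Qed.

(* The derivative of [s => cexp_tr (S n) (s z) * cexp (- s z)] has a single
   surviving term. *)
Lemma cexp_tr_bound (n : nat) (z : C) :
  Cmod (cexp z - cexp_tr (S n) z)%C
  <= 2 * (/ INR (fact n) * Cmod z ^ S n) * exp (2 * Cmod z).
Proof.
  set (h := fun r : R => (cexp_tr (S n) (RtoC r * z) * cexp (- (RtoC r * z)))%C).
  set (h' := fun r : R => (- (z * (/ INR (fact n) * (RtoC r * z) ^ n)) * cexp (- (RtoC r * z)))%C).
  assert (Hf : 0 < / INR (fact n)) by (apply Rinv_0_lt_compat, INR_fact_lt_0).
  assert (H : Cmod (h 1 - h 0)%C <= 2 * (/ INR (fact n) * Cmod z ^ S n * exp (Cmod z))).
  { apply derC_MVT with h'.
    - intros r _; unfold h, h'; eapply derC_eq.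
      + apply derC_mult; [apply derC_cexp_tr|apply derC_cexp, derC_opp, derC_id].
      + cbv beta; rewrite cexp_tr_S; ring.
    - intros r Hr; unfold h'.
      assert (Hrz : Cmod (RtoC r * z) <= Cmod z).
      { rewrite Cmod_mult, Cmod_R, Rabs_pos_eq by lra; generalize (Cmod_ge_0 z); nra. }
      rewrite Cmod_mult, Cmod_opp, !Cmod_mult, Cmod_pow, <- RtoC_inv, Cmod_R, Rabs_pos_eq
        by (try lra; apply INR_fact_neq_0).
      apply Rmult_le_compat; try apply Cmod_ge_0.
      + repeat apply Rmult_le_pos; try lra; try apply Cmod_ge_0; apply pow_le, Cmod_ge_0.
      + cbn [pow].
        apply Rle_trans with (Cmod z * (/ INR (fact n) * Cmod z ^ n)); [|right; ring].
        apply Rmult_le_compat_l; [apply Cmod_ge_0|].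
        apply Rmult_le_compat_l; [lra|].
        apply pow_incr; split; [apply Cmod_ge_0|exact Hrz].
      + eapply Rle_trans; [apply cexp_mod_le|rewrite Cmod_opp].
        destruct Hrz as [Hrz| ->]; [left; now apply exp_increasing|lra]. }
  assert (E0 : h 0 = 1%C).
  { unfold h; rewrite Cmult_0_l, Copp_0, cexp_0; unfold cexp_tr; rewrite csum_recl.
    rewrite csum_0; [cbn [Cpow fact INR]; field; intro E; apply RtoC_inj in E; lra|].
    intros k _; rewrite Cpow_S; ring. }
  rewrite E0 in H; unfold h in H; rewrite Cmult_1_l in H.
  replace (cexp z - cexp_tr (S n) z)%C
    with (- cexp z * (cexp_tr (S n) z * cexp (- z) - 1))%C
    by (rewrite cexp_opp; field; apply cexp_neq_0).
  rewrite Cmod_mult, Cmod_opp.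
  replace (2 * Cmod z) with (Cmod z + Cmod z) by ring; rewrite exp_plus.
  generalize (cexp_mod_le z) (Cmod_ge_0 (cexp z)); intros H1 H2.
  eapply Rle_trans; [apply Rmult_le_compat; [exact H2|apply Cmod_ge_0|exact H1|exact H]|].
  right; ring.
Qed.

Lemma cexp_m1_bound (z : C) : Cmod (cexp z - 1)%C <= 2 * Cmod z * exp (2 * Cmod z).
Proof.
  generalize (cexp_tr_bound 0 z); unfold cexp_tr; cbn.
  rewrite Rinv_1, <- RtoC_inv, Rinv_1 by lra.
  replace (0 + 1 * 1)%C with (RtoC 1) by ring; intro H; eapply Rle_trans; [exact H|right; ring].
Qed.

Lemma clim_cexp (u : nat -> C) (a : C) : clim u a -> clim (fun n => cexp (u n)) (cexp a).
Proof.
  intro H.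
  apply clim_bound with (fun n => exp (Re a) * 2 * exp 2 * Cmod (u n - a)%C).
  - destruct (H (fun x => x < 1)) as [N HN].
    { exists (mkposreal 1 Rlt_0_1); intros y Hy; cbn in Hy; unfold AbsRing_ball, abs, minus, plus, opp in Hy.
      cbn in Hy; apply Rabs_lt_between in Hy; lra. }
    exists N; intros n Hn; specialize (HN n Hn).
    replace (cexp (u n) - cexp a)%C with (cexp a * (cexp (u n - a) - 1))%C.
    2:{ replace (cexp (u n)) with (cexp (a + (u n - a))) by (f_equal; ring).
        rewrite cexp_add; ring. }
    rewrite Cmod_mult, cexp_mod, !Rmult_assoc; apply Rmult_le_compat_l; [left; apply exp_pos|].
    eapply Rle_trans; [apply cexp_m1_bound|].
    generalize (Cmod_ge_0 (u n - a)%C); intro H0.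
    rewrite Rmult_assoc; apply Rmult_le_compat_l; [lra|rewrite Rmult_comm].
    apply Rmult_le_compat_r; [exact H0|].
    left; apply exp_increasing; lra.
  - now apply is_lim_seq_0_scal.
Qed.

(** * Partial fractions of [1 / sinh^2] and [coth] *)

Lemma PI_bounds : 3.14159 <= PI <= 3.1416.
Proof.
  generalize (PI_2_3_7_ineq 3); unfold PI_2_3_7_tg, tg_alt, Ratan_seq, Rdiv.
  simpl; intros [H1 H2]; split; lra.
Qed.

(** For [Re z > 0] and q = e^-z this is the sum of q^m over m >= 1, and [sfun z] below is the sum of
    m q^m, that is 1 / (4 sinh^2 (z/2)), the negative of the derivative of [bos]. *)
Definition bos (z : C) : C := (/ (cexp z - 1))%C.

Definition sfun (z : C) : C := (cexp z / ((cexp z - 1) * (cexp z - 1)))%C.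

Definition tpi : C := (0, 2 * PI).

Definition csinh (v : C) : C := ((cexp v - cexp (- v)) / 2)%C.

Lemma C_neq_R (x y : R) : x <> y -> RtoC x <> RtoC y.
Proof. intros H E; now apply H, RtoC_inj. Qed.

Lemma Cmod_INR (n : nat) : Cmod (INR n) = INR n.
Proof. rewrite Cmod_R; apply Rabs_pos_eq, pos_INR. Qed.

Lemma Cmod_tpi : Cmod tpi = 2 * PI.
Proof.
  generalize PI_bounds; intros.
  unfold Cmod, tpi; cbn [fst snd].
  replace (0 ^ 2 + (2 * PI) ^ 2) with ((2 * PI) ^ 2) by ring; apply sqrt_pow2; lra.
Qed.

Lemma cexp_add_tpi (z : C) (k : nat) : cexp (z + INR k * tpi)%C = cexp z.
Proof.
  rewrite cexp_add, cexp_pow; unfold tpi; rewrite cexp_2PI, Cpow_1_l; ring.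
Qed.

Lemma cexp_sub_tpi (z : C) (k : nat) : cexp (z - INR k * tpi)%C = cexp z.
Proof.
  rewrite <- (cexp_add_tpi (z - INR k * tpi) k); f_equal; ring.
Qed.

Lemma C2_neq_0 : RtoC 2 <> 0%C. Proof. apply C_neq_R; lra. Qed.
Lemma C4_neq_0 : RtoC 4 <> 0%C. Proof. apply C_neq_R; lra. Qed.
#[local] Hint Resolve C2_neq_0 C4_neq_0 : core.

Lemma cexp_half_tpi (z : C) : cexp (z + tpi / 2)%C = (- cexp z)%C.
Proof.
  replace (tpi / 2)%C with ((0, PI) : C).
  - rewrite cexp_add, cexp_PI; ring.
  - unfold tpi; apply injective_projections; cbn; field.
Qed.

Lemma cexp_half_tpi' (z : C) : cexp (z - tpi / 2)%C = (- cexp z)%C.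
Proof.
  replace (cexp z) with (cexp ((z - tpi / 2) + tpi / 2)) by (f_equal; ring).
  rewrite cexp_half_tpi; ring.
Qed.

Lemma sfun_doubling (z z1 : C) :
  cexp z <> 1%C -> z1 = (z / 2 + tpi / 2)%C \/ z1 = (z / 2 - tpi / 2)%C ->
  sfun z = (/ 4 * (sfun (z / 2) + sfun z1))%C.
Proof.
  intros Hz H1.
  assert (E1 : cexp z1 = (- cexp (z / 2))%C).
  { destruct H1 as [-> | ->]; [apply cexp_half_tpi|apply cexp_half_tpi']. }
  assert (E : cexp z = (cexp (z / 2) * cexp (z / 2))%C).
  { rewrite <- cexp_add; f_equal; field; auto. }
  unfold sfun; rewrite E1, E; rewrite E in Hz.
  set (w := cexp (z / 2)) in *.
  assert (A1 : (w - 1)%C <> 0%C) by (intro F; apply Hz; replace w with (w - 1 + 1)%C by ring; rewrite F; ring).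
  assert (A2 : (w + 1)%C <> 0%C) by (intro F; apply Hz; replace w with (w + 1 - 1)%C by ring; rewrite F; ring).
  assert (A3 : (- w - 1)%C <> 0%C) by (intro F; apply A2; replace (w + 1)%C with (- (- w - 1))%C by ring; rewrite F; ring).
  assert (A4 : (w * w - 1)%C <> 0%C) by (replace (w * w - 1)%C with ((w - 1) * (w + 1))%C by ring; now apply Cmult_neq_0).
  field; auto.
Qed.

Lemma INR_pow2 (n : nat) : INR (2 ^ n) = 2 ^ n.
Proof. rewrite pow_INR; reflexivity. Qed.

Lemma pow2_pos (n : nat) : 0 < 2 ^ n.
Proof. apply pow_lt; lra. Qed.

Lemma pow2C_neq_0 (n : nat) : (RtoC 2 ^ n)%C <> 0%C.
Proof. apply Cpow_nz; auto. Qed.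
#[local] Hint Resolve pow2C_neq_0 : core.

Lemma cexp_div_pow2 (z w : C) (n : nat) : cexp z <> 1%C -> cexp w = cexp z -> cexp (w / 2 ^ n)%C <> 1%C.
Proof.
  intros Hz Hw E; apply Hz; rewrite <- Hw.
  replace w with (INR (2 ^ n) * (w / 2 ^ n))%C.
  - rewrite cexp_pow, E; apply Cpow_1_l.
  - rewrite INR_pow2, RtoC_pow; field; auto.
Qed.

(** Herglotz's device: iterating the doubling formula spreads [sfun z] over 2^(n+1) points close to
    0, where only the double pole matters. *)
Lemma sfun_iter (n : nat) (z : C) : cexp z <> 1%C ->
  sfun z = ((/ 4) ^ S n * csum (fun k => sfun ((z + INR k * tpi) / 2 ^ S n)
                                   + sfun ((z - INR (S k) * tpi) / 2 ^ S n)) (2 ^ n))%C.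
Proof.
  intro Hz; induction n as [|n IH].
  - rewrite (sfun_doubling z (z / 2 - tpi / 2)) by auto; cbn.
    rewrite !Cmult_1_r, !Cplus_0_l; do 2 f_equal; f_equal; field; auto.
  - rewrite IH at 1; rewrite (Cpow_S (/ 4) (S n)).
    replace (2 ^ S n)%nat with (2 ^ n + 2 ^ n)%nat by (cbn; lia).
    (* Doubling turns the shift k into k and k - 2^(n+1), so the upper half of the new range is met
       in reverse order and is reversed before pairing. *)
    match goal with |- context [csum ?u (2 ^ n + 2 ^ n)%nat] =>
      rewrite (csum_add_index u), <- (csum_rev (fun k => u (2 ^ n + k)%nat)), <- csum_plus end.
    rewrite <- csum_scal, <- csum_scal; apply csum_ext; intros k Hk.
    rewrite (sfun_doubling ((z + INR k * tpi) / 2 ^ S n)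
       ((z - INR (S (2 ^ n + (2 ^ n - 1 - k))) * tpi) / 2 ^ S (S n))).
    + rewrite (sfun_doubling ((z - INR (S k) * tpi) / 2 ^ S n)
       ((z + INR (2 ^ n + (2 ^ n - 1 - k)) * tpi) / 2 ^ S (S n))).
      * replace ((z + INR k * tpi) / 2 ^ S n / 2)%C with ((z + INR k * tpi) / 2 ^ S (S n))%C
          by (rewrite (Cpow_S 2 (S n)); field; auto).
        replace ((z - INR (S k) * tpi) / 2 ^ S n / 2)%C with ((z - INR (S k) * tpi) / 2 ^ S (S n))%C
          by (rewrite (Cpow_S 2 (S n)); field; auto).
        ring.
      * apply (cexp_div_pow2 z); [exact Hz|apply cexp_sub_tpi].
      * left; replace (2 ^ n + (2 ^ n - 1 - k))%nat with (2 ^ n + 2 ^ n - S k)%nat by lia.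
        rewrite minus_INR, plus_INR, INR_pow2, RtoC_minus, RtoC_plus, RtoC_pow by lia.
        rewrite !Cpow_S; field; auto.
    + apply (cexp_div_pow2 z); [exact Hz|apply cexp_add_tpi].
    + right; replace (S (2 ^ n + (2 ^ n - 1 - k)))%nat with (2 ^ n + 2 ^ n - k)%nat by lia.
      rewrite minus_INR, plus_INR, INR_pow2, RtoC_minus, RtoC_plus, RtoC_pow by lia.
      rewrite !Cpow_S; field; auto.
Qed.

Lemma exp_diff_lb (a : R) : 0 <= a <= 2 -> 2 * exp (- 2) * a <= exp a - exp (- a).
Proof.
  intro H.
  replace (exp a - exp (- a)) with (exp (- a) * (exp (2 * a) - 1)).
  - assert (H1 : exp (-2) <= exp (- a))
      by (apply exp_le; lra).
    assert (H2 := exp_pos (-2)); assert (H3 := exp_ineq1_le (2 * a)).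
    apply Rle_trans with (exp (- a) * (2 * a)); [nra|apply Rmult_le_compat_l; [left; apply exp_pos|lra]].
  - replace (2 * a) with (a + a) by ring; rewrite exp_plus, exp_Ropp; field; apply Rgt_not_eq, exp_pos.
Qed.

Lemma sin_lb_third (b : R) : 0 <= b <= 2 -> b / 3 <= sin b.
Proof.
  intro H; destruct (pre_sin_bound b 0) as [H1 _]; try lra.
  unfold sin_approx, sin_term in H1; cbn in H1; nra.
Qed.

Lemma re_csinh (v : C) : Re (csinh v) = (exp (Re v) - exp (- Re v)) / 2 * cos (Im v).
Proof. destruct v; unfold csinh, cexp; cbn; rewrite cos_neg; field. Qed.

Lemma im_csinh (v : C) : Im (csinh v) = (exp (Re v) + exp (- Re v)) / 2 * sin (Im v).
Proof. destruct v; unfold csinh, cexp; cbn; rewrite sin_neg; field. Qed.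

(** |sinh (a + ib)|^2 = sinh^2 a + sin^2 b, and each square is bounded below by a multiple of a^2 or
    b^2. *)
Lemma csinh_lb (v : C) : Cmod v <= 2 -> exp (-2) * Cmod v <= Cmod (csinh v).
Proof.
  intro Hv; assert (He := exp_pos (-2)).
  assert (He' : exp (-2) <= / 3).
  { replace (-2) with (- (2)) by ring; rewrite exp_Ropp; apply Rinv_le_contravar; [lra|generalize (exp_ineq1_le 2); lra]. }
  apply Rsqr_incr_0; try apply Cmod_ge_0; [|apply Rmult_le_pos; [lra|apply Cmod_ge_0]].
  unfold Rsqr.
  replace (Cmod (csinh v) * Cmod (csinh v)) with (Cmod (csinh v) ^ 2) by ring.
  replace (exp (-2) * Cmod v * (exp (-2) * Cmod v)) with (exp (-2) ^ 2 * Cmod v ^ 2) by ring.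
  rewrite !Cmod2_alt, re_csinh, im_csinh.
  assert (Ha : Rabs (Re v) <= 2) by (eapply Rle_trans; [apply re_le_Cmod|lra]).
  assert (Hb : Rabs (Im v) <= 2) by (eapply Rle_trans; [apply im_le_Cmod|lra]).
  set (a := Re v) in *; set (b := Im v) in *.
  set (S := (exp a - exp (- a)) / 2).
  assert (HS : exp (-2) ^ 2 * a ^ 2 <= S ^ 2).
  { apply Rabs_le_between in Ha; destruct (Rle_dec 0 a) as [Hp|Hn].
    - assert (H1 := exp_diff_lb a ltac:(lra)).
      assert (H2 : 0 <= exp (-2) * a <= S).
      { unfold S; split; [apply Rmult_le_pos|]; lra. }
      rewrite <- Rpow_mult_distr; now apply pow_incr.
    - assert (H1 := exp_diff_lb (- a) ltac:(lra)); rewrite Ropp_involutive in H1.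
      assert (H2 : 0 <= exp (-2) * - a <= - S).
      { unfold S; split; [apply Rmult_le_pos|]; lra. }
      replace (S ^ 2) with ((- S) ^ 2) by ring; replace (a ^ 2) with ((- a) ^ 2) by ring.
      rewrite <- Rpow_mult_distr; now apply pow_incr. }
  assert (HB : exp (-2) ^ 2 * b ^ 2 <= sin b ^ 2).
  { apply Rle_trans with (/ 9 * b ^ 2).
    { apply Rmult_le_compat_r; [apply pow2_ge_0|]; nra. }
    apply Rabs_le_between in Hb; destruct (Rle_dec 0 b) as [Hp|Hn].
    - generalize (sin_lb_third b ltac:(lra)); intro; nra.
    - generalize (sin_lb_third (- b) ltac:(lra)); rewrite sin_neg; intro; nra. }
  assert (HC : ((exp a + exp (- a)) / 2) ^ 2 = S ^ 2 + 1).
  { unfold S; assert (E : exp a * exp (- a) = 1) by (rewrite <- exp_plus, Rplus_opp_r; apply exp_0).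
    replace 1 with (exp a * exp (- a)); field. }
  rewrite !Rpow_mult_distr, HC.
  assert (HT : cos b ^ 2 = 1 - sin b ^ 2) by (generalize (sin2_cos2 b); unfold Rsqr; intro; nra).
  rewrite HT; nra.
Qed.

Lemma csinh_sub_id (v : C) : Cmod v <= 2 -> Cmod (csinh v - v)%C <= exp 4 * Cmod v ^ 3.
Proof.
  intro Hv.
  assert (H1 := cexp_tr_bound 2 v); assert (H2 := cexp_tr_bound 2 (- v)).
  rewrite Cmod_opp in H2.
  replace (csinh v - v)%C
    with (/ 2 * ((cexp v - cexp_tr 3 v) - (cexp (- v) - cexp_tr 3 (- v))))%C.
  - rewrite Cmod_mult, <- RtoC_inv, Cmod_R, Rabs_pos_eq by lra.
    assert (H3 := Cmod_triangle (cexp v - cexp_tr 3 v) (- (cexp (- v) - cexp_tr 3 (- v)))).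
    rewrite Cmod_opp in H3.
    assert (He : exp (2 * Cmod v) <= exp 4)
    by (apply exp_le; lra).
    assert (Hp : 0 <= Cmod v ^ 3) by (apply pow_le, Cmod_ge_0).
    cbn [fact INR Nat.mul Nat.add] in H1, H2.
    unfold Cminus in *.
    assert (Hm : Cmod v ^ 3 * exp (2 * Cmod v) <= Cmod v ^ 3 * exp 4) by (apply Rmult_le_compat_l; lra).
    lra.
  - unfold csinh, cexp_tr; cbn [csum fact INR Nat.mul Nat.add].
    rewrite !RtoC_plus; field; auto.
Qed.

Lemma sfun_csinh (w : C) : cexp w <> 1%C ->
  sfun w = (/ (4 * (csinh (w / 2) * csinh (w / 2))))%C.
Proof.
  intro Hw; unfold sfun, csinh; rewrite cexp_opp.
  assert (E : cexp w = (cexp (w / 2) * cexp (w / 2))%C).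
  { rewrite <- cexp_add; f_equal; field; auto. }
  rewrite E in *; assert (Hc := cexp_neq_0 (w / 2)); set (u := cexp (w / 2)) in *.
  assert (A : (u * u - 1)%C <> 0%C) by (intro F; apply Hw; replace (u * u)%C with (u * u - 1 + 1)%C by ring; rewrite F; ring).
  field; auto.
Qed.

(** Its value is immaterial: it bounds the regular part of [sfun] near 0 and is always divided by a
    power of 2 that tends to infinity. *)
Definition csb : R := exp 4 * (2 + 4 * exp 4) / (4 * exp (-2) ^ 2).

Lemma csb_pos : 0 < csb.
Proof.
  unfold csb; apply Rdiv_lt_0_compat; repeat apply Rmult_lt_0_compat; try apply exp_pos;
    try apply pow_lt; generalize (exp_pos 4) (exp_pos (-2)); lra.
Qed.

(** With v = w/2 the difference is -(sinh v - v)(sinh v + v) / (4 v^2 sinh^2 v), whose numerator and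
    denominator both have order v^4. *)
Lemma sfun_near_0 (w : C) : cexp w <> 1%C -> w <> 0%C -> Cmod w <= 4 ->
  Cmod (sfun w - / (w * w))%C <= csb.
Proof.
  intros Hw Hw0 Hw4; rewrite sfun_csinh by exact Hw.
  set (v := (w / 2)%C); replace w with (2 * v)%C by (unfold v; field; auto).
  assert (Hv0 : v <> 0%C).
  { intro E; apply Hw0; replace w with (2 * v)%C by (unfold v; field; auto); rewrite E; ring. }
  assert (Hv : Cmod v <= 2).
  { unfold v; rewrite Cmod_div, Cmod_R, Rabs_pos_eq by (auto; lra); lra. }
  assert (Hvp : 0 < Cmod v) by (now apply Cmod_gt_0).
  assert (H1 := csinh_lb v Hv); assert (H2 := csinh_sub_id v Hv).
  assert (He := exp_pos (-2)); assert (He4 := exp_pos 4).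
  assert (Hs : 0 < Cmod (csinh v)) by (eapply Rlt_le_trans; [|exact H1]; nra).
  assert (Hs0 : csinh v <> 0%C) by (now apply Cmod_gt_0).
  replace (/ (4 * (csinh v * csinh v)) - / (2 * v * (2 * v)))%C
    with (- ((csinh v - v) * (csinh v + v)) / (4 * (v * v) * (csinh v * csinh v)))%C by (field; auto).
  rewrite Cmod_div, Cmod_opp, !Cmod_mult, Cmod_R, Rabs_pos_eq;
    [|lra|apply Cmult_neq_0; [apply Cmult_neq_0; [|apply Cmult_neq_0]|apply Cmult_neq_0]; auto].
  assert (H3 : Cmod (csinh v + v)%C <= Cmod v * (2 + 4 * exp 4)).
  { replace (csinh v + v)%C with ((csinh v - v) + 2 * v)%C by ring.
    eapply Rle_trans; [apply Cmod_triangle|].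
    rewrite Cmod_mult, Cmod_R, Rabs_pos_eq by lra.
    assert (Cmod v ^ 2 <= 4) by nra.
    assert (exp 4 * Cmod v ^ 3 <= exp 4 * (4 * Cmod v)); [|lra].
    apply Rmult_le_compat_l; [lra|]; cbn [pow] in *; nra. }
  assert (H4 : Cmod (csinh v - v)%C * Cmod (csinh v + v)%C
     <= exp 4 * Cmod v ^ 3 * (Cmod v * (2 + 4 * exp 4))).
  { apply Rmult_le_compat; auto; apply Cmod_ge_0. }
  assert (H5 : 4 * (Cmod v * Cmod v) * ((exp (-2) * Cmod v) * (exp (-2) * Cmod v))
     <= 4 * (Cmod v * Cmod v) * (Cmod (csinh v) * Cmod (csinh v))).
  { apply Rmult_le_compat_l; [nra|]; apply Rmult_le_compat; nra. }
  apply Rle_trans with (exp 4 * Cmod v ^ 3 * (Cmod v * (2 + 4 * exp 4))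
     / (4 * (Cmod v * Cmod v) * ((exp (-2) * Cmod v) * (exp (-2) * Cmod v)))).
  - unfold Rdiv; apply Rmult_le_compat.
    + apply Rmult_le_pos; apply Cmod_ge_0.
    + left; apply Rinv_0_lt_compat; repeat apply Rmult_lt_0_compat; lra.
    + exact H4.
    + apply Rinv_le_contravar; [|exact H5].
      repeat apply Rmult_lt_0_compat; lra.
  - right; unfold csb; field; split; lra.
Qed.

(* Partial sum over the indices [-N <= k < N] of [1 / (z + 2 pi i k)^2]. *)
Definition spart (N : nat) (z : C) : C :=
  csum (fun k => / ((z + INR k * tpi) * (z + INR k * tpi))
               + / ((z - INR (S k) * tpi) * (z - INR (S k) * tpi)))%C N.

Lemma neq_0_of_cexp (w z : C) : cexp w = cexp z -> cexp z <> 1%C -> w <> 0%C.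
Proof. intros E H F; apply H; rewrite <- E, F; apply cexp_0. Qed.

(** Each of the 2^(n+1) terms of [sfun_iter] is replaced by its double pole at the cost of [csb] /
    4^(n+1), so the whole error is at most [csb] / 2^n and no tail of the series has to be
    estimated. *)
Lemma sfun_partial_fractions (n : nat) (z : C) : cexp z <> 1%C -> Cmod z <= 2 ^ n ->
  Cmod (sfun z - spart (2 ^ n) z)%C <= csb / 2 ^ n.
Proof.
  intros Hz Hb; rewrite (sfun_iter n z Hz); unfold spart.
  rewrite <- csum_scal, <- csum_minus.
  assert (Hp := pow2_pos n); assert (HPI := PI_bounds).
  assert (Hk : forall w k, (k <= 2 ^ n)%nat -> Cmod w <= INR k * (2 * PI) ->
    forall z', z' = (z + w)%C -> cexp z' = cexp z ->
    Cmod ((/ 4) ^ S n * sfun (z' / 2 ^ S n) - / (z' * z'))%C <= (/ 4) ^ S n * csb).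
  { intros w k Hk Hw z' Ez Ee.
    assert (Hz' : z' <> 0%C) by (now apply (neq_0_of_cexp _ z)).
    replace ((/ 4) ^ S n * sfun (z' / 2 ^ S n) - / (z' * z'))%C
      with ((/ 4) ^ S n * (sfun (z' / 2 ^ S n) - / ((z' / 2 ^ S n) * (z' / 2 ^ S n))))%C.
    - rewrite Cmod_mult, Cmod_pow, <- RtoC_inv, Cmod_R, Rabs_pos_eq by lra.
      apply Rmult_le_compat_l; [apply pow_le; lra|].
      apply sfun_near_0.
      + now apply (cexp_div_pow2 z).
      + intro F; apply Hz'; replace z' with (z' / 2 ^ S n * 2 ^ S n)%C by (field; auto).
        rewrite F; ring.
      + rewrite Cmod_div, Cmod_pow, Cmod_R, Rabs_pos_eq by (auto; lra).
        apply le_INR in Hk; rewrite INR_pow2 in Hk.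
        assert (Hm : Cmod z' <= 2 ^ n + 2 ^ n * (2 * PI)).
        { rewrite Ez; eapply Rle_trans; [apply Cmod_triangle|].
          apply Rplus_le_compat; [exact Hb|eapply Rle_trans; [exact Hw|]].
          apply Rmult_le_compat_r; lra. }
        (* The radius 4 of [sfun_near_0] is enough because 1 + 2 pi < 8. *)
        cbn [pow]; apply Rmult_le_reg_r with (2 * 2 ^ n); [lra|].
        unfold Rdiv; rewrite Rmult_assoc, Rinv_l, Rmult_1_r by lra; nra.
    - replace ((/ 4) ^ S n)%C with (/ (2 ^ S n * 2 ^ S n))%C.
      + assert (HP : (2 ^ S n)%C <> 0%C) by auto.
        generalize dependent (2 ^ S n)%C; intros P HP; field; auto.
      + rewrite <- Cpow_mult_l, Cpow_inv by auto; f_equal; f_equal; rewrite <- RtoC_mult; f_equal; ring. }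
  apply Rle_trans with (rsum (fun _ => 2 * ((/ 4) ^ S n * csb)) (2 ^ n)).
  - apply Cmod_csum_le'; intros k Hkn.
    match goal with |- Cmod ?e <= _ => replace e with
      (((/ 4) ^ S n * sfun ((z + INR k * tpi) / 2 ^ S n) - / ((z + INR k * tpi) * (z + INR k * tpi)))
      + ((/ 4) ^ S n * sfun ((z - INR (S k) * tpi) / 2 ^ S n) - / ((z - INR (S k) * tpi) * (z - INR (S k) * tpi))))%C by ring end.
    eapply Rle_trans; [apply Cmod_triangle|].
    replace (2 * ((/ 4) ^ S n * csb)) with ((/ 4) ^ S n * csb + (/ 4) ^ S n * csb) by ring.
    apply Rplus_le_compat.
    + apply (Hk (INR k * tpi)%C k); [lia| |reflexivity|apply cexp_add_tpi].
      rewrite Cmod_mult, Cmod_INR, Cmod_tpi; lra.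
    + apply (Hk (- (INR (S k) * tpi))%C (S k)); [lia| |reflexivity|apply cexp_sub_tpi].
      rewrite Cmod_opp, Cmod_mult, Cmod_INR, Cmod_tpi; lra.
  - rewrite rsum_const, INR_pow2; cbn [pow].
    replace ((/ 4) ^ n) with (/ 2 ^ n * / 2 ^ n).
    + assert (H0 : 0 <= csb / 2 ^ n) by (apply Rlt_le, Rdiv_lt_0_compat; [apply csb_pos|lra]).
      apply Rle_trans with (csb / 2 ^ n / 2); [right; field; lra|lra].
    + rewrite <- !pow_inv, <- Rpow_mult_distr; f_equal; field.
Qed.

Lemma cexp_neq_1_re (z : C) : 0 < Re z -> cexp z <> 1%C.
Proof.
  intros H E; assert (E' := cexp_mod z); rewrite E, Cmod_1 in E'.
  generalize (exp_increasing 0 (Re z) H); rewrite exp_0; lra.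
Qed.

Lemma cexp_neq_1_minus (z : C) : cexp z <> 1%C -> (cexp z - 1)%C <> 0%C.
Proof. intros H F; apply H; replace (cexp z) with (cexp z - 1 + 1)%C by ring; rewrite F; ring. Qed.

Lemma cexp_neq_1_seg (z : C) (s : R) : 0 < Re z -> 0 <= s <= 1 ->
  cexp (tpi / 2 + s * (z - tpi / 2))%C <> 1%C.
Proof.
  intros Hz [[Hs|<-] _].
  - apply cexp_neq_1_re.
    replace (Re (tpi / 2 + s * (z - tpi / 2))) with (s * Re z); [nra|].
    destruct z; unfold tpi; cbn; field.
  - replace (tpi / 2 + 0%R * (z - tpi / 2))%C with (0 + tpi / 2)%C by ring.
    rewrite cexp_half_tpi, cexp_0; intro E.
    apply (C_neq_R (-1) 1); [lra|]; rewrite <- E, <- RtoC_opp; reflexivity.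
Qed.

Lemma derC_bos (f : R -> C) (x : R) (l : C) : cexp (f x) <> 1%C ->
  derC f x l -> derC (fun s => bos (f s)) x (- (l * sfun (f x)))%C.
Proof.
  intros Hn Hf; assert (Hn' := cexp_neq_1_minus _ Hn); unfold bos.
  eapply derC_eq.
  - apply (derC_inv (fun s => (cexp (f s) - 1)%C)); [exact Hn'|].
    exact (derC_minus _ _ _ _ _ (derC_cexp _ _ _ Hf) (derC_const 1 x)).
  - cbv beta; unfold sfun; field; exact Hn'.
Qed.

Lemma derC_shift_inv (f : R -> C) (x : R) (l a : C) : (f x + a)%C <> 0%C ->
  derC f x l -> derC (fun s => (/ (f s + a))%C) x (- (l * / ((f x + a) * (f x + a))))%C.
Proof.
  intros Hn Hf; eapply derC_eq.
  - apply (derC_inv (fun s => (f s + a)%C)); [exact Hn|].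
    exact (derC_plus _ _ _ _ _ Hf (derC_const a x)).
  - field; exact Hn.
Qed.

(** This is coth (z/2) / 2. *)
Definition cfun (z : C) : C := (/ 2 + bos z)%C.

Definition cpart (N : nat) (z : C) : C :=
  csum (fun k => / (z + INR k * tpi) + / (z - INR (S k) * tpi))%C N.

Lemma tpi_neq_0 : tpi <> 0%C.
Proof. apply Cmod_gt_0; rewrite Cmod_tpi; generalize PI_bounds; lra. Qed.

(* Both sides vanish at [z = pi i], and their derivatives are those of
   [sfun_partial_fractions]. *)
Lemma cfun_partial_fractions (n : nat) (z : C) : 0 < Re z -> Cmod z <= 2 ^ n -> 4 <= 2 ^ n ->
  Cmod (cfun z - cpart (2 ^ n) z)%C <= 2 * (Cmod (z - tpi / 2)%C * (csb / 2 ^ n)).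
Proof.
  intros Hz Hb H4.
  set (g := fun s : R => (tpi / 2 + s * (z - tpi / 2))%C).
  assert (Hg : forall s, 0 <= s <= 1 -> cexp (g s) <> 1%C)
    by (intros s Hs; now apply cexp_neq_1_seg).
  assert (Dg : forall s, derC g s (z - tpi / 2)%C) by (intro s; apply derC_lin).
  assert (H := derC_MVT (fun s => (cfun (g s) - cpart (2 ^ n) (g s))%C)
     (fun s => (- ((z - tpi / 2) * (sfun (g s) - spart (2 ^ n) (g s))))%C)
     (Cmod (z - tpi / 2)%C * (csb / 2 ^ n))).
  cbv beta in H; replace (g 1) with z in H by (unfold g; ring).
  replace (cfun (g 0) - cpart (2 ^ n) (g 0))%C with (RtoC 0) in H.
  - replace (cfun z - cpart (2 ^ n) z)%C with (cfun z - cpart (2 ^ n) z - 0)%C by ring.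
    apply H; intros s Hs.
    + eapply derC_eq.
      * apply derC_minus.
        -- apply (derC_plus (fun _ => / 2)%C); [apply derC_const|apply derC_bos; [now apply Hg|apply Dg]].
        -- apply (derC_csum (fun k s => / (g s + INR k * tpi) + / (g s - INR (S k) * tpi))%C).
           intros k _; apply derC_plus; apply derC_shift_inv; try apply Dg.
           ++ apply (neq_0_of_cexp _ (g s)); [apply cexp_add_tpi|now apply Hg].
           ++ apply (neq_0_of_cexp _ (g s)); [apply cexp_sub_tpi|now apply Hg].
      * unfold spart.
        replace (csum _ (2 ^ n)) with (- ((z - tpi / 2) * csum (fun k => / ((g s + INR k * tpi) * (g s + INR k * tpi))
               + / ((g s - INR (S k) * tpi) * (g s - INR (S k) * tpi)))%C (2 ^ n)))%C.
        -- ring.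
        -- rewrite <- csum_scal, <- csum_opp; apply csum_ext; intros k _; unfold Cminus; ring.
    + rewrite Cmod_opp, Cmod_mult; apply Rmult_le_compat_l; [apply Cmod_ge_0|].
      apply sfun_partial_fractions; [now apply Hg|].
      unfold g; replace (tpi / 2 + s * (z - tpi / 2))%C with (s * z + (1 - s) * (tpi / 2))%C by ring.
      eapply Rle_trans; [apply Cmod_triangle|].
      rewrite <- RtoC_minus, !Cmod_mult, !Cmod_R, !Rabs_pos_eq by lra.
      rewrite Cmod_div, Cmod_tpi, Cmod_R, Rabs_pos_eq by (auto; lra).
      generalize PI_bounds; intro; nra.
  - unfold g; replace (tpi / 2 + 0%R * (z - tpi / 2))%C with (0 + tpi / 2)%C by ring.
    unfold cpart; rewrite csum_0.
    + unfold cfun, bos; rewrite cexp_half_tpi, cexp_0; field.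
    (* The poles with indices k and -k-1 lie symmetrically about pi i, so the summands cancel in
       pairs. *)
    + intros k _.
      assert (Hk : RtoC (INR k + / 2) <> 0%C) by (apply C_neq_R; generalize (pos_INR k); lra).
      assert (T := tpi_neq_0).
      replace (0 + tpi / 2 + INR k * tpi)%C with ((INR k + / 2)%R * tpi)%C
        by (rewrite RtoC_plus, RtoC_inv by lra; field; auto).
      replace (0 + tpi / 2 - INR (S k) * tpi)%C with (- ((INR k + / 2)%R * tpi))%C
        by (rewrite S_INR, !RtoC_plus, RtoC_inv by lra; field; auto).
      field; auto.
Qed.

Definition zpart (N : nat) : R := rsum (fun m => / (INR (S m) ^ 2)) N.

(** The partial fractions are evaluated at z = pi i, where [sfun] equals -1/4 and the lattice points
    are odd multiples of pi i. *)
Lemma odd_squares (n : nat) : (2 <= n)%nat ->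
  Rabs (rsum (fun k => / ((2 * INR k + 1) ^ 2)) (2 ^ n) - PI ^ 2 / 8) <= PI ^ 2 / 2 * (csb / 2 ^ n).
Proof.
  intro Hn; assert (HPI := PI_bounds).
  assert (Hz : cexp (tpi / 2)%C = (- (1))%C).
  { replace (tpi / 2)%C with (0 + tpi / 2)%C by ring; rewrite cexp_half_tpi, cexp_0; reflexivity. }
  assert (H1 : cexp (tpi / 2)%C <> 1%C).
  { rewrite Hz, <- RtoC_opp; apply C_neq_R; lra. }
  assert (H2 : Cmod (tpi / 2)%C <= 2 ^ n).
  { rewrite Cmod_div, Cmod_tpi, Cmod_R, Rabs_pos_eq by (auto; lra).
    generalize (Rle_pow 2 2 n ltac:(lra) Hn); lra. }
  assert (H := sfun_partial_fractions n (tpi / 2)%C H1 H2).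
  replace (sfun (tpi / 2)) with (RtoC (- / 4)) in H.
  - replace (spart (2 ^ n) (tpi / 2))%C
      with (RtoC (- (2 / PI ^ 2) * rsum (fun k => / ((2 * INR k + 1) ^ 2)) (2 ^ n))) in H.
    + rewrite <- RtoC_minus, Cmod_R in H.
      set (S := rsum _ _) in *.
      replace (S - PI ^ 2 / 8) with (PI ^ 2 / 2 * (- / 4 - - (2 / PI ^ 2) * S)) by (field; lra).
      rewrite Rabs_mult, Rabs_pos_eq by (apply Rmult_le_pos; [apply pow2_ge_0|lra]).
      apply Rmult_le_compat_l; [apply Rmult_le_pos; [apply pow2_ge_0|lra]|exact H].
    + unfold spart; rewrite <- rsum_scal, <- csum_R; apply csum_ext; intros k _.
      assert (Hk := pos_INR k).
      apply injective_projections; unfold tpi; rewrite S_INR; cbn; field; repeat split; nra.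
  - unfold sfun; rewrite Hz; apply injective_projections; cbn; field.
Qed.

Lemma zpart_split (N : nat) :
  zpart (N + N) = rsum (fun k => / ((2 * INR k + 1) ^ 2)) N + / 4 * zpart N.
Proof.
  induction N as [|N IH]; [cbn; ring|].
  replace (S N + S N)%nat with (S (S (N + N))) by lia.
  unfold zpart in *; cbn [rsum]; rewrite IH, !S_INR, plus_INR.
  assert (H := pos_INR N); field; repeat split; nra.
Qed.

(** Euler's value of zeta(2). The limit Z exists by monotonicity, and splitting off the even squares
    along the subsequence 2^n gives Z - Z/4 = pi^2/8. *)
Lemma zpart_lim : is_lim_seq zpart (PI ^ 2 / 6).
Proof.
  assert (Hex : ex_finite_lim_seq zpart).
  { apply ex_finite_lim_seq_incr with 2.
    - intro n; unfold zpart; cbn [rsum].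
      assert (0 < / INR (S n) ^ 2) by (apply Rinv_0_lt_compat, pow_lt, lt_0_INR; lia); lra.
    - assert (G : forall n, zpart (S n) <= 2 - / INR (S n)).
      { induction n as [|n IH]; [unfold zpart; cbn; lra|].
        unfold zpart in *; cbn [rsum] in *; rewrite (S_INR (S n)).
        assert (Hp : 0 < INR (S n)) by (apply lt_0_INR; lia).
        set (x := INR (S n)) in *.
        assert (/ (x + 1) ^ 2 <= / x - / (x + 1)); [|lra].
        replace (/ x - / (x + 1)) with (/ (x * (x + 1))) by (field; lra).
        apply Rinv_le_contravar; nra. }
      intros [|n]; [unfold zpart; cbn; lra|].
      assert (0 < / INR (S n)) by (apply Rinv_0_lt_compat, lt_0_INR; lia).
      generalize (G n); lra. }
  destruct Hex as [Z HZ].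
  assert (Hp2 : forall c, filterlim (fun n => (2 ^ (n + c))%nat) eventually eventually).
  { intro c; apply eventually_subseq; intro n.
    rewrite Nat.add_succ_l; apply Nat.pow_lt_mono_r; lia. }
  assert (L1 := is_lim_seq_subseq _ _ _ (Hp2 1%nat) HZ).
  assert (L0 := is_lim_seq_subseq _ _ _ (Hp2 0%nat) HZ).
  assert (LO : is_lim_seq (fun n => zpart (2 ^ (n + 1)) - / 4 * zpart (2 ^ (n + 0))) (Z - / 4 * Z)).
  { apply is_lim_seq_minus'; [exact L1|].
    apply is_lim_seq_mult'; [apply is_lim_seq_const|exact L0]. }
  assert (LP : is_lim_seq (fun n => zpart (2 ^ (n + 1)) - / 4 * zpart (2 ^ (n + 0))) (PI ^ 2 / 8)).
  { apply is_lim_seq_ext with (fun n => (rsum (fun k => / ((2 * INR k + 1) ^ 2)) (2 ^ n) - PI ^ 2 / 8) + PI ^ 2 / 8).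
    - intro n; rewrite Nat.add_0_r, Nat.add_1_r.
      replace (2 ^ S n)%nat with (2 ^ n + 2 ^ n)%nat by (cbn; lia); rewrite zpart_split; ring.
    - replace (Finite (PI ^ 2 / 8)) with (Finite (0 + PI ^ 2 / 8)) by (f_equal; ring).
      apply is_lim_seq_plus'; [|apply is_lim_seq_const].
      apply is_lim_seq_abs_0, lim0_squeeze with (fun n => PI ^ 2 / 2 * csb * / 2 ^ n).
      + exists 2%nat; intros n Hn; split; [apply Rabs_pos|].
        eapply Rle_trans; [now apply odd_squares|right; field; apply pow_nonzero; lra].
      + apply is_lim_seq_0_scal, (is_lim_seq_ext (fun n => (/ 2) ^ n)).
        * intro n; apply pow_inv.
        * apply is_lim_seq_geom; rewrite Rabs_pos_eq; lra. }
  assert (E := is_lim_seq_unique _ _ LO); rewrite (is_lim_seq_unique _ _ LP) in E.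
  injection E; intro E'; replace (PI ^ 2 / 6) with Z by lra; exact HZ.
Qed.

#[local] Hint Resolve tpi_neq_0 : core.

(** * The quasi-modularity of the weight two Eisenstein series *)

Lemma clim_csum (u : nat -> nat -> C) (l : nat -> C) (N : nat) :
  (forall k, (k < N)%nat -> clim (u k) (l k)) ->
  clim (fun n => csum (fun k => u k n) N) (csum l N).
Proof.
  induction N as [|N IH]; intro H; cbn; [apply clim_const|].
  apply clim_plus; [apply IH; intros; apply H; lia|apply H; lia].
Qed.

(** Passes from the pairing of k with -k-1, produced by the doubling, to the symmetric pairing of k
    with -k. *)
Lemma csum_shift_pair (f g : nat -> C) (N : nat) :
  csum (fun k => (f k + g (S k))%C) N = (f O - f N + csum (fun k => (f (S k) + g (S k))%C) N)%C.
Proof. induction N as [|N IH]; cbn [csum]; [ring|rewrite IH; ring]. Qed.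

Lemma bos_bound (z : C) : 0 < Re z -> Cmod (bos z) <= / (exp (Re z) - 1).
Proof.
  intro H; assert (He := exp_ineq1 (Re z) ltac:(lra)); unfold bos.
  rewrite Cmod_inv by (now apply cexp_neq_1_minus, cexp_neq_1_re).
  apply Rinv_le_contravar; [lra|].
  generalize (Cmod_Rabs_triang (cexp z) (- (1))); rewrite Cmod_opp, Cmod_1, cexp_mod.
  unfold Cminus; lra.
Qed.

Lemma is_lim_seq_inv_pow2 (c : R) : is_lim_seq (fun n => c / 2 ^ n) 0.
Proof.
  apply (is_lim_seq_0_scal c (fun n => / 2 ^ n)), (is_lim_seq_ext (fun n => (/ 2) ^ n)).
  - intro n; apply pow_inv.
  - apply is_lim_seq_geom; rewrite Rabs_pos_eq; lra.
Qed.

Lemma pow2_eventually (x : R) : eventually (fun n => x <= 2 ^ n).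
Proof.
  destruct (Pow_x_infinity 2 ltac:(rewrite Rabs_pos_eq; lra) x) as [N HN].
  exists N; intros n Hn; specialize (HN n Hn).
  rewrite Rabs_pos_eq in HN; [lra|apply Rlt_le, pow2_pos].
Qed.

Section EisensteinSum.
Variables (a B : R) (t : C).
Hypothesis a_pos : 0 < a.
Hypothesis t_re : a <= Re t.
Hypothesis t_mod : Cmod t <= B.

Let c := a / (1 + a + B).

Lemma B_ge_a : a <= B.
Proof. generalize (re_le_Cmod' t); lra. Qed.

Lemma c_pos : 0 < c.
Proof. generalize B_ge_a; intro; apply Rdiv_lt_0_compat; lra. Qed.

(** The real part controls m through m a <= |z|, and then the imaginary period controls k through 2
    pi k <= |z| + m B. The constant is uniform in t, as the later integration along a segment
    requires. *)
Lemma lattice_lb (z : C) (m k : nat) :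
  z = (INR m * t + INR k * tpi)%C \/ z = (INR m * t - INR k * tpi)%C ->
  c * (INR m + INR k) <= Cmod z.
Proof.
  intro Hz; assert (HB := B_ge_a); assert (HPI := PI_bounds).
  assert (Hm := pos_INR m); assert (Hk := pos_INR k).
  assert (H1 : INR m * a <= Cmod z).
  { apply Rle_trans with (Re z); [|apply re_le_Cmod'].
    replace (Re z) with (INR m * Re t); [nra|].
    destruct Hz as [-> | ->]; destruct t; cbn; ring. }
  assert (H2 : INR k <= Cmod z + INR m * B).
  { apply Rle_trans with (Cmod (INR k * tpi)%C).
    - rewrite Cmod_mult, Cmod_INR, Cmod_tpi; nra.
    - apply Rle_trans with (Cmod z + Cmod (INR m * t)%C).
      + destruct Hz as [-> | ->].
        * replace (INR k * tpi)%C with ((INR m * t + INR k * tpi) + - (INR m * t))%C at 1 by ring.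
          eapply Rle_trans; [apply Cmod_triangle|rewrite Cmod_opp; lra].
        * replace (INR k * tpi)%C with (- (INR m * t - INR k * tpi) + (INR m * t))%C at 1 by ring.
          eapply Rle_trans; [apply Cmod_triangle|rewrite Cmod_opp; lra].
      + rewrite (Cmod_mult (INR m)), Cmod_INR; nra. }
  unfold c, Rdiv; apply Rmult_le_reg_r with (1 + a + B); [lra|].
  replace (a * / (1 + a + B) * (INR m + INR k) * (1 + a + B)) with (a * (INR m + INR k)) by (field; lra).
  nra.
Qed.

Lemma lattice_neq_0 (z : C) (m k : nat) : (0 < m + k)%nat ->
  z = (INR m * t + INR k * tpi)%C \/ z = (INR m * t - INR k * tpi)%C -> z <> 0%C.
Proof.
  intros Hmk Hz; apply Cmod_gt_0; eapply Rlt_le_trans; [|exact (lattice_lb z m k Hz)].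
  apply Rmult_lt_0_compat; [apply c_pos|rewrite <- plus_INR; now apply lt_0_INR].
Qed.

Definition eterm (m k : nat) : C :=
  (/ ((INR m * t + INR k * tpi) * (INR m * t + INR k * tpi))
   + / ((INR m * t - INR k * tpi) * (INR m * t - INR k * tpi)))%C.

Definition vterm (m k : nat) : C :=
  ((/ (INR m * t - INR k * tpi) - / (INR m * t + INR k * tpi)) / tpi)%C.

(* [vterm] telescopes in [k] and approximates [eterm] up to O((m + k)^-3), so
   the double series of [dterm] converges absolutely and may be summed in
   either order; the boundary terms of [vterm] produce the quasi-modular
   correction. *)
Definition dterm (m k : nat) : C := (eterm m (S k) - (vterm m (S k) - vterm m k))%C.

(** With p' = p - 2 pi i and q' = q + 2 pi i the term is exactly -2 pi i / (p^2 p') + 2 pi i / (q^2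
    q'), hence of cubic decay. The factor 1/2 lost on p' and q' is available because m >= 1. *)
Lemma dterm_bound (m k : nat) : (1 <= m)%nat ->
  Cmod (dterm m k) <= 8 * PI / c ^ 3 / (INR m + INR (S k)) ^ 3.
Proof.
  intro Hm; assert (HPI := PI_bounds); assert (Hc := c_pos).
  assert (Hm' : 1 <= INR m) by (apply (le_INR 1); exact Hm).
  assert (Hk' := pos_INR k).
  set (p := (INR m * t + INR (S k) * tpi)%C); set (p' := (INR m * t + INR k * tpi)%C).
  set (q := (INR m * t - INR (S k) * tpi)%C); set (q' := (INR m * t - INR k * tpi)%C).
  assert (Bp : c * (INR m + INR (S k)) <= Cmod p) by (apply lattice_lb; now left).
  assert (Bq : c * (INR m + INR (S k)) <= Cmod q) by (apply lattice_lb; now right).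
  assert (Bp' : c * (INR m + INR k) <= Cmod p') by (apply lattice_lb; now left).
  assert (Bq' : c * (INR m + INR k) <= Cmod q') by (apply lattice_lb; now right).
  assert (Np : p <> 0%C) by (apply (lattice_neq_0 p m (S k)); [lia|now left]).
  assert (Nq : q <> 0%C) by (apply (lattice_neq_0 q m (S k)); [lia|now right]).
  assert (Np' : p' <> 0%C) by (apply (lattice_neq_0 p' m k); [lia|now left]).
  assert (Nq' : q' <> 0%C) by (apply (lattice_neq_0 q' m k); [lia|now right]).
  assert (Ep : (p - p')%C = tpi) by (unfold p, p'; rewrite S_INR, RtoC_plus; ring).
  assert (Eq : (q' - q)%C = tpi) by (unfold q, q'; rewrite S_INR, RtoC_plus; ring).
  set (x := INR m + INR (S k)) in *.
  assert (Hx : INR m + INR k >= x / 2) by (unfold x; rewrite S_INR; lra).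
  assert (Hx0 : 0 < x) by (unfold x; rewrite S_INR; lra).
  assert (G : forall u w : C, u <> 0%C -> w <> 0%C -> c * x <= Cmod u -> c * (INR m + INR k) <= Cmod w ->
     Cmod (tpi / (u * u * w))%C <= 4 * PI / c ^ 3 / x ^ 3).
  { intros u w Nu Nw Bu Bw.
    rewrite Cmod_div, !Cmod_mult, Cmod_tpi by (repeat apply Cmult_neq_0; auto).
    apply Rle_trans with (2 * PI / ((c * x) * (c * x) * (c * x / 2))).
    - apply Rmult_le_compat_l; [lra|].
      assert (Hcx : 0 < c * x) by nra.
      assert (Hcx2 : 0 < (c * x) * (c * x)) by (apply Rmult_lt_0_compat; exact Hcx).
      apply Rinv_le_contravar; [apply Rmult_lt_0_compat; lra|].
      apply Rmult_le_compat; [lra|lra|apply Rmult_le_compat; lra|].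
      eapply Rle_trans; [|exact Bw].
      replace (c * x / 2) with (c * (x / 2)) by field; apply Rmult_le_compat_l; lra.
    - right; field; split; lra. }
  unfold dterm, eterm, vterm; fold p q p' q'.
  replace (/ (p * p) + / (q * q) - ((/ q - / p) / tpi - (/ q' - / p') / tpi))%C
    with (- (tpi / (p * p * p')) + tpi / (q * q * q'))%C.
  - eapply Rle_trans; [apply Cmod_triangle|]; rewrite Cmod_opp.
    replace (8 * PI / c ^ 3 / x ^ 3) with (4 * PI / c ^ 3 / x ^ 3 + 4 * PI / c ^ 3 / x ^ 3) by (field; split; lra).
    apply Rplus_le_compat; apply G; auto.
  - assert (Hq : q' = (q + tpi)%C) by (rewrite <- Eq; ring).
    assert (Hp : p' = (p - tpi)%C) by (rewrite <- Ep; ring).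
    rewrite Hq, Hp in *; field; auto.
Qed.

Definition dsum (M K : nat) : C := csum (fun i => csum (fun j => dterm (S i) j) K) M.

Lemma inv_cube_tail (M L : nat) : (1 <= M)%nat ->
  rsum (fun j => / INR (S (M + j)) ^ 3) L <= / INR M * / INR M.
Proof.
  intro HM; assert (HM' : 1 <= INR M) by (apply (le_INR 1); exact HM).
  apply Rle_trans with (rsum (fun j => / INR M * (/ INR (M + j) - / INR (M + S j))) L).
  - apply rsum_le; intros j _.
    rewrite Nat.add_succ_r, S_INR, plus_INR; assert (Hj := pos_INR j).
    set (x := INR M + INR j); assert (Hx : INR M <= x) by (unfold x; lra).
    replace (/ x - / (x + 1)) with (/ (x * (x + 1))) by (field; lra).
    rewrite <- Rinv_mult; apply Rinv_le_contravar; [repeat apply Rmult_lt_0_compat; lra|].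
    apply Rle_trans with (x * (x * (x + 1))); [apply Rmult_le_compat_r; nra|cbn; nra].
  - rewrite rsum_scal, (rsum_telescope (fun j => / INR (M + j))), Nat.add_0_r.
    apply Rmult_le_compat_l; [left; apply Rinv_0_lt_compat; lra|].
    assert (0 < / INR (M + L)) by (apply Rinv_0_lt_compat, lt_0_INR; lia); lra.
Qed.

Let K0 := 8 * PI / c ^ 3.

Lemma K0_pos : 0 < K0.
Proof.
  generalize PI_bounds c_pos; intros; apply Rdiv_lt_0_compat; [lra|apply pow_lt; lra].
Qed.

(** M rows with tails of order M^-2 give M^-1; quadratic decay of the terms would not suffice
    here. *)
Lemma tail_block (f : nat -> nat -> C) (M L : nat) : (1 <= M)%nat ->
  (forall i j, Cmod (f i j) <= K0 / INR (S (M + j)) ^ 3) ->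
  Cmod (csum (fun i => csum (f i) L) M) <= K0 / INR M.
Proof.
  intros HM Hf; assert (HM' : 1 <= INR M) by (apply (le_INR 1); exact HM).
  assert (HK := K0_pos).
  apply Rle_trans with (rsum (fun _ => K0 * (/ INR M * / INR M)) M).
  - apply Cmod_csum_le'; intros i _.
    eapply Rle_trans; [apply Cmod_csum_le'; intros j _; apply Hf|].
    unfold Rdiv; rewrite (rsum_scal K0 (fun j => / INR (S (M + j)) ^ 3)).
    apply Rmult_le_compat_l; [lra|now apply inv_cube_tail].
  - rewrite rsum_const; right; field; lra.
Qed.

Lemma dterm_bound_l (i j M : nat) : Cmod (dterm (S i) (M + j)) <= K0 / INR (S (M + j)) ^ 3.
Proof.
  eapply Rle_trans; [apply dterm_bound; lia|].
  assert (HK := K0_pos); unfold K0 in HK |- *.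
  apply Rmult_le_compat_l; [lra|]; apply Rinv_le_contravar.
  - apply pow_lt, lt_0_INR; lia.
  - apply pow_incr; generalize (pos_INR (S i)) (pos_INR (S (M + j))); lra.
Qed.

Lemma dterm_bound_r (i j M : nat) : Cmod (dterm (S (M + j)) i) <= K0 / INR (S (M + j)) ^ 3.
Proof.
  eapply Rle_trans; [apply dterm_bound; lia|].
  assert (HK := K0_pos); unfold K0 in HK |- *.
  apply Rmult_le_compat_l; [lra|]; apply Rinv_le_contravar.
  - apply pow_lt, lt_0_INR; lia.
  - apply pow_incr; generalize (pos_INR (S i)) (pos_INR (S (M + j))); lra.
Qed.

(** Rectangles elongated in either direction stay within [K0] / M of the M by M square. The square
    thus mediates between the two orders of summation. *)
Lemma dsum_cauchy_l (M K : nat) : (1 <= M <= K)%nat -> Cmod (dsum M K - dsum M M)%C <= K0 / INR M.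
Proof.
  intros H; unfold dsum; rewrite <- csum_minus.
  replace K with (M + (K - M))%nat by lia.
  erewrite csum_ext; [apply (tail_block (fun i j => dterm (S i) (M + j)) M (K - M)); [lia|]|].
  - intros i j; apply dterm_bound_l.
  - intros i _; cbv beta; rewrite csum_add_index; ring.
Qed.

Lemma dsum_cauchy_r (M K : nat) : (1 <= M <= K)%nat -> Cmod (dsum K M - dsum M M)%C <= K0 / INR M.
Proof.
  intros H; unfold dsum; rewrite !(csum_swap (fun i j => dterm (S i) j)), <- csum_minus.
  replace K with (M + (K - M))%nat by lia.
  erewrite csum_ext; [apply (tail_block (fun i j => dterm (S (M + j)) i) M (K - M)); [lia|]|].
  - intros i j; apply dterm_bound_r.
  - intros i _; cbv beta; rewrite csum_add_index; ring.
Qed.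

Definition esum (M K : nat) : C := csum (fun i => csum (fun j => eterm (S i) (S j)) K) M.

Lemma esum_dsum (M K : nat) : esum M K = (dsum M K + csum (fun i => vterm (S i) K) M)%C.
Proof.
  unfold esum, dsum; rewrite <- csum_plus; apply csum_ext; intros i _.
  unfold dterm; rewrite csum_minus, csum_telescope.
  (* The two fractions of [vterm] coincide at k = 0, so only the upper boundary term survives the
     telescoping. *)
  replace (vterm (S i) 0) with (RtoC 0); [ring|].
  unfold vterm; change (INR 0) with 0.
  replace (INR (S i) * t - 0 * tpi)%C with (INR (S i) * t + 0 * tpi)%C by ring.
  unfold Cdiv; ring.
Qed.

Lemma pow2_large (x : R) : exists N, forall n, (N <= n)%nat -> x <= INR (2 ^ n).
Proof.
  destruct (pow2_eventually x) as [N H]; exists N; intros n Hn; rewrite INR_pow2; now apply H.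
Qed.

Lemma lattice_inv_lim (m : nat) (s : nat -> C) :
  (forall k, s k = (INR m * t + INR k * tpi)%C \/ s k = (INR m * t - INR k * tpi)%C) ->
  clim (fun n => (/ s (2 ^ n)%nat)%C) 0.
Proof.
  intro Hs; assert (Hc := c_pos).
  apply clim_bound with (fun n => / c / 2 ^ n); [|apply is_lim_seq_inv_pow2].
  exists O; intros n _; replace (/ s (2 ^ n)%nat - 0)%C with (/ s (2 ^ n)%nat)%C by ring.
  assert (H := lattice_lb _ m (2 ^ n) (Hs _)); rewrite INR_pow2 in H.
  assert (Hp := pow2_pos n); assert (Hm := pos_INR m).
  assert (H0 : 0 < c * 2 ^ n) by nra.
  assert (Hn : s (2 ^ n)%nat <> 0%C) by (apply Cmod_gt_0; nra).
  rewrite Cmod_inv by exact Hn.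
  unfold Rdiv; rewrite <- Rinv_mult; apply Rinv_le_contravar; nra.
Qed.

Lemma row_lim (m : nat) : (1 <= m)%nat ->
  clim (fun n => csum (fun j => eterm m (S j)) (2 ^ n))
       (sfun (INR m * t) - / ((INR m * t) * (INR m * t)))%C.
Proof.
  intro Hm; set (z := (INR m * t)%C).
  assert (Hz : 0 < Re z).
  { unfold z; rewrite re_scal_l; apply Rmult_lt_0_compat; [apply lt_0_INR; lia|lra]. }
  assert (Hz1 := cexp_neq_1_re z Hz).
  set (s := fun k : nat => (z + INR k * tpi)%C).
  apply clim_ext with (fun n => (spart (2 ^ n) z - / (z * z) + / s (2 ^ n)%nat * / s (2 ^ n)%nat)%C).
  - intro n; unfold spart.
    rewrite (csum_shift_pair (fun k => / ((z + INR k * tpi) * (z + INR k * tpi)))%C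
                             (fun k => / ((z - INR k * tpi) * (z - INR k * tpi)))%C).
    unfold eterm; fold z; change (INR 0) with 0.
    replace (z + 0 * tpi)%C with z by ring.
    assert (Hsn : (z + INR (2 ^ n) * tpi)%C <> 0%C).
    { apply (lattice_neq_0 _ m (2 ^ n)); [lia|now left]. }
    unfold s; set (e := csum _ _); field; split; [exact Hsn|].
    intro F; rewrite F in Hz; cbn in Hz; lra.
  - replace (sfun z - / (z * z))%C with (sfun z - / (z * z) + 0 * 0)%C by ring.
    apply clim_plus.
    + apply clim_minus; [|apply clim_const].
      apply clim_bound with (fun n => csb / 2 ^ n); [|apply is_lim_seq_inv_pow2].
      destruct (pow2_eventually (Cmod z)) as [N HN]; exists N; intros n Hn.
      rewrite Cmod_minus_comm; apply sfun_partial_fractions; auto.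
    + apply clim_mult; apply (lattice_inv_lim m s); intro k; now left.
Qed.

Lemma vterm_lim (m : nat) : (1 <= m)%nat -> clim (fun n => vterm m (2 ^ n)) 0.
Proof.
  intro Hm; unfold vterm.
  replace (RtoC 0) with ((0 - 0) * / tpi)%C by ring.
  apply (clim_mult (fun n => (/ (INR m * t - INR (2 ^ n) * tpi) - / (INR m * t + INR (2 ^ n) * tpi))%C));
    [apply clim_minus|apply clim_const].
  - apply (lattice_inv_lim m (fun k => (INR m * t - INR k * tpi)%C)); intro k; now right.
  - apply (lattice_inv_lim m (fun k => (INR m * t + INR k * tpi)%C)); intro k; now left.
Qed.

(** A truncation of the Lambert series of sigma(n) q^n, the nonconstant part of the Eisenstein
    series of weight two, with the lattice points of index k = 0 removed. *)
Definition alpha (M : nat) : C :=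
  csum (fun i => sfun (INR (S i) * t) - / ((INR (S i) * t) * (INR (S i) * t)))%C M.

(** When each row is summed first, the boundary terms [vterm] tend to 0, so this order produces no
    correction. *)
Lemma alpha_dsum (M : nat) : (1 <= M)%nat -> Cmod (alpha M - dsum M M)%C <= K0 / INR M.
Proof.
  intro HM.
  apply (clim_Cmod_le (fun n => dsum M (2 ^ n)) _ _ (fun _ => K0 / INR M)).
  - apply clim_ext with (fun n => (esum M (2 ^ n) - csum (fun i => vterm (S i) (2 ^ n)) M)%C).
    + intro n; rewrite esum_dsum; ring.
    + replace (alpha M) with (alpha M - csum (fun _ => 0) M)%C
        by (rewrite (csum_0 (fun _ => RtoC 0)) by reflexivity; ring).
      apply clim_minus.
      * apply (clim_csum (fun i n => csum (fun j => eterm (S i) (S j)) (2 ^ n))).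
        intros k _; apply row_lim; lia.
      * apply (clim_csum (fun i n => vterm (S i) (2 ^ n))).
        intros k _; apply vterm_lim; lia.
  - apply is_lim_seq_const.
  - destruct (pow2_large (INR M)) as [N HN]; exists N; intros n Hn.
    apply dsum_cauchy_l; split; [exact HM|apply INR_le; auto].
Qed.

End EisensteinSum.

(** This is 4 pi^2 / t, the image of t under the modular inversion tau -> -1/tau when t = -2 pi i
    tau. *)
Definition tdual (t : C) : C := (- (tpi * tpi) / t)%C.

Lemma tpi_sq : (tpi * tpi)%C = RtoC (- (2 * PI) ^ 2).
Proof. unfold tpi; apply injective_projections; cbn; ring. Qed.

Lemma re_neq_0 (t : C) : 0 < Re t -> t <> 0%C.
Proof. intros H F; rewrite F in H; cbn in H; lra. Qed.

Lemma re_tdual (t : C) : 0 < Re t -> Re (tdual t) = (2 * PI) ^ 2 * (Re t / Cmod t ^ 2).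
Proof.
  intro H; assert (Hp : 0 < Cmod t ^ 2) by (apply pow_lt, Cmod_gt_0, re_neq_0, H).
  unfold tdual; rewrite tpi_sq, <- RtoC_opp, Ropp_involutive.
  unfold Cdiv; rewrite re_scal_l; f_equal; rewrite Cmod2_alt in *.
  destruct t; reflexivity.
Qed.

Lemma re_tdual_pos (t : C) : 0 < Re t -> 0 < Re (tdual t).
Proof.
  intro H; rewrite re_tdual by exact H; generalize PI_bounds; intro.
  apply Rmult_lt_0_compat; [apply pow_lt; lra|].
  apply Rdiv_lt_0_compat; [exact H|apply pow_lt, Cmod_gt_0, re_neq_0, H].
Qed.

(** Multiplication by 2 pi i / t carries the lattice of t to the lattice of [tdual t] and exchanges
    the two indices. *)
Lemma eterm_dual (t : C) (m k : nat) : 0 < Re t -> (1 <= m + k)%nat ->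
  eterm t m k = (tpi * tpi / (t * t) * eterm (tdual t) k m)%C.
Proof.
  intros Ht Hmk; assert (Ht0 := re_neq_0 t Ht); assert (T := tpi_neq_0).
  assert (H1 : (INR m * t + INR k * tpi)%C <> 0%C).
  { apply (lattice_neq_0 (Re t) (Cmod t) t Ht ltac:(lra) ltac:(lra) _ m k); [lia|now left]. }
  assert (H2 : (INR m * t - INR k * tpi)%C <> 0%C).
  { apply (lattice_neq_0 (Re t) (Cmod t) t Ht ltac:(lra) ltac:(lra) _ m k); [lia|now right]. }
  unfold eterm, tdual.
  replace (INR k * (- (tpi * tpi) / t) + INR m * tpi)%C
    with (tpi / t * (INR m * t - INR k * tpi))%C by (field; auto).
  replace (INR k * (- (tpi * tpi) / t) - INR m * tpi)%C
    with (- (tpi / t) * (INR m * t + INR k * tpi))%C by (field; auto).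
  field; auto.
Qed.

Lemma vterm_dual (t : C) (m k : nat) : 0 < Re t -> (1 <= m + k)%nat ->
  vterm t m k = (/ t * (/ (INR k * tdual t + INR m * tpi) + / (INR k * tdual t - INR m * tpi)))%C.
Proof.
  intros Ht Hmk; assert (Ht0 := re_neq_0 t Ht); assert (T := tpi_neq_0).
  assert (H1 : (INR m * t + INR k * tpi)%C <> 0%C).
  { apply (lattice_neq_0 (Re t) (Cmod t) t Ht ltac:(lra) ltac:(lra) _ m k); [lia|now left]. }
  assert (H2 : (INR m * t - INR k * tpi)%C <> 0%C).
  { apply (lattice_neq_0 (Re t) (Cmod t) t Ht ltac:(lra) ltac:(lra) _ m k); [lia|now right]. }
  unfold vterm, tdual.
  replace (INR k * (- (tpi * tpi) / t) + INR m * tpi)%C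
    with (tpi / t * (INR m * t - INR k * tpi))%C by (field; auto).
  replace (INR k * (- (tpi * tpi) / t) - INR m * tpi)%C
    with (- (tpi / t) * (INR m * t + INR k * tpi))%C by (field; auto).
  field; auto.
Qed.

(** In the other order of summation the boundary terms do not vanish: summed over m they form the
    partial fractions of [cfun] at M times [tdual t]. Since [cfun] tends to 1/2, this is the source
    of the correction 1 / (2t). *)
Lemma vterm_sum_lim (t : C) (M : nat) : 0 < Re t -> (1 <= M)%nat ->
  clim (fun n => csum (fun i => vterm t (S i) M) (2 ^ n))
       (/ t * (cfun (INR M * tdual t) - / (INR M * tdual t)))%C.
Proof.
  intros Ht HM; assert (Ht' := re_tdual_pos t Ht).
  set (z := (INR M * tdual t)%C).
  assert (Hz : 0 < Re z).
  { unfold z; rewrite re_scal_l; apply Rmult_lt_0_compat; [apply lt_0_INR; lia|exact Ht']. }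
  assert (Hz0 := re_neq_0 z Hz).
  apply clim_ext with (fun n => (/ t * (cpart (2 ^ n) z - / z + / (z + INR (2 ^ n) * tpi)))%C).
  - intro n; unfold cpart.
    rewrite (csum_shift_pair (fun k => / (z + INR k * tpi))%C (fun k => / (z - INR k * tpi))%C).
    change (INR 0) with 0; replace (z + 0 * tpi)%C with z by ring.
    rewrite (csum_ext (fun i => vterm t (S i) M)
      (fun i => / t * (/ (z + INR (S i) * tpi) + / (z - INR (S i) * tpi)))%C)
      by (intros; apply vterm_dual; [exact Ht|lia]).
    rewrite csum_scal; f_equal.
    set (e := csum _ _); ring.
  - apply clim_scal.
    replace (cfun z - / z)%C with (cfun z - / z + 0)%C by ring.
    apply clim_plus.
    + apply clim_minus; [|apply clim_const].
      apply clim_bound with (fun n => 2 * Cmod (z - tpi / 2)%C * csb / 2 ^ n); [|apply is_lim_seq_inv_pow2].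
      destruct (pow2_eventually (Cmod z)) as [N HN], (pow2_eventually 4) as [N' HN'].
      exists (N + N')%nat; intros n Hn.
      rewrite Cmod_minus_comm; eapply Rle_trans.
      * apply cfun_partial_fractions; [exact Hz|apply HN; lia|apply HN'; lia].
      * right; field; apply pow_nonzero; lra.
    + apply (lattice_inv_lim (Re (tdual t)) (Cmod (tdual t)) (tdual t) Ht' ltac:(lra) ltac:(lra) M
        (fun k => (z + INR k * tpi)%C)); intro k; now left.
Qed.

(** Both iterated limits of [dsum] lie within [K0] / M of the same square sum: the row order gives
    [alpha t], the column order the dual series and the boundary term. The constant is uniform on
    the region, so that the relation can be integrated before M tends to infinity. *)
Lemma eisenstein_quasimodular (a B : R) : 0 < a -> exists K, 0 < K /\
  forall t, a <= Re t -> Cmod t <= B -> forall M, (1 <= M)%nat ->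
  Cmod (alpha t M - tpi * tpi / (t * t) * alpha (tdual t) M + / (2 * t))%C <= K / INR M.
Proof.
  intro Ha; set (K0 := 8 * PI / (a / (1 + a + B)) ^ 3).
  (* The absolute value secures positivity also for those B for which no t satisfies the
     hypotheses. *)
  exists (Rabs (2 * K0 + B ^ 2 / a ^ 2 + 1) + 1); split; [generalize (Rabs_pos (2 * K0 + B ^ 2 / a ^ 2 + 1)); lra|].
  intros t Hta HtB M HM.
  assert (Ht : 0 < Re t) by lra; assert (Ht0 := re_neq_0 t Ht).
  assert (Ht' := re_tdual_pos t Ht); assert (Ht0' := re_neq_0 _ Ht').
  assert (HM' : 1 <= INR M) by (apply (le_INR 1); exact HM).
  assert (HM0 : RtoC (INR M) <> 0%C) by (apply C_neq_R; lra).
  assert (HaB : a <= B) by (generalize (re_le_Cmod' t); lra).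
  assert (H1 := alpha_dsum a B t Ha Hta HtB M HM); fold K0 in H1.
  set (l := (tpi * tpi / (t * t) * alpha (tdual t) M - / t * (cfun (INR M * tdual t) - / (INR M * tdual t)))%C).
  assert (H2 : Cmod (l - dsum t M M)%C <= K0 / INR M).
  { apply (clim_Cmod_le (fun n => dsum t (2 ^ n) M) _ _ (fun _ => K0 / INR M)).
    - apply clim_ext with (fun n => (esum t (2 ^ n) M - csum (fun i => vterm t (S i) M) (2 ^ n))%C).
      + intro n; rewrite esum_dsum; ring.
      + apply clim_minus; [|now apply vterm_sum_lim].
        apply clim_ext with (fun n => (tpi * tpi / (t * t) *
           csum (fun j => csum (fun i => eterm (tdual t) (S j) (S i)) (2 ^ n)) M)%C).
        * intro n; unfold esum; rewrite (csum_swap (fun i j => eterm t (S i) (S j))), <- csum_scal.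
          apply csum_ext; intros j _; rewrite <- csum_scal; apply csum_ext; intros i _.
          symmetry; apply eterm_dual; [exact Ht|lia].
        * apply clim_scal.
          apply (clim_csum (fun j n => csum (fun i => eterm (tdual t) (S j) (S i)) (2 ^ n))).
          intros k _; apply (row_lim (Re (tdual t)) (Cmod (tdual t))); try lra; lia.
    - apply is_lim_seq_const.
    - destruct (pow2_large (INR M)) as [N HN]; exists N; intros n Hn.
      apply (dsum_cauchy_r a B t Ha Hta HtB M (2 ^ n)); split; [exact HM|apply INR_le; auto]. }
  assert (Hz : 0 < Re (INR M * tdual t)%C) by (rewrite re_scal_l; apply Rmult_lt_0_compat; lra).
  (* The exponential decay of [bos] is not exploited; 1 / (M Re t') with t' = [tdual t] and Re t' >=
     a / B^2 is enough. *)
  assert (H3 : Cmod (/ t * bos (INR M * tdual t))%C <= B ^ 2 / a ^ 2 / INR M).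
  { rewrite Cmod_mult, Cmod_inv by exact Ht0.
    assert (Hb := bos_bound _ Hz).
    assert (He := exp_ineq1 (Re (INR M * tdual t)%C) ltac:(lra)).
    rewrite re_scal_l, re_tdual in Hb, He, Hz by exact Ht.
    assert (HPI := PI_bounds).
    assert (Hat : a <= Cmod t) by (generalize (re_le_Cmod' t); lra).
    assert (Hr : a / B ^ 2 <= (2 * PI) ^ 2 * (Re t / Cmod t ^ 2)).
    { apply Rle_trans with (1 * (a / B ^ 2)); [lra|].
      assert (0 < Cmod t ^ 2) by (apply pow_lt; lra).
      apply Rmult_le_compat; [lra| |cbn; nra|].
      - apply Rmult_le_pos; [lra|left; apply Rinv_0_lt_compat, pow_lt; lra].
      - unfold Rdiv; apply Rmult_le_compat; [lra| |lra|].
        + left; apply Rinv_0_lt_compat, pow_lt; lra.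
        + apply Rinv_le_contravar; [apply pow_lt; lra|apply pow_incr; lra]. }
    assert (0 < a / B ^ 2) by (apply Rdiv_lt_0_compat; [lra|apply pow_lt; lra]).
    apply Rle_trans with (/ a * / (INR M * (a / B ^ 2))).
    - apply Rmult_le_compat; try apply Cmod_ge_0.
      + left; apply Rinv_0_lt_compat; lra.
      + apply Rinv_le_contravar; lra.
      + eapply Rle_trans; [exact Hb|]; apply Rinv_le_contravar; [apply Rmult_lt_0_compat; lra|].
        apply Rle_trans with (INR M * ((2 * PI) ^ 2 * (Re t / Cmod t ^ 2))); [apply Rmult_le_compat_l; lra|lra].
    - right; field; repeat split; lra. }
  assert (H4 : Cmod (/ t * / (INR M * tdual t))%C <= 1 / INR M).
  { assert (T := tpi_neq_0).
    replace (/ t * / (INR M * tdual t))%C with (- / (INR M * (tpi * tpi)))%C by (unfold tdual; field; auto).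
    rewrite Cmod_opp, Cmod_inv, !Cmod_mult, Cmod_INR, Cmod_tpi by (apply Cmult_neq_0; [auto|apply Cmult_neq_0; auto]).
    unfold Rdiv; rewrite Rmult_1_l; apply Rinv_le_contravar; [lra|].
    generalize PI_bounds; intro; assert (1 <= 2 * PI * (2 * PI)) by nra; nra. }
  replace (alpha t M - tpi * tpi / (t * t) * alpha (tdual t) M + / (2 * t))%C
    with ((alpha t M - dsum t M M) + - (l - dsum t M M)
          + (- (/ t * bos (INR M * tdual t)) + / t * / (INR M * tdual t)))%C.
  - apply Rle_trans with ((2 * K0 + B ^ 2 / a ^ 2 + 1) / INR M).
    + eapply Rle_trans; [apply Cmod_triangle|].
      replace ((2 * K0 + B ^ 2 / a ^ 2 + 1) / INR M)
        with ((K0 / INR M + K0 / INR M) + (B ^ 2 / a ^ 2 / INR M + 1 / INR M)) by (field; lra).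
      apply Rplus_le_compat; (eapply Rle_trans; [apply Cmod_triangle|rewrite Cmod_opp; lra]).
    + apply Rmult_le_compat_r; [left; apply Rinv_0_lt_compat; lra|].
      generalize (Rle_abs (2 * K0 + B ^ 2 / a ^ 2 + 1)); lra.
  - unfold l, cfun; field; auto.
Qed.

(** * The transformation law of the partition generating function *)

Lemma rsum_sum_n (u : nat -> R) (n : nat) : rsum u (S n) = sum_n u n.
Proof.
  induction n as [|n IH]; [rewrite sum_O; cbn; ring|].
  rewrite sum_Sn, <- IH; reflexivity.
Qed.

Lemma csum_conv (u : nat -> C) (b : nat -> R) :
  (forall n, Cmod (u n) <= b n) -> ex_finite_lim_seq (rsum b) ->
  clim (csum u) (real (Lim_seq (fun n => Re (csum u n))), real (Lim_seq (fun n => Im (csum u n)))).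
Proof.
  intros Hu [l Hl].
  assert (Hb : ex_series b).
  { exists l; unfold is_series; apply (is_lim_seq_incr_1 (rsum b)) in Hl.
    exact (is_lim_seq_ext _ _ _ (rsum_sum_n b) Hl). }
  assert (G : forall f : C -> R, (forall z, Rabs (f z) <= Cmod z) ->
     (forall n, f (csum u n) = rsum (fun k => f (u k)) n) ->
     is_lim_seq (fun n => f (csum u n)) (real (Lim_seq (fun n => f (csum u n))))).
  { intros f Hf Hs; apply Lim_seq_correct'.
    assert (Hc : ex_series (fun n => f (u n))).
    { apply (ex_series_le (fun n => f (u n)) b); [|exact Hb].
      intro n; eapply Rle_trans; [apply Hf|apply Hu]. }
    destruct Hc as [s Hs']; exists s.
    apply is_lim_seq_ext with (rsum (fun k => f (u k))); [intro n; now rewrite Hs|].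
    apply is_lim_seq_incr_1; apply (is_lim_seq_ext (sum_n (fun n => f (u n)))).
    - intro n; now rewrite rsum_sum_n.
    - exact Hs'. }
  assert (G1 := G Re re_le_Cmod (fun n => re_csum u n)).
  assert (G2 := G Im im_le_Cmod (fun n => ltac:(
    induction n as [|n IH]; cbn; [reflexivity|rewrite <- IH; reflexivity]))).
  set (x := real _) in G1 |- *; set (y := real _) in G2 |- *.
  apply clim_bound with (fun n => Rabs (Re (csum u n) - x) + Rabs (Im (csum u n) - y)).
  - exists O; intros n _; eapply Rle_trans; [apply Cmod_le_ReIm|].
    unfold Cminus; rewrite re_plus, im_plus, re_opp, im_opp.
    change (Re (x, y)) with x; change (Im (x, y)) with y; unfold Rminus; lra.
  - apply is_lim_seq_0_plus.
    + apply (proj1 (is_lim_seq_abs_0 _)); replace 0 with (x - x) by ring.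
      apply is_lim_seq_minus'; [exact G1|apply is_lim_seq_const].
    + apply (proj1 (is_lim_seq_abs_0 _)); replace 0 with (y - y) by ring.
      apply is_lim_seq_minus'; [exact G2|apply is_lim_seq_const].
Qed.

(* Expanding the logarithm, [LamI t = - sum_m log (1 - e^(- m t))]. *)
Definition Lam (M : nat) (t : C) : C :=
  csum (fun i => / INR (S i) * bos (INR (S i) * t))%C M.

Definition LamI (t : C) : C :=
  (real (Lim_seq (fun M => Re (Lam M t))), real (Lim_seq (fun M => Im (Lam M t)))).

Lemma INR_S_pos (n : nat) : 0 < INR (S n).
Proof. apply lt_0_INR; lia. Qed.

Lemma INR_S_C (n : nat) : RtoC (INR (S n)) <> 0%C.
Proof. apply C_neq_R; generalize (INR_S_pos n); lra. Qed.
#[local] Hint Resolve INR_S_C : core.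

Lemma Lam_term_bound (t : C) (i : nat) : 0 < Re t ->
  Cmod (/ INR (S i) * bos (INR (S i) * t))%C <= / Re t * / INR (S i) ^ 2.
Proof.
  intro Ht; assert (Hi := INR_S_pos i).
  assert (Hz : 0 < Re (INR (S i) * t)%C) by (rewrite re_scal_l; nra).
  rewrite Cmod_mult, Cmod_inv, Cmod_INR by auto.
  apply Rle_trans with (/ INR (S i) * / (INR (S i) * Re t)).
  - apply Rmult_le_compat_l; [left; now apply Rinv_0_lt_compat|].
    eapply Rle_trans; [now apply bos_bound|].
    assert (He := exp_ineq1 (Re (INR (S i) * t)%C) ltac:(lra)).
    rewrite re_scal_l in *; apply Rinv_le_contravar; lra.
  - right; field; lra.
Qed.

Lemma Lam_lim (t : C) : 0 < Re t -> clim (fun M => Lam M t) (LamI t).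
Proof.
  intro Ht; apply (csum_conv _ (fun i => / Re t * / INR (S i) ^ 2)).
  - intro n; now apply Lam_term_bound.
  - exists (/ Re t * (PI ^ 2 / 6)).
    apply is_lim_seq_ext with (fun n => / Re t * zpart n).
    + intro n; now rewrite rsum_scal.
    + apply is_lim_seq_mult'; [apply is_lim_seq_const|apply zpart_lim].
Qed.

(** The truncated error in the functional equation of the logarithm of eta. The two [zpart] terms
    integrate the parts removed in [alpha]; as [tpi * tpi] is negative, the last one contributes
    +t/24 in the limit. *)
Definition RR (M : nat) (t : C) : C :=
  (Lam M t - Lam M (tdual t) - zpart M / t - zpart M * t / (tpi * tpi))%C.

Lemma tdual_self : tdual (RtoC (2 * PI)) = RtoC (2 * PI).
Proof.
  assert (HPI := PI_bounds).
  unfold tdual; rewrite tpi_sq, <- RtoC_opp, <- RtoC_div by lra; f_equal; field; lra.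
Qed.

(** 2 pi is the fixed point of [tdual], so integration started there has constant 0 for every M. *)
Lemma RR_self (M : nat) : RR M (RtoC (2 * PI)) = 0%C.
Proof.
  assert (HPI := PI_bounds).
  assert (H2PI : RtoC (2 * PI) <> 0%C) by (apply C_neq_R; lra).
  unfold RR; rewrite tdual_self, tpi_sq.
  replace (RtoC (- (2 * PI) ^ 2)) with (- (RtoC (2 * PI) * RtoC (2 * PI)))%C
    by (rewrite <- RtoC_mult, <- RtoC_opp; f_equal; ring).
  field; exact H2PI.
Qed.

Lemma derC_Lam (M : nat) (g : R -> C) (x : R) (l : C) : 0 < Re (g x) -> derC g x l ->
  derC (fun s => Lam M (g s)) x (- (l * csum (fun i => sfun (INR (S i) * g x)) M))%C.
Proof.
  intros Hg Dg; unfold Lam.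
  rewrite <- csum_scal, <- csum_opp.
  apply (derC_csum (fun i s => / INR (S i) * bos (INR (S i) * g s))%C).
  intros i _; eapply derC_eq.
  - apply derC_scal, derC_bos; [|apply derC_scal, Dg].
    apply cexp_neq_1_re; rewrite re_scal_l; generalize (INR_S_pos i); nra.
  - cbv beta; field; auto.
Qed.

Lemma derC_RR (M : nat) (g : R -> C) (x : R) (l : C) : 0 < Re (g x) -> derC g x l ->
  derC (fun s => RR M (g s)) x
    (- (l * (alpha (g x) M - tpi * tpi / (g x * g x) * alpha (tdual (g x)) M)))%C.
Proof.
  intros Hg Dg; assert (Hg0 := re_neq_0 _ Hg); assert (T := tpi_neq_0).
  assert (Hg' := re_tdual_pos _ Hg).
  assert (Ea : forall z : C, z <> 0%C ->
    alpha z M = (csum (fun i => sfun (INR (S i) * z)) M - zpart M / (z * z))%C).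
  { intros z Hz; unfold alpha; rewrite csum_minus; f_equal.
    unfold zpart, Cdiv; rewrite <- csum_R, Cmult_comm, <- csum_scal.
    apply csum_ext; intros i _.
    rewrite RtoC_inv, RtoC_pow by (apply pow_nonzero; generalize (INR_S_pos i); lra).
    field; auto. }
  assert (Dt : derC (fun s => tdual (g s)) x (l * (tpi * tpi) / (g x * g x))%C).
  { unfold tdual; eapply derC_eq.
    - apply (derC_scal (- (tpi * tpi)) (fun s => / g s)%C), derC_inv; [exact Hg0|exact Dg].
    - field; auto. }
  unfold RR; eapply derC_eq.
  - apply derC_minus; [apply derC_minus; [apply derC_minus|]|].
    + apply derC_Lam; [exact Hg|exact Dg].
    + apply derC_Lam; [exact Hg'|exact Dt].
    + apply (derC_scal (zpart M) (fun s => / g s)%C), derC_inv; [exact Hg0|exact Dg].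
    + apply derC_ext with (fun s => (zpart M / (tpi * tpi) * g s)%C); [intro; field; auto|].
      apply derC_scal, Dg.
  - rewrite !Ea by (try apply re_neq_0; assumption).
    set (S1 := csum _ M); set (S2 := csum _ M); unfold tdual; field; auto.
Qed.

Lemma RR_der_bound (a B : R) : 0 < a -> exists K, 0 < K /\
  forall t, a <= Re t -> Cmod t <= B -> forall M, (1 <= M)%nat ->
  Cmod (- (alpha t M - tpi * tpi / (t * t) * alpha (tdual t) M) - / (2 * t))%C <= K / INR M.
Proof.
  intro Ha; destruct (eisenstein_quasimodular a B Ha) as [K [HK H]]; exists K; split; [exact HK|].
  intros t H1 H2 M HM; rewrite <- Cmod_opp; eapply Rle_trans; [|exact (H t H1 H2 M HM)].
  right; f_equal; ring.
Qed.

Definition seg (t : C) (s : R) : C := (RtoC (2 * PI) + s * (t - RtoC (2 * PI)))%C.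

Lemma seg_convex (t : C) (s : R) (a B : R) : 0 <= s <= 1 ->
  a <= 2 * PI <= B -> a <= Re t -> Cmod t <= B -> a <= Re (seg t s) /\ Cmod (seg t s) <= B.
Proof.
  intros Hs Hp Ha HB; assert (HPI := PI_bounds); unfold seg; split.
  - replace (Re _) with ((1 - s) * (2 * PI) + s * Re t) by (destruct t; cbn; ring).
    nra.
  - replace (_ + _)%C with (RtoC (1 - s) * RtoC (2 * PI) + s * t)%C by (rewrite RtoC_minus; ring).
    eapply Rle_trans; [apply Cmod_triangle|].
    rewrite !Cmod_mult, !Cmod_R, !Rabs_pos_eq by lra; nra.
Qed.

Lemma seg_0 (t : C) : seg t 0 = RtoC (2 * PI).
Proof. unfold seg; ring. Qed.

Lemma seg_1 (t : C) : seg t 1 = t.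
Proof. unfold seg; ring. Qed.

Lemma derC_seg (t : C) (s : R) : derC (seg t) s (t - RtoC (2 * PI))%C.
Proof. apply derC_lin. Qed.

Lemma inv2_bound (t : C) (a : R) : 0 < a -> a <= Re t -> Cmod (/ (2 * t))%C <= / (2 * a).
Proof.
  intros Ha Ht.
  rewrite Cmod_inv, Cmod_mult, Cmod_R, Rabs_pos_eq; try lra.
  - generalize (re_le_Cmod' t); intro; apply Rinv_le_contravar; lra.
  - apply Cmult_neq_0; auto; apply re_neq_0; lra.
Qed.

(** Boundedness uniform in M keeps exp (2 RR) under control when it is differentiated along the
    segment. *)
Lemma RR_bounded (a B : R) : 0 < a -> a <= 2 * PI <= B -> exists K, 0 < K /\
  forall t, a <= Re t -> Cmod t <= B -> forall M, (1 <= M)%nat -> Cmod (RR M t) <= K.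
Proof.
  intros Ha Hp; destruct (RR_der_bound a B Ha) as [K [HK H]].
  assert (HPI := PI_bounds).
  exists (2 * ((B + 2 * PI) * (K + / (2 * a)))); split.
  { assert (0 < / (2 * a)) by (apply Rinv_0_lt_compat; lra).
    repeat apply Rmult_lt_0_compat; lra. }
  intros t H1 H2 M HM.
  assert (HM' : 1 <= INR M) by (apply (le_INR 1); exact HM).
  assert (D := derC_MVT (fun s => RR M (seg t s))
    (fun s => (- ((t - RtoC (2 * PI)) * (alpha (seg t s) M - tpi * tpi / (seg t s * seg t s) * alpha (tdual (seg t s)) M)))%C)
    ((B + 2 * PI) * (K + / (2 * a)))).
  cbv beta in D; rewrite seg_0, seg_1, RR_self in D.
  replace (RR M t - 0)%C with (RR M t) in D by ring; apply D.
  - intros s Hs; apply derC_RR; [|apply derC_seg].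
    generalize (proj1 (seg_convex t s a B Hs Hp H1 H2)); lra.
  - intros s Hs; destruct (seg_convex t s a B Hs Hp H1 H2) as [S1 S2].
    set (E := (alpha (seg t s) M - tpi * tpi / (seg t s * seg t s) * alpha (tdual (seg t s)) M)%C).
    rewrite Cmod_opp, Cmod_mult; apply Rmult_le_compat; try apply Cmod_ge_0.
    + unfold Cminus; eapply Rle_trans; [apply Cmod_triangle|].
      rewrite Cmod_opp, Cmod_R, Rabs_pos_eq; lra.
    + replace E with (- ((- E - / (2 * seg t s)) + / (2 * seg t s)))%C by ring.
      rewrite Cmod_opp; eapply Rle_trans; [apply Cmod_triangle|].
      apply Rplus_le_compat; [|now apply inv2_bound].
      eapply Rle_trans; [exact (H _ S1 S2 M HM)|].
      apply Rmult_le_reg_r with (INR M); [lra|].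
      unfold Rdiv; rewrite Rmult_assoc, Rinv_l by lra; nra.
Qed.

Lemma is_lim_seq_inv_INR (c : R) : is_lim_seq (fun n => c / INR n) 0.
Proof.
  apply (is_lim_seq_0_scal c (fun n => / INR n)).
  apply (is_lim_seq_inv INR p_infty); [apply is_lim_seq_INR|discriminate].
Qed.

Lemma region (t : C) : 0 < Re t -> exists a B, 0 < a /\ a <= 2 * PI <= B /\ a <= Re t /\ Cmod t <= B.
Proof.
  intro H; assert (HPI := PI_bounds); exists (Rmin 1 (Re t)), (Rmax 7 (Cmod t)).
  generalize (Rmin_l 1 (Re t)) (Rmin_r 1 (Re t)) (Rmax_l 7 (Cmod t)) (Rmax_r 7 (Cmod t)); intros.
  repeat split; try lra; apply Rmin_glb_lt; lra.
Qed.

(* By quasi-modularity [RR' = 1/(2t) + O(1/M)], so [cexp (2 RR) / t] is almost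
   constant along the segment from [2 pi] to [t]. *)
Lemma RR_lim_exp (t : C) : 0 < Re t ->
  clim (fun M => cexp (2 * RR M t)) (t / RtoC (2 * PI))%C.
Proof.
  intro Ht; destruct (region t Ht) as [a [B [Ha [Hp [H1 H2]]]]].
  destruct (RR_der_bound a B Ha) as [K [HK HKb]].
  destruct (RR_bounded a B Ha Hp) as [L [HL HLb]].
  assert (HPI := PI_bounds); assert (Ht0 := re_neq_0 t Ht).
  assert (H2PI : RtoC (2 * PI) <> 0%C) by (apply C_neq_R; lra).
  apply clim_bound with (fun M => B * (2 * ((B + 2 * PI) * (2 * K) * (exp (2 * L) / a))) / INR M);
    [|apply is_lim_seq_inv_INR].
  exists 1%nat; intros M HM.
  assert (HM' : 1 <= INR M) by (apply (le_INR 1); exact HM).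
  assert (D := derC_MVT (fun s => cexp (2 * RR M (seg t s)) * / seg t s)%C
    (fun s => (t - RtoC (2 * PI)) * (2 * (- (alpha (seg t s) M - tpi * tpi / (seg t s * seg t s) * alpha (tdual (seg t s)) M)
        - / (2 * seg t s))) * (cexp (2 * RR M (seg t s)) * / seg t s))%C
    ((B + 2 * PI) * (2 * (K / INR M)) * (exp (2 * L) * / a))).
  cbv beta in D; rewrite seg_0, seg_1, RR_self, Cmult_0_r, cexp_0 in D.
  replace (cexp (2 * RR M t) - t / RtoC (2 * PI))%C
    with (t * (cexp (2 * RR M t) * / t - 1 * / RtoC (2 * PI)))%C by (field; auto).
  rewrite Cmod_mult.
  replace (B * (2 * ((B + 2 * PI) * (2 * K) * (exp (2 * L) / a))) / INR M)
    with (B * (2 * ((B + 2 * PI) * (2 * (K / INR M)) * (exp (2 * L) * / a)))) by (field; lra).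
  apply Rmult_le_compat; try apply Cmod_ge_0; [exact H2|apply D].
  - intros s Hs; destruct (seg_convex t s a B Hs Hp H1 H2) as [S1 S2].
    assert (Hs0 : seg t s <> 0%C) by (apply re_neq_0; lra).
    eapply derC_eq.
    + apply derC_mult.
      * apply derC_cexp, derC_scal, derC_RR; [lra|apply derC_seg].
      * apply derC_inv; [exact Hs0|apply derC_seg].
    + cbv beta; set (E := (alpha _ M - _)%C); field; exact Hs0.
  - intros s Hs; destruct (seg_convex t s a B Hs Hp H1 H2) as [S1 S2].
    assert (Hs0 : seg t s <> 0%C) by (apply re_neq_0; lra).
    rewrite !Cmod_mult; repeat apply Rmult_le_compat; try apply Cmod_ge_0;
      try (repeat apply Rmult_le_pos; apply Cmod_ge_0).
    + unfold Cminus; eapply Rle_trans; [apply Cmod_triangle|].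
      rewrite Cmod_opp, Cmod_R, Rabs_pos_eq; lra.
    + rewrite Cmod_R, Rabs_pos_eq; lra.
    + exact (HKb _ S1 S2 M HM).
    + eapply Rle_trans; [apply cexp_mod_le|apply exp_le].
      rewrite Cmod_mult, Cmod_R, Rabs_pos_eq by lra.
      apply Rmult_le_compat_l; [lra|now apply HLb].
    + rewrite Cmod_inv by exact Hs0; apply Rinv_le_contravar; [lra|].
      generalize (re_le_Cmod' (seg t s)); lra.
Qed.

(** Since d / (2 d t) = 1 / (2 t), the derivatives of RR (d t) and RR t agree up to O(1/M). A direct
    proof is needed because exp (2 RI) determines [RI] only up to multiples of pi i. *)
Lemma RR_lim_scale (d : R) (t : C) : 0 < d -> 0 < Re t ->
  clim (fun M => RR M (d * t) - RR M t - RR M (d * RtoC (2 * PI)))%C 0.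
Proof.
  intros Hd Ht; destruct (region t Ht) as [a [B [Ha [Hp [H1 H2]]]]].
  destruct (RR_der_bound a B Ha) as [K [HK HKb]].
  destruct (RR_der_bound (d * a) (d * B) ltac:(nra)) as [K' [HK' HKb']].
  assert (HPI := PI_bounds); assert (Hd0 : RtoC d <> 0%C) by (apply C_neq_R; lra).
  apply clim_bound with (fun M => 2 * ((B + 2 * PI) * (d * K' + K)) / INR M); [|apply is_lim_seq_inv_INR].
  exists 1%nat; intros M HM.
  assert (HM' : 1 <= INR M) by (apply (le_INR 1); exact HM).
  set (E := fun z => (- (alpha z M - tpi * tpi / (z * z) * alpha (tdual z) M) - / (2 * z))%C).
  assert (D := derC_MVT (fun s => RR M (d * seg t s) - RR M (seg t s))%C
    (fun s => (t - RtoC (2 * PI)) * (d * E (d * seg t s) - E (seg t s)))%C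
    ((B + 2 * PI) * (d * (K' / INR M) + K / INR M))).
  cbv beta in D; rewrite seg_0, seg_1, RR_self in D.
  replace (2 * ((B + 2 * PI) * (d * K' + K)) / INR M)
    with (2 * ((B + 2 * PI) * (d * (K' / INR M) + K / INR M))) by (field; lra).
  replace (RR M (d * t) - RR M t - RR M (d * RtoC (2 * PI)) - 0)%C
    with (RR M (d * t) - RR M t - (RR M (d * RtoC (2 * PI)) - 0))%C by ring.
  apply D; clear D; intros s Hs; destruct (seg_convex t s a B Hs Hp H1 H2) as [S1 S2];
    (assert (Hs0 : seg t s <> 0%C) by (apply re_neq_0; lra)).
  - eapply derC_eq.
    + apply derC_minus; apply derC_RR.
      * rewrite re_scal_l; nra.
      * apply derC_scal, derC_seg.
      * lra.
      * apply derC_seg.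
    + unfold E; set (E1 := alpha (d * seg t s) M); set (E2 := alpha (tdual (d * seg t s)) M);
        set (E3 := alpha (seg t s) M); set (E4 := alpha (tdual (seg t s)) M).
      field; auto.
  - rewrite Cmod_mult; apply Rmult_le_compat; try apply Cmod_ge_0.
    + unfold Cminus; eapply Rle_trans; [apply Cmod_triangle|].
      rewrite Cmod_opp, Cmod_R, Rabs_pos_eq; lra.
    + eapply Rle_trans; [apply Cmod_triangle|]; rewrite Cmod_opp, Cmod_mult, Cmod_R, Rabs_pos_eq by lra.
      apply Rplus_le_compat; [apply Rmult_le_compat_l; [lra|]|].
      * apply HKb'; [rewrite re_scal_l; nra| |exact HM].
        rewrite Cmod_mult, Cmod_R, Rabs_pos_eq by lra; nra.
      * now apply HKb.
Qed.

Definition RI (t : C) : C :=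
  (LamI t - LamI (tdual t) - RtoC (PI ^ 2 / 6) / t - RtoC (PI ^ 2 / 6) * t / (tpi * tpi))%C.

Lemma clim_R (u : nat -> R) (l : R) : is_lim_seq u l -> clim (fun n => RtoC (u n)) (RtoC l).
Proof.
  intro H; apply clim_bound with (fun n => Rabs (u n - l)).
  - exists O; intros n _; rewrite <- RtoC_minus, Cmod_R; lra.
  - apply (proj1 (is_lim_seq_abs_0 _)); replace 0 with (l - l) by ring.
    apply is_lim_seq_minus'; [exact H|apply is_lim_seq_const].
Qed.

Lemma RR_lim (t : C) : 0 < Re t -> clim (fun M => RR M t) (RI t).
Proof.
  intro Ht; unfold RR, RI.
  assert (HZ := clim_R _ _ zpart_lim).
  repeat apply clim_minus.
  - now apply Lam_lim.
  - now apply Lam_lim, re_tdual_pos.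
  - apply clim_mult; [exact HZ|apply clim_const].
  - apply clim_mult; [apply clim_mult; [exact HZ|]|]; apply clim_const.
Qed.

Lemma RI_exp (t : C) : 0 < Re t -> cexp (2 * RI t) = (t / RtoC (2 * PI))%C.
Proof.
  intro Ht; apply clim_unique with (fun M => cexp (2 * RR M t)); [|now apply RR_lim_exp].
  now apply clim_cexp, clim_scal, RR_lim.
Qed.

Lemma RI_scale (d : R) (t : C) : 0 < d -> 0 < Re t ->
  RI (d * t) = (RI t + RI (d * RtoC (2 * PI)))%C.
Proof.
  intros Hd Ht; assert (HPI := PI_bounds).
  apply Ceq_minus, clim_unique with (fun M => RR M (d * t) - RR M t - RR M (d * RtoC (2 * PI)))%C;
    [|now apply RR_lim_scale].
  replace (RI (d * t) - (RI t + RI (d * RtoC (2 * PI))))%C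
    with (RI (d * t) - RI t - RI (d * RtoC (2 * PI)))%C by ring.
  apply clim_minus; [apply clim_minus|]; apply RR_lim; auto; rewrite re_scal_l; cbn; nra.
Qed.

(* [LF D t] is a logarithm of the generating function at [q = e^(-t)], and
   [LG D (tdual t)] collects its terms at the dual point. *)
Definition LF (D : R) (t : C) : C :=
  (3 * LamI t - LamI (2 * t) - LamI (D * t) + LamI ((2 * D)%R * t))%C.

Definition LG (D : R) (u : C) : C :=
  (3 * LamI u - LamI (u / 2) - LamI (u / D) + LamI (u / (2 * D)%R))%C.

(** The four products contribute pi^2/6 times 3 - 1/2 - 1/D + 1/(2D) to the coefficient of 1/t. *)
Definition cA (D : R) : R := PI ^ 2 / 6 * (5 / 2 - / (2 * D)).

(** The four products contribute 1/24 times 3 - 2 - D + 2D. *)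
Definition cs (D : R) : R := (1 + D) / 24.

(** By [RI_scale] the combination 3, -1, -1, 1 of the values of [RI] at t, 2t, Dt, 2Dt equals
    [2 * RI t]: the scaling constants of 2 and D cancel. [RI_exp] then applies without any choice of
    a branch. *)
Theorem LF_transform (D : R) (t : C) : 0 < D -> 0 < Re t ->
  cexp (LF D t) = (t / RtoC (2 * PI) * cexp (cA D / t - cs D * t) * cexp (LG D (tdual t)))%C.
Proof.
  intros HD Ht; assert (HPI := PI_bounds); assert (Ht0 := re_neq_0 t Ht); assert (T := tpi_neq_0).
  assert (HDC : RtoC D <> 0%C) by (apply C_neq_R; lra).
  rewrite <- (RI_exp t Ht), <- !cexp_add; f_equal.
  assert (E2 := RI_scale 2 t ltac:(lra) Ht).
  assert (ED := RI_scale D t HD Ht).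
  assert (E2D := RI_scale 2 (D * t) ltac:(lra) ltac:(rewrite re_scal_l; nra)).
  rewrite ED in E2D.
  assert (Es : (3 * RI t - RI (2 * t) - RI (D * t) + RI (2 * (D * t)))%C = (2 * RI t)%C).
  { rewrite E2D, E2, ED; ring. }
  rewrite <- Es; unfold RI, LF, LG, tdual.
  replace (- (tpi * tpi) / (2 * t))%C with (- (tpi * tpi) / t / 2)%C by (field; auto).
  replace (- (tpi * tpi) / (D * t))%C with (- (tpi * tpi) / t / D)%C by (field; auto).
  replace (- (tpi * tpi) / (2 * (D * t)))%C with (- (tpi * tpi) / t / (2 * D)%R)%C
    by (rewrite RtoC_mult; field; auto).
  replace (2 * (D * t))%C with ((2 * D)%R * t)%C by (rewrite RtoC_mult; ring).
  set (u1 := LamI t); set (u2 := LamI (2 * t)); set (u3 := LamI (D * t)); set (u4 := LamI ((2 * D)%R * t)).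
  set (v1 := LamI (_ / t)); set (v2 := LamI (_ / 2)); set (v3 := LamI (_ / D)); set (v4 := LamI (_ / (2 * D)%R)).
  rewrite tpi_sq; unfold cA, cs.
  assert (H2P : RtoC PI <> 0%C) by (apply C_neq_R; lra).
  repeat first [rewrite RtoC_mult | rewrite RtoC_minus | rewrite RtoC_plus | rewrite RtoC_opp
    | rewrite RtoC_pow | rewrite RtoC_div by lra | rewrite RtoC_inv by lra].
  field; auto.
Qed.

(** * Coefficient extraction on a circle *)

Ltac eqR := match goal with |- @eq _ ?a ?b => change (@eq R a b) end.

Definition shift (m : nat) (c : nat -> R) (n : nat) : R :=
  if (m <=? n)%nat then c (n - m)%nat else 0.

(** Negative indices are kept because division by 1 - q^m is justified by letting the index tend to
    minus infinity. *)
Definition zext (c : nat -> R) (n : Z) : R :=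
  if (n <? 0)%Z then 0 else c (Z.to_nat n).

Lemma zext_shift (m : nat) (c : nat -> R) (n : Z) :
  zext (shift m c) n = zext c (n - Z.of_nat m)%Z.
Proof.
  unfold zext, shift; destruct (Z.ltb_spec n 0), (Z.ltb_spec (n - Z.of_nat m) 0); try lia; auto.
  - destruct (Nat.leb_spec m (Z.to_nat n)); [lia|reflexivity].
  - destruct (Nat.leb_spec m (Z.to_nat n)); [|lia].
    f_equal; lia.
Qed.

Definition smooth (g : R -> C) := forall th, exists l, derC g th l.

Lemma smooth_mult (f g : R -> C) : smooth f -> smooth g -> smooth (fun s => f s * g s)%C.
Proof. intros Hf Hg th; destruct (Hf th), (Hg th); eexists; apply derC_mult; eassumption. Qed.

Lemma smooth_minus (f g : R -> C) : smooth f -> smooth g -> smooth (fun s => f s - g s)%C.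
Proof. intros Hf Hg th; destruct (Hf th), (Hg th); eexists; apply derC_minus; eassumption. Qed.

Lemma smooth_const (a : C) : smooth (fun _ => a).
Proof. intro th; eexists; apply derC_const. Qed.

Lemma smooth_inv (f : R -> C) : (forall s, f s <> 0%C) -> smooth f -> smooth (fun s => / f s)%C.
Proof. intros H Hf th; destruct (Hf th); eexists; apply derC_inv; [apply H|eassumption]. Qed.

Lemma smooth_cexp (f : R -> C) : smooth f -> smooth (fun s => cexp (f s)).
Proof. intros Hf th; destruct (Hf th); eexists; apply derC_cexp; eassumption. Qed.

Lemma smooth_ex_RInt (g : R -> C) (a b : R) : smooth g -> ex_RInt (fun s => Re (g s)) a b.
Proof.
  intro H; apply (ex_RInt_continuous (V := R_CompleteNormedModule)); intros z _.
  destruct (H z) as [l [Hl _]]; apply (ex_derive_continuous (fun s => Re (g s))); eexists; exact Hl.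
Qed.

Lemma smooth_ex_RInt_im (g : R -> C) (a b : R) : smooth g -> ex_RInt (fun s => Im (g s)) a b.
Proof.
  intro H; apply (ex_RInt_continuous (V := R_CompleteNormedModule)); intros z _.
  destruct (H z) as [l [_ Hl]]; apply (ex_derive_continuous (fun s => Im (g s))); eexists; exact Hl.
Qed.

Section Coefficients.
Variable y : R.
Hypothesis y_pos : 0 < y.

Lemma smooth_line (a : C) : smooth (fun th => a * (y, th))%C.
Proof.
  intro th; eexists; apply derC_scal.
  apply derC_ext with (fun s => (RtoC y + RtoC s * Ci)%C).
  - intro s; apply injective_projections; cbn; ring.
  - apply derC_lin.
Qed.

(** The exponential factor removes q^n at q = e^-(y + i th). Real parts suffice because the
    coefficients are real. *)
Definition coef (n : Z) (g : R -> C) : R :=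
  RInt (fun th => Re (g th * cexp (IZR n * (y, th)))%C) (- PI) PI.

(* [g] is the restriction to the circle of radius [e^(-y)] of the power series
   with coefficients [c]. *)
Definition good (g : R -> C) (c : nat -> R) :=
  smooth g /\ forall n, coef n g = 2 * PI * zext c n.

Lemma smooth_kernel (g : R -> C) (n : Z) : smooth g -> smooth (fun th => g th * cexp (IZR n * (y, th)))%C.
Proof. intro H; apply smooth_mult; [exact H|apply smooth_cexp, smooth_line]. Qed.

Lemma good_one : good (fun _ => 1%C) (fun n => if (n =? 0)%nat then 1 else 0).
Proof.
  assert (HPI := PI_bounds).
  split; [apply smooth_const|]; intro n; unfold coef.
  rewrite (RInt_ext _ (fun th => exp (IZR n * y) * cos (IZR n * th))).
  - destruct (Z.eq_dec n 0) as [->|Hn].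
    + rewrite (RInt_ext _ (fun _ => 1)).
      * rewrite (RInt_const (V := R_CompleteNormedModule)).
        change ((PI - - PI) * 1 = 2 * PI * 1); ring.
      * intros; rewrite !Rmult_0_l, exp_0, cos_0; eqR; ring.
    + assert (Hn' : IZR n <> 0) by (now apply not_0_IZR).
      rewrite (is_RInt_unique _ _ _ (exp (IZR n * y) * sin (IZR n * PI) / IZR n
                 - exp (IZR n * y) * sin (IZR n * - PI) / IZR n)).
      * replace (IZR n * - PI) with (- (IZR n * PI)) by ring.
        rewrite sin_neg, (sin_eq_0_1 (IZR n * PI)) by (now exists n).
        unfold zext; destruct (Z.ltb_spec n 0); [field; exact Hn'|].
        destruct (Nat.eqb_spec (Z.to_nat n) 0); [lia|field; exact Hn'].
      * apply (is_RInt_derive (fun th => exp (IZR n * y) * sin (IZR n * th) / IZR n)).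
        -- intros x _; auto_derive; [exact I|field; exact Hn'].
        -- intros x _; apply (ex_derive_continuous (fun th => exp (IZR n * y) * cos (IZR n * th))).
           auto_derive; exact I.
  - intros th _; cbn; rewrite !Rmult_0_l, !Rmult_1_l, Rminus_0_r, Rplus_0_r, Rminus_0_r; reflexivity.
Qed.

Lemma kernel_shift (g : C) (n : Z) (m : nat) (z : C) :
  (g * (1 - cexp (- (INR m * z))) * cexp (IZR n * z))%C
  = (g * cexp (IZR n * z) - g * cexp (IZR (n - Z.of_nat m) * z))%C.
Proof.
  rewrite minus_IZR, <- INR_IZR_INZ.
  replace (RtoC (IZR n - INR m) * z)%C with (IZR n * z + - (INR m * z))%C by (rewrite RtoC_minus; ring).
  rewrite cexp_add; ring.
Qed.

Lemma coef_shift (g : R -> C) (n : Z) (m : nat) : smooth g ->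
  coef n (fun th => g th * (1 - cexp (- (INR m * (y, th)))))%C = coef n g - coef (n - Z.of_nat m) g.
Proof.
  intro Hg; unfold coef.
  rewrite <- (RInt_minus (V := R_CompleteNormedModule) (fun th => Re (g th * cexp (IZR n * (y, th)))%C)
    (fun th => Re (g th * cexp (IZR (n - Z.of_nat m) * (y, th)))%C)).
  - apply RInt_ext; intros th _; rewrite kernel_shift; unfold Cminus; rewrite re_plus, re_opp; reflexivity.
  - now apply smooth_ex_RInt, smooth_kernel.
  - now apply smooth_ex_RInt, smooth_kernel.
Qed.

Lemma smooth_one_minus (m : nat) : smooth (fun th => 1 - cexp (- (INR m * (y, th))))%C.
Proof.
  apply smooth_minus; [apply smooth_const|].
  intro th; destruct (smooth_line (- INR m) th) as [l Hl]; eexists; apply derC_cexp.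
  eapply derC_ext; [|exact Hl]; intro s; cbv beta; ring.
Qed.

Lemma good_mult (g : R -> C) (c c' : nat -> R) (m : nat) :
  good g c -> (forall n, c' n = c n - shift m c n) ->
  good (fun th => g th * (1 - cexp (- (INR m * (y, th)))))%C c'.
Proof.
  intros [Hg Hc] Hc'; split.
  - apply smooth_mult; [exact Hg|apply smooth_one_minus].
  - intro n; rewrite coef_shift, !Hc, <- zext_shift by exact Hg.
    unfold zext; destruct (n <? 0)%Z; [ring|rewrite Hc'; ring].
Qed.

Lemma one_minus_neq_0 (m : nat) (th : R) : (1 <= m)%nat -> (1 - cexp (- (INR m * (y, th))))%C <> 0%C.
Proof.
  intros Hm F.
  assert (Hm' : 1 <= INR m) by (apply (le_INR 1); exact Hm).
  apply (cexp_neq_1_re (INR m * (y, th))); [rewrite re_scal_l; cbn; nra|].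
  assert (E : cexp (- (INR m * (y, th))) = 1%C).
  { replace (cexp _) with (1 - (1 - cexp (- (INR m * (y, th)))))%C by ring; rewrite F; ring. }
  rewrite cexp_opp in E.
  assert (Hn := cexp_neq_0 (INR m * (y, th))).
  replace (cexp (INR m * (y, th))) with (/ (/ cexp (INR m * (y, th))))%C by (field; auto).
  rewrite E; field.
Qed.

(** The bound tends to 0 as n tends to minus infinity, which is the only use made of it. *)
Lemma coef_bound (g : R -> C) : smooth g -> exists B, forall n, Rabs (coef n g) <= B * exp (IZR n * y).
Proof.
  intro Hg; assert (HPI := PI_bounds).
  exists (RInt (fun th => Rabs (Re (g th)) + Rabs (Im (g th))) (- PI) PI); intro n.
  assert (E1 := ex_RInt_norm _ _ _ (smooth_ex_RInt g (- PI) PI Hg)).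
  assert (E2 := ex_RInt_norm _ _ _ (smooth_ex_RInt_im g (- PI) PI Hg)).
  assert (E3 := ex_RInt_plus _ _ _ _ E1 E2).
  rewrite Rmult_comm.
  assert (E5 : exp (IZR n * y) * RInt (fun th => Rabs (Re (g th)) + Rabs (Im (g th))) (- PI) PI
    = RInt (fun th => exp (IZR n * y) * (Rabs (Re (g th)) + Rabs (Im (g th)))) (- PI) PI).
  { symmetry; exact (RInt_scal (V := R_CompleteNormedModule)
    (fun th => Rabs (Re (g th)) + Rabs (Im (g th))) (- PI) PI (exp (IZR n * y)) E3). }
  rewrite E5.
  assert (E4 := smooth_ex_RInt _ (- PI) PI (smooth_kernel g n Hg)).
  unfold coef; eapply Rle_trans; [apply abs_RInt_le; [lra|exact E4]|].
  apply RInt_le; [lra|exact (ex_RInt_norm _ _ _ E4)| |].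
  - exact (ex_RInt_scal _ _ _ (exp (IZR n * y)) E3).
  - intros th _; eapply Rle_trans; [apply re_le_Cmod|].
    rewrite Cmod_mult, cexp_mod, re_scal_l, Rmult_comm; unfold scal; cbn; unfold mult; cbn.
    apply Rmult_le_compat_l; [left; apply exp_pos|apply Cmod_le_ReIm].
Qed.

(* The difference of the two sides is [m]-periodic in [n] and tends to [0] as
   [n] tends to minus infinity. *)
Lemma good_div (g : R -> C) (c c' : nat -> R) (m : nat) : (1 <= m)%nat ->
  good g c -> (forall n, c' n - shift m c' n = c n) ->
  good (fun th => g th / (1 - cexp (- (INR m * (y, th)))))%C c'.
Proof.
  intros Hm [Hg Hc] Hc'; set (G := (fun th => g th / (1 - cexp (- (INR m * (y, th)))))%C).
  assert (HG : smooth G).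
  { apply smooth_mult; [exact Hg|apply smooth_inv; [|apply smooth_one_minus]].
    intro s; now apply one_minus_neq_0. }
  split; [exact HG|].
  set (d := fun n => coef n G - 2 * PI * zext c' n).
  assert (Hd : forall n, d n = d (n - Z.of_nat m)%Z).
  { intro n; unfold d.
    assert (E := coef_shift G n m HG).
    replace (coef n (fun th => G th * (1 - cexp (- (INR m * (y, th)))))%C) with (coef n g) in E.
    - rewrite Hc in E; rewrite <- (zext_shift m c' n).
      assert (E' : zext c n = zext c' n - zext (shift m c') n).
      { unfold zext; destruct (n <? 0)%Z; [ring|now rewrite <- Hc']. }
      rewrite E' in E; lra.
    - apply RInt_ext; intros th _; unfold G; do 2 f_equal; field; now apply one_minus_neq_0. }
  assert (Hd' : forall j n, d n = d (n - Z.of_nat (j * m))%Z).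
  { induction j as [|j IH]; intro n; [f_equal; lia|].
    rewrite IH, Hd; f_equal; lia. }
  destruct (coef_bound G HG) as [B HB].
  intro n; apply Rminus_diag_uniq; change (d n = 0).
  assert (Hlim : is_lim_seq (fun j => Rabs B * exp (IZR n * y) * exp (- y) ^ j) 0).
  { apply is_lim_seq_0_scal, is_lim_seq_geom.
    rewrite Rabs_pos_eq by (left; apply exp_pos).
    rewrite <- exp_0; apply exp_increasing; lra. }
  assert (Hle : Rabs (d n) <= 0).
  { apply (is_lim_seq_le_loc (fun _ => Rabs (d n)) _ (Rabs (d n)) 0) with (2 := is_lim_seq_const _) (3 := Hlim).
    exists (Z.to_nat (Z.abs n + 1)); intros j Hj.
    rewrite (Hd' j n); unfold d.
    assert (Hneg : (n - Z.of_nat (j * m) < 0)%Z) by nia.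
    unfold zext at 1; destruct (Z.ltb_spec (n - Z.of_nat (j * m)) 0); [|lia].
    rewrite Rmult_0_r, Rminus_0_r; eapply Rle_trans; [apply HB|].
    apply Rle_trans with (Rabs B * exp (IZR (n - Z.of_nat (j * m)) * y)).
    - apply Rmult_le_compat_r; [left; apply exp_pos|apply Rle_abs].
    - rewrite Rmult_assoc; apply Rmult_le_compat_l; [apply Rabs_pos|].
      rewrite exp_pow, <- exp_plus; apply exp_le.
      rewrite minus_IZR, <- INR_IZR_INZ, mult_INR.
      assert (1 <= INR m) by (apply (le_INR 1); exact Hm).
      assert (Hj0 := pos_INR j).
      assert (INR j * y <= INR j * INR m * y) by (apply Rmult_le_compat_r; nra).
      lra. }
  assert (H0 := Rabs_pos (d n)).
  destruct (Req_dec (d n) 0) as [E|E]; [exact E|].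
  generalize (Rabs_pos_lt _ E); lra.
Qed.

End Coefficients.

(** * The generating function on the circle *)

Definition Eq (j : nat) (t : C) : C := cexp (- (INR j * t))%C.

(** The factors are in the order of [gen_step], so that multiplications and divisions can be matched
    with coefficient operations one at a time. *)
Fixpoint hprod (D N : nat) (t : C) : C :=
  match N with
  | O => RtoC 1
  | S N =>
      (hprod D N t * (1 - Eq (2 * S N) t) * (1 - Eq (D * S N) t)
       / (1 - Eq (S N) t) / (1 - Eq (S N) t) / (1 - Eq (S N) t)
       / (1 - Eq (2 * D * S N) t))%C
  end.

(** A truncation of -log (1 - x). *)
Definition pl (J : nat) (x : C) : C := csum (fun j => / INR (S j) * x ^ S j)%C J.

Lemma derC_pl (J : nat) (x : C) (r : R) : derC (fun s => pl J (RtoC s * x)%C) r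
  (x * csum (fun j => (RtoC r * x) ^ j) J)%C.
Proof.
  unfold pl; rewrite <- csum_scal.
  apply (derC_csum (fun j s => / INR (S j) * (RtoC s * x) ^ S j)%C).
  intros k _; eapply derC_eq; [apply derC_scal, derC_pow_scal|field; auto].
Qed.

Lemma geom_csum (z : C) (J : nat) : ((1 - z) * csum (fun j => z ^ j) J)%C = (1 - z ^ J)%C.
Proof.
  induction J as [|J IH]; cbn [csum]; [cbn; ring|].
  rewrite Cmult_plus_distr_l, IH, Cpow_S; ring.
Qed.

Lemma pl_bound (J : nat) (x : C) : Cmod x < 1 -> Cmod (pl J x) <= Cmod x / (1 - Cmod x).
Proof.
  intro Hx; assert (H0 := Cmod_ge_0 x).
  apply Rle_trans with (rsum (fun j => Cmod x * Cmod x ^ j) J).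
  - apply Cmod_csum_le'; intros k _.
    rewrite Cmod_mult, Cmod_inv, Cmod_INR, Cmod_pow by auto.
    assert (Hp : 0 <= Cmod x ^ S k) by now apply pow_le.
    assert (Hk : / INR (S k) <= 1).
    { rewrite <- Rinv_1; apply Rinv_le_contravar; [lra|]; rewrite S_INR; generalize (pos_INR k); lra. }
    change (Cmod x * Cmod x ^ k) with (Cmod x ^ S k); nra.
  - rewrite rsum_scal; apply Rmult_le_compat_l; [exact H0|].
    apply Rmult_le_reg_l with (1 - Cmod x); [lra|]; rewrite Rinv_r by lra.
    assert (E : (1 - Cmod x) * rsum (fun j => Cmod x ^ j) J = 1 - Cmod x ^ J).
    { induction J as [|J IH]; cbn [rsum]; [cbn; ring|rewrite Rmult_plus_distr_l, IH; cbn; ring]. }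
    eapply Rle_trans; [right; exact E|generalize (pow_le (Cmod x) J H0); lra].
Qed.

Lemma one_minus_mod_neq_0 (x : C) : Cmod x < 1 -> (1 - x)%C <> 0%C.
Proof.
  intros H F; assert (E : x = 1%C) by (replace x with (1 - (1 - x))%C by ring; rewrite F; ring).
  rewrite E, Cmod_1 in H; lra.
Qed.

(** Along the segment from 0 to x, the derivative of (1 - s x) exp (pl (s x)) telescopes to a single
    term with factor (s x)^J, so no complex logarithm is needed. *)
Lemma pl_lim (x : C) : Cmod x < 1 -> clim (fun J => cexp (pl J x)) (/ (1 - x))%C.
Proof.
  intro Hx; assert (H0 := Cmod_ge_0 x); assert (Hn := one_minus_mod_neq_0 x Hx).
  set (L := Cmod x / (1 - Cmod x)).
  apply clim_bound with (fun J => Cmod (/ (1 - x))%C * (2 * exp L) * Cmod x ^ J).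
  2:{ apply is_lim_seq_0_scal, is_lim_seq_geom; rewrite Rabs_pos_eq; lra. }
  exists O; intros J _.
  assert (D := derC_MVT (fun s => (1 - RtoC s * x) * cexp (pl J (RtoC s * x)))%C
    (fun s => - x * (RtoC s * x) ^ J * cexp (pl J (RtoC s * x)))%C (Cmod x ^ J * exp L)).
  cbv beta in D; rewrite Cmult_1_l, Cmult_0_l in D.
  replace (pl J 0) with (RtoC 0) in D.
  2:{ symmetry; apply csum_0; intros k _; rewrite Cpow_S; ring. }
  rewrite cexp_0 in D.
  replace (cexp (pl J x) - / (1 - x))%C
    with (/ (1 - x) * ((1 - x) * cexp (pl J x) - (1 - 0) * 1))%C by (field; exact Hn).
  rewrite Cmod_mult, !Rmult_assoc; apply Rmult_le_compat_l; [apply Cmod_ge_0|].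
  rewrite (Rmult_comm (exp L)); apply D.
  - intros s _; eapply derC_eq.
    + apply derC_mult; [apply derC_minus; [apply derC_const|apply derC_id]|].
      apply derC_cexp, derC_pl.
    + cbv beta; set (z := (RtoC s * x)%C).
      assert (G := geom_csum z J).
      replace ((0 - x) * cexp (pl J z) + (1 - z) * (x * csum (fun j => z ^ j) J * cexp (pl J z)))%C
        with (x * cexp (pl J z) * (- (1) + (1 - z) * csum (fun j => z ^ j) J))%C by ring.
      rewrite G; ring.
  - intros s Hs.
    assert (Hsx : Cmod (RtoC s * x)%C <= Cmod x).
    { rewrite Cmod_mult, Cmod_R, Rabs_pos_eq by lra; nra. }
    assert (Hs0 := Cmod_ge_0 (RtoC s * x)%C).
    rewrite !Cmod_mult, Cmod_opp, Cmod_pow; apply Rmult_le_compat.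
    + apply Rmult_le_pos; [exact H0|now apply pow_le].
    + apply Cmod_ge_0.
    + apply Rle_trans with (1 * Cmod x ^ J); [|lra].
      apply Rmult_le_compat; [exact H0|now apply pow_le|lra|now apply pow_incr].
    + eapply Rle_trans; [apply cexp_mod_le|apply exp_le].
      eapply Rle_trans; [apply pl_bound; lra|unfold L, Rdiv].
      apply Rmult_le_compat; [exact Hs0| |exact Hsx|apply Rinv_le_contravar; lra].
      left; apply Rinv_0_lt_compat; lra.
Qed.

Lemma Eq_mod (j : nat) (t : C) : Cmod (Eq j t) = exp (- (INR j * Re t)).
Proof. unfold Eq; rewrite cexp_mod, re_opp, re_scal_l; reflexivity. Qed.

Lemma Eq_mod_lt (j : nat) (t : C) : (1 <= j)%nat -> 0 < Re t -> Cmod (Eq j t) < 1.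
Proof.
  intros Hj Ht; rewrite Eq_mod, <- exp_0; apply exp_increasing.
  assert (1 <= INR j) by (apply (le_INR 1); exact Hj); nra.
Qed.

Definition plcomb (D J m : nat) (t : C) : C :=
  (3 * pl J (Eq m t) - pl J (Eq (2 * m) t) - pl J (Eq (D * m) t) + pl J (Eq (2 * D * m) t))%C.

Lemma pl_lim_opp (x : C) : Cmod x < 1 -> clim (fun J => cexp (- pl J x)) (1 - x)%C.
Proof.
  intro Hx; assert (H0 := Cmod_ge_0 x); assert (Hn := one_minus_mod_neq_0 x Hx).
  apply clim_bound with (fun J => exp (Cmod x / (1 - Cmod x)) * Cmod (1 - x)%C
      * Cmod (cexp (pl J x) - / (1 - x))%C).
  - exists O; intros J _.
    replace (cexp (- pl J x) - (1 - x))%C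
      with (- (cexp (- pl J x) * (1 - x) * (cexp (pl J x) - / (1 - x))))%C.
    + rewrite Cmod_opp, !Cmod_mult, !Rmult_assoc; apply Rmult_le_compat_r.
      * apply Rmult_le_pos; apply Cmod_ge_0.
      * eapply Rle_trans; [apply cexp_mod_le|rewrite Cmod_opp; apply exp_le; now apply pl_bound].
    + rewrite cexp_opp; field; split; [apply cexp_neq_0|exact Hn].
  - apply is_lim_seq_0_scal, pl_lim, Hx.
Qed.

Lemma hprod_lim (D N : nat) (t : C) : (1 <= D)%nat -> 0 < Re t ->
  clim (fun J => cexp (csum (fun m => plcomb D J (S m) t) N)) (hprod D N t).
Proof.
  intros HD Ht; induction N as [|N IH]; cbn [csum hprod].
  - apply clim_ext with (fun _ => cexp 0); [reflexivity|rewrite cexp_0; apply clim_const].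
  - assert (H3 : (1 <= D * S N)%nat) by (apply (Nat.mul_le_mono 1 D 1 (S N)); lia).
    assert (H4 : (1 <= 2 * D * S N)%nat) by (apply (Nat.mul_le_mono 1 (2 * D) 1 (S N)); lia).
    assert (L1 := pl_lim (Eq (S N) t) (Eq_mod_lt (S N) t ltac:(lia) Ht)).
    assert (L2 := pl_lim_opp (Eq (2 * S N) t) (Eq_mod_lt (2 * S N) t ltac:(lia) Ht)).
    assert (L3 := pl_lim_opp (Eq (D * S N) t) (Eq_mod_lt (D * S N) t H3 Ht)).
    assert (L4 := pl_lim (Eq (2 * D * S N) t) (Eq_mod_lt (2 * D * S N) t H4 Ht)).
    eapply clim_ext; [|exact (clim_mult _ _ _ _ (clim_mult _ _ _ _ (clim_mult _ _ _ _
      (clim_mult _ _ _ _ (clim_mult _ _ _ _ (clim_mult _ _ _ _ IH L2) L3) L1) L1) L1) L4)].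
    intro J; cbv beta; rewrite <- !cexp_add; f_equal; unfold plcomb; ring.
Qed.

Lemma geom_bos (w : C) (N : nat) : 0 < Re w ->
  csum (fun m => cexp (- (INR (S m) * w))) N = (bos w - bos w * cexp (- (INR N * w)))%C.
Proof.
  intro Hw; assert (Hn := cexp_neq_1_minus w (cexp_neq_1_re w Hw)).
  induction N as [|N IH]; cbn [csum].
  - replace (- (INR 0 * w))%C with (RtoC 0) by (cbn; ring); rewrite cexp_0; ring.
  - rewrite IH, S_INR.
    replace (- (RtoC (INR N + 1) * w))%C with (- (INR N * w) + - w)%C by (rewrite RtoC_plus; ring).
    rewrite cexp_add, (cexp_opp w); unfold bos; assert (Hc := cexp_neq_0 w); field; auto.
Qed.

(** The share in the truncated logarithm of the factors with index m > N. *)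
Definition tau (J N : nat) (z : C) : C :=
  csum (fun j => / INR (S j) * (bos (INR (S j) * z) * cexp (- (INR N * (INR (S j) * z)))))%C J.

Lemma pl_Eq_sum (J N d : nat) (t : C) : (1 <= d)%nat -> 0 < Re t ->
  csum (fun m => pl J (Eq (d * S m) t)) N = (Lam J (INR d * t) - tau J N (INR d * t))%C.
Proof.
  intros Hd Ht; unfold pl, Lam, tau.
  rewrite (csum_swap (fun m j => / INR (S j) * Eq (d * S m) t ^ S j)%C), <- csum_minus.
  apply csum_ext; intros j _; rewrite csum_scal.
  assert (Hw : 0 < Re (INR (S j) * (INR d * t))%C).
  { rewrite !re_scal_l; assert (1 <= INR d) by (apply (le_INR 1); exact Hd).
    apply Rmult_lt_0_compat; [apply INR_S_pos|apply Rmult_lt_0_compat; lra]. }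
  rewrite (csum_ext _ (fun m => cexp (- (INR (S m) * (INR (S j) * (INR d * t)))))).
  - rewrite geom_bos by exact Hw; ring.
  - intros m _; unfold Eq; rewrite <- cexp_pow; f_equal; rewrite mult_INR, RtoC_mult; ring.
Qed.

Lemma zpart_le_2 (J : nat) : zpart J <= 2.
Proof.
  assert (Hi : forall n, zpart n <= zpart (S n)).
  { intro n; unfold zpart; cbn [rsum].
    assert (0 < / INR (S n) ^ 2) by (apply Rinv_0_lt_compat, pow_lt, INR_S_pos); lra. }
  assert (H := is_lim_seq_incr_compare _ _ zpart_lim Hi J).
  generalize PI_bounds; intro; nra.
Qed.

Lemma tau_bound (J N : nat) (z : C) (y : R) : 0 < y -> y <= Re z ->
  Cmod (tau J N z) <= 2 * exp (- (INR N * y)) / y.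
Proof.
  intros Hy Hz; apply Rle_trans with (rsum (fun j => exp (- (INR N * y)) / y * / INR (S j) ^ 2) J).
  - apply Cmod_csum_le'; intros j _; assert (Hj := INR_S_pos j); assert (HN := pos_INR N).
    assert (Hj1 : 1 <= INR (S j)) by (rewrite S_INR; generalize (pos_INR j); lra).
    assert (H1 := Lam_term_bound z j ltac:(lra)).
    rewrite Cmult_assoc, Cmod_mult.
    replace (exp (- (INR N * y)) / y * / INR (S j) ^ 2)
      with ((/ y * / INR (S j) ^ 2) * exp (- (INR N * y))) by (unfold Rdiv; ring).
    apply Rmult_le_compat; try apply Cmod_ge_0.
    + eapply Rle_trans; [exact H1|]; apply Rmult_le_compat_r.
      * left; apply Rinv_0_lt_compat, pow_lt, Hj.
      * apply Rinv_le_contravar; lra.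
    + rewrite cexp_mod, re_opp, !re_scal_l; apply exp_le, Ropp_le_contravar.
      apply Rmult_le_compat_l; [exact HN|nra].
  - rewrite rsum_scal; assert (Hz2 := zpart_le_2 J); fold (zpart J).
    assert (0 < exp (- (INR N * y)) / y) by (apply Rdiv_lt_0_compat; [apply exp_pos|lra]).
    replace (2 * exp (- (INR N * y)) / y) with (exp (- (INR N * y)) / y * 2) by (field; lra).
    apply Rmult_le_compat_l; lra.
Qed.

Definition lamcomb (D : nat) (J : nat) (t : C) : C :=
  (3 * Lam J t - Lam J (2 * t) - Lam J (INR D * t) + Lam J ((2 * INR D)%R * t))%C.

Lemma re_scal_pos (d : R) (t : C) : 0 < d -> 0 < Re t -> 0 < Re (d * t)%C.
Proof. intros; rewrite re_scal_l; now apply Rmult_lt_0_compat. Qed.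

Lemma lamcomb_lim (D : nat) (t : C) : (1 <= D)%nat -> 0 < Re t ->
  clim (fun J => lamcomb D J t) (LF (INR D) t).
Proof.
  intros HD Ht; assert (1 <= INR D) by (apply (le_INR 1); exact HD); unfold lamcomb, LF.
  apply clim_plus; [apply clim_minus; [apply clim_minus; [apply clim_scal|]|]|];
    apply Lam_lim; auto; apply re_scal_pos; lra.
Qed.

(** The tails [tau] enter with total weight 3 + 1 + 1 + 1 = 6, each at most 2 exp (-N Re t) / Re t,
    whence the 12. A second [eta] absorbs the truncation in J, and [cexp_m1_bound] applied to an
    exponent of size [2 * eta] gives the stated error. *)
Lemma hprod_approx (D N : nat) (t : C) : (1 <= D)%nat -> 0 < Re t ->
  let eta := 12 * exp (- (INR N * Re t)) / Re t in
  Cmod (hprod D N t - cexp (LF (INR D) t))%C <= exp (Re (LF (INR D) t)) * (4 * eta * exp (4 * eta)).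
Proof.
  intros HD Ht eta; assert (HD' : 1 <= INR D) by (apply (le_INR 1); exact HD).
  assert (Heta : 0 < eta).
  { unfold eta; apply Rdiv_lt_0_compat; [|exact Ht]; generalize (exp_pos (- (INR N * Re t))); lra. }
  apply (clim_Cmod_le (fun J => cexp (csum (fun m => plcomb D J (S m) t) N)) _ _
    (fun _ => exp (Re (LF (INR D) t)) * (4 * eta * exp (4 * eta)))).
  - now apply hprod_lim.
  - apply is_lim_seq_const.
  - assert (HL := lamcomb_lim D t HD Ht).
    destruct (HL (fun x => x < eta)) as [J0 HJ].
    { exists (mkposreal eta Heta); intros z Hz; cbn in Hz; unfold AbsRing_ball, abs, minus, plus, opp in Hz.
      cbn in Hz; apply Rabs_lt_between in Hz; lra. }
    exists J0; intros J HJ0; specialize (HJ J HJ0).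
    set (w := (csum (fun m => plcomb D J (S m) t) N - LF (INR D) t)%C).
    assert (Hw : Cmod w <= 2 * eta).
    { assert (E : csum (fun m => plcomb D J (S m) t) N
        = (lamcomb D J t - (3 * tau J N t - tau J N (2 * t) - tau J N (INR D * t) + tau J N ((2 * INR D)%R * t)))%C).
      { unfold plcomb; rewrite csum_plus, !csum_minus, csum_scal.
        rewrite (csum_ext (fun k => pl J (Eq (S k) t)) (fun k => pl J (Eq (1 * S k) t)))
          by (intros; rewrite Nat.mul_1_l; reflexivity).
        rewrite !pl_Eq_sum by (auto; lia).
        change (INR 1) with 1; rewrite Cmult_1_l.
        replace (INR (2 * D)) with (2 * INR D) by (rewrite mult_INR; reflexivity).
        change (INR 2) with 2; unfold lamcomb; ring. }
      unfold w; rewrite E.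
      match goal with |- Cmod (?a - ?b - ?c)%C <= _ =>
        replace (a - b - c)%C with ((a - c) - b)%C by ring end.
      unfold Cminus at 1; eapply Rle_trans; [apply Cmod_triangle|]; rewrite Cmod_opp.
      replace (2 * eta) with (eta + eta) by ring; apply Rplus_le_compat; [lra|].
      assert (Ht1 := tau_bound J N t (Re t) Ht ltac:(lra)).
      assert (Ht2 := tau_bound J N (2 * t) (Re t) Ht ltac:(rewrite re_scal_l; lra)).
      assert (Ht3 := tau_bound J N (INR D * t) (Re t) Ht ltac:(rewrite re_scal_l; nra)).
      assert (Ht4 := tau_bound J N ((2 * INR D)%R * t) (Re t) Ht ltac:(rewrite re_scal_l; nra)).
      replace eta with (3 * (2 * exp (- (INR N * Re t)) / Re t) + 2 * exp (- (INR N * Re t)) / Re t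
        + 2 * exp (- (INR N * Re t)) / Re t + 2 * exp (- (INR N * Re t)) / Re t) by (unfold eta; field; lra).
      eapply Rle_trans; [apply Cmod_triangle|apply Rplus_le_compat; [|exact Ht4]].
      unfold Cminus; eapply Rle_trans; [apply Cmod_triangle|apply Rplus_le_compat; [|now rewrite Cmod_opp]].
      eapply Rle_trans; [apply Cmod_triangle|apply Rplus_le_compat; [|now rewrite Cmod_opp]].
      rewrite Cmod_mult, Cmod_R, Rabs_pos_eq by lra; lra. }
    replace (csum _ N) with (LF (INR D) t + w)%C by (unfold w; ring).
    rewrite cexp_add.
    replace (cexp (LF (INR D) t) * cexp w - cexp (LF (INR D) t))%C
      with (cexp (LF (INR D) t) * (cexp w - 1))%C by ring.
    rewrite Cmod_mult, cexp_mod; apply Rmult_le_compat_l; [left; apply exp_pos|].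
    eapply Rle_trans; [apply cexp_m1_bound|].
    assert (H0 := Cmod_ge_0 w).
    apply Rmult_le_compat; [lra|left; apply exp_pos|lra|apply exp_le; lra].
Qed.

(** * Away from the positive real axis *)

Definition Tcomb (D : R) (z : C) : C := (3 * bos z - bos (2 * z) - bos (D * z) + bos ((2 * D)%R * z))%C.

Lemma bos_x (d : nat) (z : C) : 0 < Re z -> (1 <= d)%nat ->
  bos (INR d * z) = (cexp (- z) ^ d / (1 - cexp (- z) ^ d))%C.
Proof.
  intros Hz Hd; unfold bos; rewrite cexp_pow, cexp_opp, Cpow_inv by apply cexp_neq_0.
  assert (Hn : (cexp z ^ d - 1)%C <> 0%C).
  { rewrite <- cexp_pow; apply cexp_neq_1_minus, cexp_neq_1_re, re_scal_pos; [|exact Hz].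
    apply lt_0_INR; lia. }
  assert (Hc : (cexp z ^ d)%C <> 0%C) by apply Cpow_nz, cexp_neq_0.
  field; auto.
Qed.

Lemma x_pow_neq (d : nat) (x : C) : Cmod x < 1 -> (1 <= d)%nat -> (1 - x ^ d)%C <> 0%C.
Proof.
  intros Hx Hd; apply one_minus_mod_neq_0; rewrite Cmod_pow.
  destruct d as [|d]; [lia|].
  assert (H := Cmod_ge_0 x).
  apply Rle_lt_trans with (Cmod x * 1); [|lra].
  cbn [pow]; apply Rmult_le_compat_l; [exact H|].
  rewrite <- (pow1 d); apply pow_incr; lra.
Qed.

Lemma cexp_opp_mod_lt (z : C) : 0 < Re z -> Cmod (cexp (- z)) < 1.
Proof. intro H; rewrite cexp_mod, re_opp, <- exp_0; apply exp_increasing; lra. Qed.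

(** After removal of [2 * bos], inclusion-exclusion leaves the powers x^n with n divisible by
    neither 2 nor D. These are the exponents below 2D; the second branch is meant for D = 5. *)
Definition Unum (D : nat) (x : C) : C :=
  match D with 3%nat => (x + x ^ 5)%C | _ => (x + x ^ 3 + x ^ 7 + x ^ 9)%C end.

Lemma Tcomb_U (D : nat) (z : C) : D = 3%nat \/ D = 5%nat -> 0 < Re z ->
  Tcomb (INR D) z = (2 * bos z + Unum D (cexp (- z)) / (1 - cexp (- z) ^ (2 * D)))%C.
Proof.
  intros HD Hz; assert (Hx := cexp_opp_mod_lt z Hz).
  unfold Tcomb.
  replace (2 * INR D) with (INR (2 * D)) by (rewrite mult_INR; reflexivity).
  change 2 with (INR 2) at 2.
  rewrite (bos_x 2), (bos_x D), (bos_x (2 * D)) by (auto; lia).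
  replace (bos z) with (cexp (- z) / (1 - cexp (- z)))%C.
  2:{ rewrite <- (Cpow_1_r (cexp (- z))), <- bos_x by (auto; lia).
      f_equal; change (INR 1) with 1; ring. }
  set (x := cexp (- z)) in *.
  assert (N1 := x_pow_neq 1 x Hx ltac:(lia)); rewrite Cpow_1_r in N1.
  assert (N2 := x_pow_neq 2 x Hx ltac:(lia)).
  assert (N3 := x_pow_neq D x Hx ltac:(lia)).
  assert (N4 := x_pow_neq (2 * D) x Hx ltac:(lia)).
  destruct HD as [-> | ->]; cbn [Unum Nat.mul Nat.add] in *; change (INR 2) with 2; field; auto.
Qed.

(** A series with nonnegative coefficients is largest in modulus at the positive point of a
    circle. *)
Lemma Unum_bound (D : nat) (x : C) : D = 3%nat \/ D = 5%nat -> Cmod x < 1 ->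
  Re (Unum D x / (1 - x ^ (2 * D)))%C <= Re (Unum D (Cmod x) / (1 - RtoC (Cmod x) ^ (2 * D)))%C.
Proof.
  intros HD Hx; assert (H0 := Cmod_ge_0 x).
  assert (HN : Cmod (Unum D x) <= Re (Unum D (Cmod x)) /\ Unum D (Cmod x) = RtoC (Re (Unum D (Cmod x)))).
  { destruct HD as [-> | ->]; cbn [Unum].
    - rewrite <- !RtoC_pow, <- !RtoC_plus; cbn [Re RtoC fst]; split; [|reflexivity].
      eapply Rle_trans; [apply Cmod_triangle|rewrite Cmod_pow; lra].
    - rewrite <- !RtoC_pow, <- !RtoC_plus; cbn [Re RtoC fst]; split; [|reflexivity].
      repeat (eapply Rle_trans; [apply Cmod_triangle|apply Rplus_le_compat]);
        rewrite ?Cmod_pow; lra. }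
  destruct HN as [HN HE]; rewrite HE.
  assert (Hp : Cmod x ^ (2 * D) < 1).
  { apply pow_lt_1_compat; [lra|lia]. }
  rewrite <- RtoC_pow, <- RtoC_minus, <- RtoC_div by lra; cbn [Re RtoC fst].
  eapply Rle_trans; [apply re_le_Cmod'|].
  rewrite Cmod_div by (apply x_pow_neq; [exact Hx|lia]).
  apply Rmult_le_compat; [apply Cmod_ge_0| |exact HN|].
  - left; apply Rinv_0_lt_compat, Cmod_gt_0, x_pow_neq; [exact Hx|lia].
  - apply Rinv_le_contravar; [lra|].
    generalize (Cmod_Rabs_triang 1 (- x ^ (2 * D))); rewrite Cmod_opp, Cmod_1, Cmod_pow.
    unfold Cminus; lra.
Qed.

Lemma bos_R (y : R) : 0 < y -> bos y = RtoC (/ (exp y - 1)).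
Proof.
  intro H; unfold bos; rewrite cexp_R, <- RtoC_minus, RtoC_inv; [reflexivity|].
  generalize (exp_ineq1 y ltac:(lra)); lra.
Qed.

Lemma re_bos_le (z : C) : 0 < Re z -> Re (bos z) <= Re (bos (RtoC (Re z))).
Proof.
  intro H; rewrite bos_R by exact H; eapply Rle_trans; [apply re_le_Cmod'|now apply bos_bound].
Qed.

Lemma re_Tcomb_le (D : nat) (z : C) : D = 3%nat \/ D = 5%nat -> 0 < Re z ->
  Re (Tcomb (INR D) z) - 2 * Re (bos z)
  <= Re (Tcomb (INR D) (RtoC (Re z))) - 2 * Re (bos (RtoC (Re z))).
Proof.
  intros HD Hz; rewrite (Tcomb_U D z HD Hz), (Tcomb_U D (RtoC (Re z)) HD Hz).
  rewrite !re_plus, !re_scal_l.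
  assert (H := Unum_bound D (cexp (- z)) HD (cexp_opp_mod_lt z Hz)).
  rewrite cexp_mod, re_opp in H.
  rewrite <- RtoC_opp, cexp_R; lra.
Qed.

Lemma lamcomb_Tcomb (D J : nat) (t : C) :
  lamcomb D J t = csum (fun j => / INR (S j) * Tcomb (INR D) (INR (S j) * t))%C J.
Proof.
  unfold lamcomb, Lam; rewrite <- csum_scal, <- !csum_minus, <- csum_plus.
  apply csum_ext; intros j _; unfold Tcomb.
  replace (INR (S j) * (2 * t))%C with (2 * (INR (S j) * t))%C by ring.
  replace (INR (S j) * (INR D * t))%C with (INR D * (INR (S j) * t))%C by ring.
  replace (INR (S j) * ((2 * INR D)%R * t))%C with ((2 * INR D)%R * (INR (S j) * t))%C by ring.
  ring.
Qed.

Lemma re_inv_INR (j : nat) (z : C) : Re (/ INR (S j) * z)%C = / INR (S j) * Re z.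
Proof. rewrite <- RtoC_inv by (generalize (INR_S_pos j); lra); apply re_scal_l. Qed.

(** Every term of the logarithm splits into [2 * bos] and a [Unum] part, both maximal on the real
    axis. Only the saving of [2 * bos] in the first term is retained. *)
Lemma re_LF_minor (D : nat) (t : C) : D = 3%nat \/ D = 5%nat -> 0 < Re t ->
  Re (LF (INR D) t)
  <= Re (LF (INR D) (RtoC (Re t))) - 2 * (Re (bos (RtoC (Re t))) - Re (bos t)).
Proof.
  intros HD Ht; assert (HD1 : (1 <= D)%nat) by lia.
  assert (L1 := clim_re _ _ (lamcomb_lim D t HD1 Ht)).
  assert (L2 := clim_re _ _ (lamcomb_lim D (RtoC (Re t)) HD1 Ht)).
  apply (is_lim_seq_le_loc _ (fun J => Re (lamcomb D J (RtoC (Re t))) - 2 * (Re (bos (RtoC (Re t))) - Re (bos t)))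
    (Re (LF (INR D) t)) (Re (LF (INR D) (RtoC (Re t))) - 2 * (Re (bos (RtoC (Re t))) - Re (bos t))))
    with (2 := L1).
  - exists 1%nat; intros J HJ; destruct J as [|J]; [lia|].
    rewrite !lamcomb_Tcomb, !re_csum.
    assert (Hs : forall u : nat -> R, rsum u (S J) = u O + rsum (fun k => u (S k)) J).
    { intro u; clear; induction J as [|J IH]; cbn [rsum]; [ring|]; cbn [rsum] in IH; rewrite IH; ring. }
    rewrite !Hs.
    assert (G : forall j, Re (/ INR (S j) * Tcomb (INR D) (INR (S j) * t))%C
      - / INR (S j) * (2 * Re (bos (INR (S j) * t)))
      <= Re (/ INR (S j) * Tcomb (INR D) (INR (S j) * RtoC (Re t)))%C
      - / INR (S j) * (2 * Re (bos (INR (S j) * RtoC (Re t))))).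
    { intro j; rewrite !re_inv_INR, <- !Rmult_minus_distr_l.
      assert (Hj := INR_S_pos j).
      apply Rmult_le_compat_l; [left; now apply Rinv_0_lt_compat|].
      assert (H := re_Tcomb_le D (INR (S j) * t) HD (re_scal_pos _ _ Hj Ht)).
      rewrite re_scal_l, RtoC_mult in H; exact H. }
    assert (G0 := G O); change (INR 1) with 1 in G0 |- *.
    rewrite !Cmult_1_l, Rinv_1, !Rmult_1_l in G0.
    rewrite !Cmult_1_l.
    assert (GS : rsum (fun k => Re (/ INR (S (S k)) * Tcomb (INR D) (INR (S (S k)) * t))%C) J
      <= rsum (fun k => Re (/ INR (S (S k)) * Tcomb (INR D) (INR (S (S k)) * RtoC (Re t)))%C) J).
    { apply rsum_le; intros k _; specialize (G (S k)).
      assert (Hk := INR_S_pos (S k)).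
      assert (Hb := re_bos_le (INR (S (S k)) * t) (re_scal_pos _ _ Hk Ht)).
      rewrite re_scal_l, RtoC_mult in Hb.
      assert (Hi : 0 < / INR (S (S k))) by now apply Rinv_0_lt_compat.
      nra. }
    lra.
  - apply is_lim_seq_minus'; [exact L2|apply is_lim_seq_const].
Qed.

(** The right-hand side is coth (y/2) / 2 times (1 - cos th) / (cosh y - cos th). *)
Lemma re_bos_diff (y th : R) : 0 < y -> 1 - cos th > 0 ->
  Re (bos (RtoC y)) - Re (bos (y, th))
  = (exp y - exp (- y)) / (exp y + exp (- y) - 2) / 2
    * ((1 - cos th) / ((exp y + exp (- y)) / 2 - cos th)).
Proof.
  intros Hy Hc; rewrite bos_R by exact Hy.
  assert (He := exp_ineq1 y ltac:(lra)).
  assert (E1 : exp y * exp (- y) = 1) by (rewrite <- exp_plus, Rplus_opp_r; apply exp_0).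
  assert (E2 : exp (- y) = / exp y) by apply exp_Ropp.
  assert (Hb : Re (bos (y, th)) = (exp y * cos th - 1) / (exp y ^ 2 - 2 * exp y * cos th + 1)).
  { change (Re (bos (y, th))) with
      ((exp y * cos th + - (1)) / ((exp y * cos th + - (1)) ^ 2 + (exp y * sin th + - 0) ^ 2)).
    f_equal.
    replace ((exp y * cos th + - (1)) ^ 2 + (exp y * sin th + - 0) ^ 2)
      with (exp y ^ 2 * (sin th * sin th + cos th * cos th) - 2 * exp y * cos th + 1) by ring.
    assert (H1 := sin2_cos2 th); unfold Rsqr in H1; rewrite H1; ring. }
  rewrite Hb, E2; cbn [Re RtoC fst]; set (e := exp y) in *; set (c := cos th) in *.
  assert (H1 : e ^ 2 - 2 * e * c + 1 <> 0) by (apply Rgt_not_eq; nra).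
  field; repeat split; try lra; try (apply Rgt_not_eq; nra).
Qed.

(** * The Bessel-type main term *)

Definition kcoef (nu i : nat) : R := / (INR (fact i) * INR (fact (i + nu))).

(* [z^(nu/2) * KB nu z] is the modified Bessel function [I_nu (2 sqrt z)]. *)
Definition KB (nu : nat) (z : R) : R := PSeries (kcoef nu) z.

Lemma kcoef_pos (nu i : nat) : 0 < kcoef nu i.
Proof. apply Rinv_0_lt_compat, Rmult_lt_0_compat; apply INR_fact_lt_0. Qed.

Lemma kcoef_CV (nu : nat) (z : R) : ex_series (fun i => Rabs (kcoef nu i * z ^ i)).
Proof.
  apply (ex_series_le (fun i => Rabs (kcoef nu i * z ^ i)) (fun i => / INR (fact i) * Rabs z ^ i)).
  - intro i; change (norm ?u) with (Rabs u); rewrite Rabs_Rabsolu, Rabs_mult, RPow_abs.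
    apply Rmult_le_compat_r; [apply Rabs_pos|].
    rewrite Rabs_pos_eq by (left; apply kcoef_pos).
    apply Rinv_le_contravar; [apply INR_fact_lt_0|].
    assert (H1 := INR_fact_lt_0 i).
    assert (H2 : 1 <= INR (fact (i + nu))) by (apply (le_INR 1), lt_O_fact); nra.
  - exists (exp (Rabs z)).
    apply (is_series_ext (fun i => scal (pow_n (Rabs z) i) (/ INR (fact i)))).
    + intro i; rewrite pow_n_pow; unfold scal; cbn; unfold mult; cbn; ring.
    + exact (is_exp_Reals (Rabs z)).
Qed.

Lemma kcoef_CV_radius (nu : nat) (z : R) : Rbar_lt (Rabs z) (CV_radius (kcoef nu)).
Proof.
  assert (H := proj1 (Lub_Rbar_correct (CV_disk (kcoef nu))) (Rabs z + 1) (kcoef_CV nu _)); fold (CV_radius (kcoef nu)) in H.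
  eapply Rbar_lt_le_trans; [|exact H].
  cbn; lra.
Qed.

Lemma is_derive_KB (nu : nat) (z : R) : is_derive (KB nu) z (KB (S nu) z).
Proof.
  assert (E : KB (S nu) z = PSeries (PS_derive (kcoef nu)) z).
  { apply PSeries_ext; intro i; unfold PS_derive, kcoef.
    rewrite Nat.add_succ_l, Nat.add_succ_r.
    change (fact (S i)) with (S i * fact i)%nat; rewrite mult_INR.
    field; repeat split; try apply INR_fact_neq_0; generalize (INR_S_pos i); lra. }
  rewrite E; apply is_derive_PSeries, kcoef_CV_radius.
Qed.

Lemma ex_KB (nu : nat) (z : R) : ex_pseries (kcoef nu) z.
Proof. apply CV_radius_inside, kcoef_CV_radius. Qed.

(** The three-term recurrence of Bessel functions. Together with [is_derive_KB] it is the
    differential equation u = (nu + 1) u' + z u''. *)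
Lemma KB_rec (nu : nat) (z : R) : KB nu z = (INR nu + 1) * KB (S nu) z + z * KB (S (S nu)) z.
Proof.
  unfold KB; rewrite <- PSeries_scal, <- PSeries_incr_1, <- PSeries_plus.
  - apply PSeries_ext; intro i; unfold PS_plus, PS_scal, PS_incr_1, kcoef, plus, scal; cbn; unfold mult; cbn.
    destruct i as [|i].
    + cbn [Nat.add]; change (fact (S nu)) with (S nu * fact nu)%nat; rewrite mult_INR, S_INR.
      unfold zero; cbn.
      field; repeat split; try apply INR_fact_neq_0; generalize (pos_INR nu); lra.
    + rewrite !Nat.add_succ_l, !Nat.add_succ_r.
      change (fact (S (S (i + nu)))) with (S (S (i + nu)) * fact (S (i + nu)))%nat.
      change (fact (S i)) with (S i * fact i)%nat.
      rewrite !mult_INR, !S_INR, plus_INR.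
      field; repeat split; try apply INR_fact_neq_0; generalize (pos_INR nu) (pos_INR i); lra.
  - apply ex_pseries_scal; [apply Rmult_comm|apply ex_KB].
  - apply ex_pseries_incr_1, ex_KB.
Qed.

Lemma KB_lim (nu : nat) (z : R) : is_lim_seq (rsum (fun i => kcoef nu i * z ^ i)) (KB nu z).
Proof.
  assert (H := PSeries_correct _ _ (ex_KB nu z)).
  apply is_lim_seq_incr_1, (is_lim_seq_ext (sum_n (fun i => scal (pow_n z i) (kcoef nu i)))); [|exact H].
  intro n; rewrite rsum_sum_n; apply sum_n_ext; intro i.
  rewrite pow_n_pow; unfold scal; cbn; unfold mult; cbn; ring.
Qed.

Lemma KB_lb (nu N : nat) (z : R) : 0 <= z -> rsum (fun i => kcoef nu i * z ^ i) N <= KB nu z.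
Proof.
  intro Hz; apply (is_lim_seq_incr_compare _ _ (KB_lim nu z)).
  intro n; cbn [rsum].
  assert (0 <= kcoef nu n * z ^ n) by (apply Rmult_le_pos; [left; apply kcoef_pos|now apply pow_le]); lra.
Qed.

Lemma KB_pos (nu : nat) (z : R) : 0 <= z -> 0 < KB nu z.
Proof.
  intro Hz; eapply Rlt_le_trans; [|exact (KB_lb nu 1 z Hz)].
  cbn; rewrite Rplus_0_l, Rmult_1_r; apply kcoef_pos.
Qed.

Lemma derC_pow (g : R -> C) (s : R) (l : C) (n : nat) : derC g s l ->
  derC (fun r => g r ^ S n)%C s (INR (S n) * l * g s ^ n)%C.
Proof.
  intro Hg; induction n as [|n IH].
  - apply derC_ext with g; [intro; cbn; ring|]; eapply derC_eq; [exact Hg|cbn; ring].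
  - apply derC_ext with (fun r => g r * g r ^ S n)%C; [intro; cbn; ring|].
    eapply derC_eq; [apply derC_mult; [exact Hg|exact IH]|].
    cbv beta; rewrite (S_INR (S n)), RtoC_plus, !Cpow_S; ring.
Qed.

Lemma smooth_pow (g : R -> C) (n : nat) : smooth g -> smooth (fun r => g r ^ n)%C.
Proof.
  intros Hg s; destruct n as [|n].
  - exists 0%C; apply derC_ext with (fun _ => RtoC 1); [reflexivity|apply derC_const].
  - destruct (Hg s) as [l Hl]; eexists; apply derC_pow; exact Hl.
Qed.

(** * The integral over a vertical segment, closed by a circular arc *)

Section Contour.
Variables (r phi : R).
Hypothesis r_pos : 0 < r.
Hypothesis phi_range : 0 < phi < PI / 2.

Let y := r * cos phi.
Let th0 := r * sin phi.

Definition arc (psi : R) : C := (r * cos psi, r * sin psi).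

Lemma cos_phi_pos : 0 < cos phi. Proof. apply cos_gt_0; lra. Qed.
Lemma sin_phi_pos : 0 < sin phi. Proof. apply sin_gt_0; generalize PI_bounds; lra. Qed.

Lemma line_neq_0 (th : R) : (y, th) <> RtoC 0.
Proof.
  intro E; injection E; intros _ E1.
  assert (H : 0 < y) by (apply Rmult_lt_0_compat; [exact r_pos|apply cos_phi_pos]); lra.
Qed.

Lemma arc_mod (psi : R) : Cmod (arc psi) = r.
Proof.
  unfold Cmod, arc; cbn [fst snd].
  replace ((r * cos psi) ^ 2 + (r * sin psi) ^ 2) with (r ^ 2 * (sin psi * sin psi + cos psi * cos psi)) by ring.
  generalize (sin2_cos2 psi); unfold Rsqr; intros ->.
  rewrite Rmult_1_r; apply sqrt_pow2; lra.
Qed.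

Lemma arc_neq_0 (psi : R) : arc psi <> RtoC 0.
Proof. apply Cmod_gt_0; rewrite arc_mod; exact r_pos. Qed.

Lemma derC_line (th : R) : derC (fun s => (y, s)) th Ci.
Proof.
  apply derC_ext with (fun s => (RtoC y + RtoC s * Ci)%C); [|apply derC_lin].
  intro s; apply injective_projections; cbn; ring.
Qed.

Lemma derC_arc (psi : R) : derC arc psi (Ci * arc psi)%C.
Proof. split; cbn; auto_derive; auto; ring. Qed.

Lemma smooth_line' : smooth (fun s => (y, s)).
Proof. intro s; eexists; apply derC_line. Qed.

Lemma smooth_arc : smooth arc.
Proof. intro s; eexists; apply derC_arc. Qed.

(** [v] is the real part of the integral of h dt / i over the closed contour: dt / i is d th on the
    segment and t d psi on the arc. *)
Definition is_loop (h : C -> C) (v : R) :=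
  exists v1 v2, is_RInt (fun th => Re (h (y, th))) (- th0) th0 v1 /\
    is_RInt (fun psi => Re (arc psi * h (arc psi))%C) phi (2 * PI - phi) v2 /\ v = v1 + v2.

Lemma is_loop_ext (h h' : C -> C) (v : R) : (forall t, t <> RtoC 0 -> h t = h' t) -> is_loop h v -> is_loop h' v.
Proof.
  intros E [v1 [v2 [H1 [H2 H3]]]]; exists v1, v2; split; [|split; [|exact H3]].
  - apply (is_RInt_ext (fun th => Re (h (y, th)))); [|exact H1].
    intros th _; rewrite E; [reflexivity|apply line_neq_0].
  - apply (is_RInt_ext (fun psi => Re (arc psi * h (arc psi))%C)); [|exact H2].
    intros psi _; rewrite E; [reflexivity|apply arc_neq_0].
Qed.

Lemma is_loop_plus (h h' : C -> C) (v v' : R) : is_loop h v -> is_loop h' v' ->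
  is_loop (fun t => h t + h' t)%C (v + v').
Proof.
  intros [v1 [v2 [H1 [H2 ->]]]] [w1 [w2 [H3 [H4 ->]]]]; exists (v1 + w1), (v2 + w2).
  split; [|split; [|ring]].
  - apply (is_RInt_ext (fun th => Re (h (y, th)) + Re (h' (y, th)))).
    + intros th _; rewrite re_plus; reflexivity.
    + exact (is_RInt_plus _ _ _ _ _ _ H1 H3).
  - apply (is_RInt_ext (fun psi => Re (arc psi * h (arc psi))%C + Re (arc psi * h' (arc psi))%C)).
    + intros psi _; rewrite <- re_plus; f_equal; ring.
    + exact (is_RInt_plus _ _ _ _ _ _ H2 H4).
Qed.

Lemma is_loop_scal (a : R) (h : C -> C) (v : R) : is_loop h v -> is_loop (fun t => RtoC a * h t)%C (a * v).
Proof.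
  intros [v1 [v2 [H1 [H2 ->]]]]; exists (a * v1), (a * v2).
  split; [|split; [|ring]].
  - apply (is_RInt_ext (fun th => a * Re (h (y, th)))).
    + intros th _; rewrite re_scal_l; reflexivity.
    + exact (is_RInt_scal _ _ _ a _ H1).
  - apply (is_RInt_ext (fun psi => a * Re (arc psi * h (arc psi))%C)).
    + intros psi _; rewrite <- re_scal_l; f_equal; ring.
    + exact (is_RInt_scal _ _ _ a _ H2).
Qed.

Lemma is_RInt_0 (a b : R) : is_RInt (fun _ => 0) a b 0.
Proof.
  generalize (is_RInt_const (V := R_NormedModule) a b 0); unfold scal; cbn; unfold mult; cbn.
  now rewrite Rmult_0_r.
Qed.

Lemma is_loop_0 : is_loop (fun _ => 0%C) 0.
Proof.
  exists 0, 0; split; [|split; [|ring]].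
  - apply is_RInt_0.
  - apply (is_RInt_ext (fun _ => 0)); [|apply is_RInt_0].
    intros psi _; cbn; ring.
Qed.

Lemma is_loop_csum (h : nat -> C -> C) (v : nat -> R) (n : nat) :
  (forall k, (k < n)%nat -> is_loop (h k) (v k)) -> is_loop (fun t => csum (fun k => h k t) n) (rsum v n).
Proof.
  induction n as [|n IH]; intro H; cbn [csum rsum]; [apply is_loop_0|].
  apply is_loop_plus; [apply IH; intros; apply H; lia|apply H; lia].
Qed.

Lemma smooth_continuous (g : R -> C) (x : R) : smooth g -> continuous (fun s => Re (g s)) x.
Proof.
  intro H; destruct (H x) as [l [Hl _]]; apply (ex_derive_continuous (fun s => Re (g s))); eexists; exact Hl.
Qed.

Lemma is_loop_prim (H h : C -> C) :
  (forall g s l, (forall s, g s <> RtoC 0) -> derC g s l -> derC (fun s => H (g s)) s (l * h (g s))%C) ->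
  (forall g, (forall s, g s <> RtoC 0) -> smooth g -> smooth (fun s => h (g s))) ->
  is_loop h 0.
Proof.
  intros HH Hh; assert (HPI := PI_bounds).
  exists (Im (H (y, th0)) - Im (H (y, - th0))), (Im (H (arc (2 * PI - phi))) - Im (H (arc phi))).
  split; [|split].
  - apply (is_RInt_derive (fun th => Im (H (y, th)))).
    + intros th _; destruct (HH _ th _ line_neq_0 (derC_line th)) as [_ D].
      replace (Re (h (y, th))) with (Im (Ci * h (y, th))%C) by (cbn; unfold Re, Im; ring); exact D.
    + intros th _; apply (smooth_continuous (fun s => h (y, s))).
      apply (Hh (fun s => (y, s))); [exact line_neq_0|apply smooth_line'].
  - apply (is_RInt_derive (fun psi => Im (H (arc psi)))).
    + intros psi _; destruct (HH _ psi _ arc_neq_0 (derC_arc psi)) as [_ D].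
      replace (Re (arc psi * h (arc psi))%C) with (Im (Ci * arc psi * h (arc psi))%C) by (cbn; unfold Re, Im; ring).
      exact D.
    + intros psi _; apply (smooth_continuous (fun s => arc s * h (arc s))%C).
      apply smooth_mult; [apply smooth_arc|apply Hh; [exact arc_neq_0|apply smooth_arc]].
  - replace (arc (2 * PI - phi)) with ((y, - th0) : C); [change (arc phi) with ((y, th0) : C); ring|].
    unfold arc, y, th0; rewrite <- (cos_neg (2 * PI - phi)).
    replace (- (2 * PI - phi)) with (phi - 2 * INR 1 * PI) by (cbn; ring).
    replace (sin (2 * PI - phi)) with (- sin phi).
    + f_equal; [|ring]; f_equal.
      rewrite <- (cos_period (phi - 2 * INR 1 * PI) 1); f_equal; ring.
    + rewrite <- sin_neg, <- (sin_period (- phi) 1); f_equal; cbn; ring.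
Qed.

Lemma is_loop_pow (k : nat) : is_loop (fun t => t ^ k)%C 0.
Proof.
  apply (is_loop_prim (fun t => / INR (S k) * t ^ S k)%C).
  - intros g s l _ D; eapply derC_eq; [apply derC_scal, derC_pow, D|field; auto].
  - intros g _ Hg; now apply smooth_pow.
Qed.

Lemma is_loop_inv_pow (k : nat) : is_loop (fun t => (/ t) ^ S (S k))%C 0.
Proof.
  apply (is_loop_prim (fun t => - / INR (S k) * (/ t) ^ S k)%C).
  - intros g s l Hg D; eapply derC_eq; [apply derC_scal, derC_pow, derC_inv; [apply Hg|exact D]|].
    rewrite !Cpow_S; field; auto.
  - intros g Hn Hg; apply smooth_pow, smooth_inv; assumption.
Qed.

(** The winding number is computed by angles: the segment contributes 2 phi through the arctangent
    and the arc 2 pi - 2 phi. *)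
Lemma is_loop_inv : is_loop (fun t => / t)%C (2 * PI).
Proof.
  assert (HPI := PI_bounds); assert (Hc := cos_phi_pos); assert (Hs := sin_phi_pos).
  assert (Hy : 0 < y) by (apply Rmult_lt_0_compat; assumption).
  exists (atan (th0 / y) - atan (- th0 / y)), (2 * PI - 2 * phi); split; [|split].
  - apply (is_RInt_derive (fun th => atan (th / y))).
    + intros th _; eapply is_derive_eq with (l := / y / (1 + (th / y) ^ 2)); [|reflexivity|].
      * auto_derive; [exact I|field; repeat split; apply Rgt_not_eq; nra].
      * change (Re (/ (y, th))%C) with (y / (y ^ 2 + th ^ 2)).
        field; repeat split; apply Rgt_not_eq; nra.
    + intros th _; apply (smooth_continuous (fun s => / (y, s))%C).
      apply smooth_inv; [exact line_neq_0|apply smooth_line'].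
  - apply (is_RInt_ext (fun _ => 1)).
    + intros psi _; rewrite Cinv_r by apply arc_neq_0; reflexivity.
    + replace (2 * PI - 2 * phi) with ((2 * PI - phi - phi) * 1) by ring.
      exact (is_RInt_const (V := R_NormedModule) phi (2 * PI - phi) 1).
  - replace (th0 / y) with (tan phi) by (unfold tan, y, th0; field; lra).
    replace (- th0 / y) with (- tan phi) by (unfold tan, y, th0; field; lra).
    rewrite atan_opp, atan_tan by lra; ring.
Qed.

Lemma is_loop_mono (i j : nat) :
  is_loop (fun t => t * t ^ j * (/ t) ^ i)%C (if (i =? j + 2)%nat then 2 * PI else 0).
Proof.
  assert (Hp : forall (t : C) k, t <> RtoC 0 -> (t ^ k * (/ t) ^ k)%C = 1%C).
  { intros t k Ht; rewrite <- Cpow_mult_l, Cinv_r by exact Ht; apply Cpow_1_l. }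
  destruct (Nat.eqb_spec i (j + 2)) as [->|Hij].
  - apply is_loop_ext with (2 := is_loop_inv); intros t Ht.
    replace (j + 2)%nat with (S (S j)) by lia; rewrite !Cpow_S.
    replace (t * t ^ j * (/ t * (/ t * (/ t) ^ j)))%C with (/ t * (t ^ j * (/ t) ^ j))%C by (field; exact Ht).
    rewrite Hp by exact Ht; ring.
  - destruct (Nat.le_gt_cases i (S j)) as [H|H].
    + apply is_loop_ext with (2 := is_loop_pow (S j - i)); intros t Ht.
      change (t * t ^ j)%C with (t ^ S j)%C.
      replace (S j) with ((S j - i) + i)%nat at 2 by lia.
      rewrite Cpow_add_r, <- Cmult_assoc, Hp by exact Ht; ring.
    + apply is_loop_ext with (2 := is_loop_inv_pow (i - j - 3)); intros t Ht.
      change (t * t ^ j)%C with (t ^ S j)%C.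
      replace i with (S j + S (S (i - j - 3)))%nat at 2 by lia.
      rewrite Cpow_add_r, Cmult_assoc, Hp by exact Ht; ring.
Qed.

Variables (A x : R).
Hypothesis A_pos : 0 < A.
Hypothesis x_pos : 0 < x.

(** Truncation makes the integrand a Laurent polynomial. The series in A/t has two more terms, so
    that each power x^j finds the partner A^(j+2) that produces a residue. *)
Definition GN (N : nat) (t : C) : C := (t * cexp_tr (S N + 2) (A / t) * cexp_tr (S N) (x * t))%C.

Definition GG (t : C) : C := (t * cexp (A / t) * cexp (x * t))%C.

Lemma rsum_single (a : R) (k n : nat) : (k < n)%nat ->
  rsum (fun i => if (i =? k)%nat then a else 0) n = a.
Proof.
  intro H; induction n as [|n IH]; [lia|]; cbn [rsum].
  destruct (Nat.eqb_spec n k) as [->|Hn].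
  - replace (rsum _ k) with (rsum (fun _ => 0) k); [rewrite rsum_const; ring|].
    apply rsum_ext; intros i Hi; destruct (Nat.eqb_spec i k); [lia|reflexivity].
  - rewrite IH by lia; ring.
Qed.

Lemma is_loop_GN (N : nat) :
  is_loop (GN N) (2 * PI * A ^ 2 * rsum (fun j => kcoef 2 j * (A * x) ^ j) (S N)).
Proof.
  set (c := fun i j : nat => / INR (fact i) * A ^ i * (/ INR (fact j) * x ^ j)).
  apply is_loop_ext with (fun t => csum (fun j => csum (fun i =>
      RtoC (c i j) * (t * t ^ j * (/ t) ^ i))%C (S N + 2)) (S N)).
  - intros t Ht; unfold GN, cexp_tr.
    symmetry; rewrite <- (csum_scal (t * _)%C); apply csum_ext; intros j _.
    match goal with |- (t * ?c1 * ?u)%C = _ => replace (t * c1 * u)%C with ((t * u) * c1)%C by ring end.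
    rewrite <- csum_scal; apply csum_ext; intros i _.
    unfold c; rewrite !RtoC_mult, !RtoC_inv, !RtoC_pow by apply INR_fact_neq_0.
    rewrite Cpow_mult_l; unfold Cdiv; rewrite Cpow_mult_l; ring.
  - replace (2 * PI * A ^ 2 * rsum (fun j => kcoef 2 j * (A * x) ^ j) (S N))
      with (rsum (fun j => rsum (fun i => c i j * (if (i =? j + 2)%nat then 2 * PI else 0)) (S N + 2)) (S N)).
    + apply is_loop_csum; intros j _; apply is_loop_csum; intros i _.
      apply is_loop_scal, is_loop_mono.
    + rewrite <- rsum_scal; apply rsum_ext; intros j Hj.
      rewrite (rsum_ext _ (fun i => if (i =? j + 2)%nat then 2 * PI * c (j + 2)%nat j else 0)).
      * rewrite rsum_single by lia; unfold c, kcoef.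
        rewrite Rpow_mult_distr, pow_add, Rinv_mult; ring.
      * intros i _; destruct (Nat.eqb_spec i (j + 2)) as [->|]; ring.
Qed.

Definition trerr (N : nat) (b : R) : R := 2 * (/ INR (fact N) * b ^ S N) * exp (2 * b).

Lemma trerr_lim (b : R) : is_lim_seq (fun N => trerr N b) 0.
Proof.
  assert (H : is_lim_seq (fun n => b ^ n / INR (fact n)) 0).
  { apply is_lim_seq_Reals, cv_speed_pow_fact. }
  apply is_lim_seq_ext with (fun N => 2 * b * exp (2 * b) * (b ^ N / INR (fact N))).
  - intro N; unfold trerr; cbn; field; apply INR_fact_neq_0.
  - now apply is_lim_seq_0_scal.
Qed.

Lemma cexp_tr_err (N : nat) (w : C) (b : R) : Cmod w <= b ->
  Cmod (cexp w - cexp_tr (S N) w)%C <= trerr N b.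
Proof.
  intro H; assert (H0 := Cmod_ge_0 w); eapply Rle_trans; [apply cexp_tr_bound|].
  assert (Hf := Rinv_0_lt_compat _ (INR_fact_lt_0 N)).
  unfold trerr; apply Rmult_le_compat.
  - apply Rmult_le_pos; [lra|apply Rmult_le_pos; [lra|now apply pow_le]].
  - left; apply exp_pos.
  - apply Rmult_le_compat_l; [lra|]; apply Rmult_le_compat_l; [lra|]; now apply pow_incr.
  - apply exp_le; lra.
Qed.

Definition GNerr (N : nat) : R :=
  r * (trerr (N + 2) (A / y) * (exp (x * r) + trerr N (x * r)) + exp (A / y) * trerr N (x * r)).

Lemma GNerr_lim : is_lim_seq GNerr 0.
Proof.
  apply is_lim_seq_0_scal, is_lim_seq_0_plus.
  - replace 0 with (0 * (exp (x * r) + 0)) by ring; apply is_lim_seq_mult'.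
    + apply (is_lim_seq_incr_n (fun N => trerr N (A / y))), trerr_lim.
    + apply is_lim_seq_plus'; [apply is_lim_seq_const|apply trerr_lim].
  - apply is_lim_seq_0_scal, trerr_lim.
Qed.

Lemma GN_err (N : nat) (t : C) : y <= Cmod t <= r -> Cmod (GG t - GN N t)%C <= GNerr N.
Proof.
  intros [H1 H2].
  assert (Hy : 0 < y) by (apply Rmult_lt_0_compat; [exact r_pos|apply cos_phi_pos]).
  assert (Ht : t <> RtoC 0) by (apply Cmod_gt_0; lra).
  assert (Ha : Cmod (A / t)%C <= A / y).
  { rewrite Cmod_div, Cmod_R, Rabs_pos_eq by (auto; lra).
    apply Rmult_le_compat_l; [lra|apply Rinv_le_contravar; lra]. }
  assert (Hx : Cmod (x * t)%C <= x * r).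
  { rewrite Cmod_mult, Cmod_R, Rabs_pos_eq by lra; apply Rmult_le_compat_l; lra. }
  assert (E1 := cexp_tr_err (N + 2) _ _ Ha); assert (E2 := cexp_tr_err N _ _ Hx).
  replace (S (N + 2)) with (S N + 2)%nat in E1 by lia.
  unfold GG, GN, GNerr.
  set (a := cexp (A / t)) in *; set (a' := cexp_tr (S N + 2) (A / t)) in *.
  set (b := cexp (x * t)) in *; set (b' := cexp_tr (S N) (x * t)) in *.
  replace (t * a * b - t * a' * b')%C with (t * ((a - a') * b' + a * (b - b')))%C by ring.
  rewrite Cmod_mult; apply Rmult_le_compat; try apply Cmod_ge_0; [exact H2|].
  eapply Rle_trans; [apply Cmod_triangle|rewrite !Cmod_mult].
  apply Rplus_le_compat; apply Rmult_le_compat; try apply Cmod_ge_0; auto.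
  - replace b' with (b + - (b - b'))%C by ring.
    eapply Rle_trans; [apply Cmod_triangle|rewrite Cmod_opp]; apply Rplus_le_compat; [|exact E2].
    eapply Rle_trans; [apply cexp_mod_le|now apply exp_le].
  - eapply Rle_trans; [apply cexp_mod_le|now apply exp_le].
Qed.

Lemma cos_arc_le (psi : R) : phi <= psi <= 2 * PI - phi -> cos psi <= cos phi.
Proof.
  intro H; assert (HPI := PI_bounds).
  assert (G : forall u, phi <= u <= PI -> cos u <= cos phi).
  { intros u Hu; destruct (Rle_lt_or_eq_dec _ _ (proj1 Hu)) as [Hlt|<-]; [|lra].
    left; apply cos_decreasing_1; lra. }
  destruct (Rle_dec psi PI) as [Hp|Hp]; [apply G; lra|].
  replace (cos psi) with (cos (2 * PI - psi)); [apply G; lra|].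
  rewrite <- (cos_neg psi), <- (cos_period (- psi) 1); f_equal; cbn; ring.
Qed.

(** On the circle both Re (A/t) and Re (x t) are positive multiples of cos psi, hence largest at the
    end points of the arc. *)
Lemma GG_arc_bound (psi : R) : phi <= psi <= 2 * PI - phi ->
  Cmod (GG (arc psi)) <= r * exp (A * y / r ^ 2 + x * y).
Proof.
  intro H; assert (Hc := cos_arc_le psi H).
  unfold GG; rewrite !Cmod_mult, arc_mod, !cexp_mod, Rmult_assoc, <- exp_plus.
  apply Rmult_le_compat_l; [lra|]; apply exp_le.
  replace (Re (A / arc psi)) with (A * cos psi / r).
  - rewrite re_scal_l; unfold y.
    replace (A * (r * cos phi) / r ^ 2) with (A / r * cos phi) by (field; lra).
    replace (A * cos psi / r) with (A / r * cos psi) by (field; lra).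
    change (Re (arc psi)) with (r * cos psi).
    assert (0 < A / r) by (now apply Rdiv_lt_0_compat).
    assert (0 < x * r) by (now apply Rmult_lt_0_compat); nra.
  - unfold Cdiv; rewrite re_scal_l.
    change (Re (/ arc psi)) with (r * cos psi / ((r * cos psi) ^ 2 + (r * sin psi) ^ 2)).
    replace ((r * cos psi) ^ 2 + (r * sin psi) ^ 2) with (r ^ 2 * (sin psi * sin psi + cos psi * cos psi)) by ring.
    generalize (sin2_cos2 psi); unfold Rsqr; intros ->; field; lra.
Qed.

Lemma line_mod (th : R) : - th0 <= th <= th0 -> y <= Cmod (y, th) <= r.
Proof.
  intro H; assert (Hy : 0 < y) by (apply Rmult_lt_0_compat; [exact r_pos|apply cos_phi_pos]).
  split.
  - generalize (re_le_Cmod' (y, th)); cbn; lra.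
  - unfold Cmod; cbn [fst snd]; rewrite <- (sqrt_pow2 r) by lra; apply sqrt_le_1_alt.
    assert (E : r ^ 2 = y ^ 2 + th0 ^ 2).
    { unfold y, th0; generalize (sin2_cos2 phi); unfold Rsqr; intro E.
      replace (r ^ 2) with (r ^ 2 * (sin phi * sin phi + cos phi * cos phi)) by (rewrite E; ring); ring. }
    rewrite E; apply Rplus_le_compat_l; nra.
Qed.

Lemma smooth_GG_line : smooth (fun th => GG (y, th)).
Proof.
  apply (smooth_mult (fun th => (y, th) * cexp (A / (y, th)))%C (fun th => cexp (x * (y, th)))%C).
  - apply (smooth_mult (fun th => (y, th)) (fun th => cexp (A / (y, th)))%C); [apply smooth_line'|].
    apply (smooth_cexp (fun th => A / (y, th)))%C, (smooth_mult (fun _ => RtoC A) (fun th => / (y, th))%C);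
      [apply smooth_const|].
    apply (smooth_inv (fun th => (y, th))); [exact line_neq_0|apply smooth_line'].
  - apply (smooth_cexp (fun th => x * (y, th)))%C, (smooth_mult (fun _ => RtoC x) (fun th => (y, th)));
      [apply smooth_const|apply smooth_line'].
Qed.

(* The vertical segment is closed by the arc of the circle [|t| = r] through
   [Re t <= y], on which the integrand is small. *)
Theorem segment_integral :
  Rabs (RInt (fun th => Re (GG (y, th))) (- th0) th0 - 2 * PI * A ^ 2 * KB 2 (A * x))
  <= 2 * PI * (r * (r * exp (A * y / r ^ 2 + x * y))).
Proof.
  assert (HPI := PI_bounds); assert (Hs := sin_phi_pos).
  assert (Hth : 0 < th0) by (apply Rmult_lt_0_compat; assumption).
  set (Bd := r * exp (A * y / r ^ 2 + x * y)).
  assert (HBd : 0 < Bd) by (apply Rmult_lt_0_compat; [exact r_pos|apply exp_pos]).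
  set (J := RInt _ _ _).
  assert (Step : forall N, Rabs (J - 2 * PI * A ^ 2 * rsum (fun j => kcoef 2 j * (A * x) ^ j) (S N))
    <= 2 * PI * (r * Bd) + (2 * th0 + 2 * PI * r) * GNerr N).
  { intro N; destruct (is_loop_GN N) as [v1 [v2 [H1 [H2 H3]]]]; rewrite H3.
    assert (HGN : 0 <= GNerr N).
    { eapply Rle_trans; [apply Cmod_ge_0|apply (GN_err N (y, 0)), line_mod; lra]. }
    assert (B1 : Rabs (J - v1) <= (th0 - - th0) * GNerr N).
    { rewrite <- (is_RInt_unique _ _ _ _ H1); unfold J.
      assert (E1 := smooth_ex_RInt _ (- th0) th0 smooth_GG_line).
      assert (E2 : ex_RInt (fun th => Re (GN N (y, th))) (- th0) th0) by (eexists; exact H1).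
      assert (E3 : RInt (fun th => Re (GG (y, th))) (- th0) th0 - RInt (fun th => Re (GN N (y, th))) (- th0) th0
        = RInt (fun th => Re (GG (y, th)) - Re (GN N (y, th))) (- th0) th0).
      { symmetry; exact (RInt_minus (V := R_CompleteNormedModule) _ _ _ _ E1 E2). }
      rewrite E3.
      apply abs_RInt_le_const; [lra|exact (ex_RInt_minus _ _ _ _ E1 E2)|].
      intros th Hth'; eapply Rle_trans; [|apply (GN_err N (y, th)), line_mod, Hth'].
      eapply Rle_trans; [|apply re_le_Cmod]; right; f_equal; unfold Cminus; rewrite re_plus, re_opp; reflexivity. }
    assert (B2 : Rabs v2 <= (2 * PI - phi - phi) * (r * (Bd + GNerr N))).
    { rewrite <- (is_RInt_unique _ _ _ _ H2).
      apply abs_RInt_le_const; [lra|eexists; exact H2|].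
      intros psi Hpsi; eapply Rle_trans; [apply re_le_Cmod|].
      rewrite Cmod_mult, arc_mod; apply Rmult_le_compat_l; [lra|].
      replace (GN N (arc psi)) with (GG (arc psi) + - (GG (arc psi) - GN N (arc psi)))%C by ring.
      eapply Rle_trans; [apply Cmod_triangle|rewrite Cmod_opp]; apply Rplus_le_compat.
      - now apply GG_arc_bound.
      - apply GN_err; rewrite arc_mod; split; [|lra].
        unfold y; generalize (COS_bound phi); nra. }
    replace (J - (v1 + v2)) with ((J - v1) + - v2) by ring.
    eapply Rle_trans; [apply Rabs_triang|rewrite Rabs_Ropp].
    assert (0 <= r * (Bd + GNerr N)) by (apply Rmult_le_pos; lra).
    assert ((2 * PI - phi - phi) * (r * (Bd + GNerr N)) <= 2 * PI * (r * (Bd + GNerr N)))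
      by (apply Rmult_le_compat_r; lra).
    lra. }
  assert (L1 : is_lim_seq (fun N => Rabs (J - 2 * PI * A ^ 2 * rsum (fun j => kcoef 2 j * (A * x) ^ j) (S N)))
     (Rabs (J - 2 * PI * A ^ 2 * KB 2 (A * x)))).
  { apply (is_lim_seq_abs _ (J - 2 * PI * A ^ 2 * KB 2 (A * x))).
    apply is_lim_seq_minus'; [apply is_lim_seq_const|].
    apply is_lim_seq_mult'; [apply is_lim_seq_const|].
    apply (is_lim_seq_incr_1 (rsum _)), KB_lim. }
  assert (L2 : is_lim_seq (fun N => 2 * PI * (r * Bd) + (2 * th0 + 2 * PI * r) * GNerr N) (2 * PI * (r * Bd))).
  { replace (Finite (2 * PI * (r * Bd))) with (Finite (2 * PI * (r * Bd) + 0)) by (f_equal; ring).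
    apply is_lim_seq_plus'; [apply is_lim_seq_const|apply is_lim_seq_0_scal, GNerr_lim]. }
  exact (is_lim_seq_le _ _ _ _ Step L1 L2).
Qed.

End Contour.

(** * Logarithmic derivatives of the main term *)

Ltac pown := match goal with |- ?e <> 0 => apply (Rgt_not_eq e 0);
  first [apply pow_lt; lra | nra | apply Rmult_lt_0_compat; nra] end.

Ltac conjs := repeat match goal with |- _ /\ _ => split end; try exact I.

Lemma MVT_open (f f' : R -> R) (a b : R) : a < b ->
  (forall c, a <= c <= b -> is_derive f c (f' c)) ->
  exists c, f b - f a = f' c * (b - a) /\ a < c < b.
Proof.
  intros Hab H; apply (MVT_cor2 f f' a b Hab).
  intros c Hc; apply is_derive_Reals, H, Hc.
Qed.

(** Beyond the last point s with f <= 0 the function would be positive and nonincreasing, against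
    continuity at s. Only continuity is asked at 0, where the differential equations for [gK] and
    [VK] are singular. *)
Lemma barrier (f f' : R -> R) :
  (forall z, 0 <= z -> continuity_pt f z) -> (forall z, 0 < z -> is_derive f z (f' z)) ->
  f 0 <= 0 -> (forall z, 0 < z -> 0 < f z -> f' z <= 0) -> forall z, 0 <= z -> f z <= 0.
Proof.
  intros Hc Hd H0 Hf x1 Hx1; apply Rnot_lt_le; intro Hpos.
  set (E := fun z => 0 <= z <= x1 /\ f z <= 0).
  destruct (completeness E) as [s [Hub Hlub]].
  - exists x1; intros z [Hz _]; lra.
  - exists 0; split; [lra|exact H0].
  - assert (Hs0 : 0 <= s) by (apply Hub; split; [lra|exact H0]).
    assert (Hs1 : s <= x1) by (apply Hlub; intros z [Hz _]; lra).
    assert (Hfs : f s <= 0).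
    { apply Rnot_lt_le; intro Hfs.
      destruct (Hc s Hs0 (f s) Hfs) as [d [Hd0 Hdd]].
      assert (Hle : s <= s - Rmin d 1).
      { apply Hlub; intros z [Hz1 Hz2].
        apply Rnot_lt_le; intro Hlt.
        assert (Hzs : z <= s) by (apply Hub; split; auto).
        destruct (Req_dec z s) as [->|Hne]; [lra|].
        assert (Hb : R_dist (f z) (f s) < f s).
        { apply (Hdd z); split.
          - split; [exact I|auto].
          - cbn; unfold R_dist; rewrite Rabs_left1 by lra.
            generalize (Rmin_l d 1); lra. }
        unfold R_dist in Hb; apply Rabs_lt_between in Hb; lra. }
      assert (0 < Rmin d 1) by (apply Rmin_glb_lt; lra); lra. }
    assert (Hlt : s < x1) by (destruct (Rle_lt_or_eq_dec _ _ Hs1) as [|<-]; lra).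
    assert (Hpos' : forall z, s < z <= x1 -> 0 < f z).
    { intros z Hz; apply Rnot_le_lt; intro Hn.
      assert (z <= s) by (apply Hub; split; lra); lra. }
    destruct (MVT_gen f s x1 f') as [c _].
    + rewrite Rmin_left, Rmax_right by lra; intros c Hc'; apply Hd; lra.
    + rewrite Rmin_left, Rmax_right by lra; intros c Hc'; apply Hc; lra.
    + destruct (MVT_open f f' ((s + x1) / 2) x1 ltac:(lra)) as [c1 [E1 Hc1]].
      { intros c' Hc'; apply Hd; lra. }
      assert (Hmono : forall u v, s < u -> u < v -> v <= x1 -> f v <= f u).
      { intros u v Hu Huv Hv; destruct (MVT_open f f' u v Huv) as [c2 [E2 Hc2]].
        - intros c' Hc'; apply Hd; lra.
        - assert (f' c2 <= 0) by (apply Hf; [lra|apply Hpos'; lra]); nra. }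
      assert (Hx1' : 0 < f x1) by (apply Hpos'; lra).
      destruct (Hc s Hs0 (f x1) Hx1') as [d [Hd0 Hdd]].
      set (u := Rmin (s + d / 2) ((s + x1) / 2)).
      assert (Hu1 : u <= s + d / 2) by apply Rmin_l.
      assert (Hu2 : u <= (s + x1) / 2) by apply Rmin_r.
      assert (Hu3 : s < u) by (apply Rmin_glb_lt; lra).
      assert (Hb : R_dist (f u) (f s) < f x1).
      { apply (Hdd u); split.
        - split; [exact I|lra].
        - cbn; unfold R_dist; rewrite Rabs_pos_eq by lra; lra. }
      unfold R_dist in Hb; apply Rabs_lt_between in Hb.
      assert (f x1 <= f u) by (apply Hmono; lra); lra.
Qed.

(* [gK = z (log (KB 2))'] and [VK = - z^2 (log (KB 2))'']. *)
Definition gK (z : R) : R := z * KB 3 z / KB 2 z.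

Definition VK (z : R) : R := gK z ^ 2 + 3 * gK z - z.

Lemma KB_pos_neq (nu : nat) (z : R) : 0 <= z -> KB nu z <> 0.
Proof. intro H; generalize (KB_pos nu z H); lra. Qed.

Lemma is_derive_gK0 (z : R) : 0 <= z ->
  is_derive gK z (KB 3 z / KB 2 z + z * (KB 4 z / KB 2 z - (KB 3 z / KB 2 z) ^ 2)).
Proof.
  intro Hz; assert (H2 := KB_pos_neq 2 z Hz).
  unfold gK; auto_derive.
  - conjs; auto; eexists; apply is_derive_KB.
  - replace (Derive (fun x => KB 3 x) z) with (KB 4 z) by (symmetry; exact (is_derive_unique _ _ _ (is_derive_KB 3 z))).
    replace (Derive (fun x => KB 2 x) z) with (KB 3 z) by (symmetry; exact (is_derive_unique _ _ _ (is_derive_KB 2 z))).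
    field; exact H2.
Qed.

(** The recurrence eliminates [KB 4]; written out, this is the Riccati equation z g' = z - 2 g -
    g^2. *)
Lemma is_derive_gK (z : R) : 0 < z -> is_derive gK z ((gK z - VK z) / z).
Proof.
  intro Hz; assert (H2 := KB_pos_neq 2 z ltac:(lra)).
  eapply is_derive_eq; [apply is_derive_gK0; lra|reflexivity|].
  unfold VK, gK.
  assert (E := KB_rec 2 z); change (INR 2) with 2 in E.
  replace (KB 4 z) with ((KB 2 z - 3 * KB 3 z) / z) by (rewrite E at 1; field; lra).
  field; split; [exact H2|lra].
Qed.

Lemma gK_pos (z : R) : 0 < z -> 0 < gK z.
Proof.
  intro Hz; unfold gK; apply Rdiv_lt_0_compat; [|apply KB_pos; lra].
  apply Rmult_lt_0_compat; [exact Hz|apply KB_pos; lra].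
Qed.

Lemma gK_0 : gK 0 = 0.
Proof. unfold gK, Rdiv; ring. Qed.

Lemma is_derive_VK (z : R) : 0 < z -> is_derive VK z ((gK z ^ 2 - (2 + 2 * gK z) * VK z) / z).
Proof.
  intro Hz; assert (D := is_derive_gK z Hz).
  unfold VK at 1; auto_derive; [conjs; eexists; exact D|].
  replace (Derive (fun x => gK x) z) with ((gK z - VK z) / z) by (symmetry; exact (is_derive_unique _ _ _ D)).
  unfold VK; field; lra.
Qed.

Lemma continuity_VK (z : R) : 0 <= z -> continuity_pt VK z.
Proof.
  intro Hz; apply continuity_pt_filterlim, (ex_derive_continuous VK).
  assert (D := is_derive_gK0 z Hz).
  unfold VK; auto_derive; conjs; eexists; exact D.
Qed.

(** Where V < 0, the equation z V' = g^2 - (2 + 2 g) V makes V increase. *)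
Lemma VK_nonneg (z : R) : 0 <= z -> 0 <= VK z.
Proof.
  intro Hz; enough (- VK z <= 0) by lra; revert z Hz.
  apply (barrier (fun z => - VK z) (fun z => - ((gK z ^ 2 - (2 + 2 * gK z) * VK z) / z))).
  - intros z Hz; apply continuity_pt_opp; now apply continuity_VK.
  - intros z Hz; exact (is_derive_opp VK z _ (is_derive_VK z Hz)).
  - unfold VK; rewrite gK_0; lra.
  - intros z Hz Hn; assert (Hg := gK_pos z Hz).
    replace (- ((gK z ^ 2 - (2 + 2 * gK z) * VK z) / z))
      with ((- gK z ^ 2 - (2 + 2 * gK z) * - VK z) / z) by (field; lra).
    apply Rmult_le_reg_r with z; [exact Hz|].
    unfold Rdiv; rewrite Rmult_assoc, Rinv_l, Rmult_1_r, Rmult_0_l by lra; nra.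
Qed.

(* The trajectory [(g, V)] starts at the origin and cannot cross the curve
   [V (2 g + al) = g^2], whose position relative to the flow
   [z g' = g - V], [z V' = g^2 - (2 + 2 g) V] depends on [al]. *)
Lemma barrier_der (al z : R) : 0 < z ->
  is_derive (fun z => VK z * (2 * gK z + al) - gK z ^ 2) z
   (((2 * gK z + al) * (gK z ^ 2 - (2 + 2 * gK z) * VK z) + 2 * VK z * (gK z - VK z)
     - 2 * gK z * (gK z - VK z)) / z).
Proof.
  intro Hz; assert (D := is_derive_gK z Hz); assert (D' := is_derive_VK z Hz).
  auto_derive; [conjs; eexists; eassumption|].
  replace (Derive (fun x => gK x) z) with ((gK z - VK z) / z) by (symmetry; exact (is_derive_unique _ _ _ D)).
  replace (Derive (fun x => VK x) z) with ((gK z ^ 2 - (2 + 2 * gK z) * VK z) / z)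
    by (symmetry; exact (is_derive_unique _ _ _ D')).
  field; lra.
Qed.

Lemma barrier_cont (al z : R) : 0 <= z ->
  continuity_pt (fun z => VK z * (2 * gK z + al) - gK z ^ 2) z.
Proof.
  intro Hz; apply continuity_pt_filterlim, (ex_derive_continuous (fun z => VK z * (2 * gK z + al) - gK z ^ 2)).
  assert (D := is_derive_gK0 z Hz).
  unfold VK; auto_derive; conjs; eexists; exact D.
Qed.

Lemma barrier_sign (c z : R) : 0 < z -> c <= 0 -> c / z <= 0.
Proof. intros Hz Hc; unfold Rdiv; assert (0 < / z) by now apply Rinv_0_lt_compat. nra. Qed.

(** The value 5/2 is the one for which the curve g^2 / (2 g + al) agrees with the trajectory up to
    the constant term as g tends to infinity, V = g/2 - 5/8 + .... *)
Lemma VK_upper (z : R) : 0 <= z -> VK z * (2 * gK z + 5 / 2) <= gK z ^ 2.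
Proof.
  intro Hz; enough (VK z * (2 * gK z + 5 / 2) - gK z ^ 2 <= 0) by lra; revert z Hz.
  eapply barrier.
  - intros z Hz; now apply barrier_cont.
  - intros z Hz; apply (barrier_der (5 / 2) z Hz).
  - unfold VK; rewrite gK_0; lra.
  - cbv beta; intros z Hz Hf; assert (Hg := gK_pos z Hz); assert (HV := VK_nonneg z ltac:(lra)).
    apply barrier_sign; [exact Hz|].
    set (g := gK z) in *; set (V := VK z) in *; set (s := 2 * g + 5 / 2).
    assert (Hs : 0 < s) by (unfold s; lra).
    assert (HVs : g ^ 2 < V * s) by (unfold s; lra).
    (* After multiplication by s^2 the variable V occurs only as V s, which may be replaced by its
       lower bound g^2. In the remaining polynomial the cubic and quadratic terms cancel. *)
    apply Rmult_le_reg_r with (s ^ 2); [apply pow_lt; exact Hs|].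
    replace ((s * (g ^ 2 - (2 + 2 * g) * V) + 2 * V * (g - V) - 2 * g * (g - V)) * s ^ 2)
      with (g ^ 2 * (s ^ 2 * (s - 2)) - (V * s) * (s * (4 * g ^ 2 + 5 * g + 5)) - 2 * (V * s) ^ 2) by (unfold s; field).
    assert (Hg2 : 0 <= g ^ 2) by apply pow2_ge_0.
    assert (H1 : g ^ 2 * (s * (4 * g ^ 2 + 5 * g + 5)) <= (V * s) * (s * (4 * g ^ 2 + 5 * g + 5))).
    { apply Rmult_le_compat_r; [apply Rmult_le_pos; nra|lra]. }
    assert (H2 : g ^ 2 * g ^ 2 <= (V * s) ^ 2) by (cbn; nra).
    assert (H3 : g ^ 2 * (s ^ 2 * (s - 2) - s * (4 * g ^ 2 + 5 * g + 5) - 2 * g ^ 2) <= 0).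
    { replace (s ^ 2 * (s - 2) - s * (4 * g ^ 2 + 5 * g + 5) - 2 * g ^ 2) with (- (5 * g + 75 / 8)) by (unfold s; field).
      nra. }
    lra.
Qed.

(** The value 4 is dictated by the origin, where the trajectory leaves along V = g^2 / 4. *)
Lemma VK_lower (z : R) : 0 <= z -> gK z ^ 2 <= VK z * (2 * gK z + 4).
Proof.
  intro Hz; enough (- (VK z * (2 * gK z + 4) - gK z ^ 2) <= 0) by lra; revert z Hz.
  apply (barrier (fun z => - (VK z * (2 * gK z + 4) - gK z ^ 2))
    (fun z => - (((2 * gK z + 4) * (gK z ^ 2 - (2 + 2 * gK z) * VK z) + 2 * VK z * (gK z - VK z)
     - 2 * gK z * (gK z - VK z)) / z))).
  - intros z Hz; apply (continuity_pt_opp (fun z => VK z * (2 * gK z + 4) - gK z ^ 2)); now apply barrier_cont.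
  - intros z Hz; exact (is_derive_opp _ z _ (barrier_der 4 z Hz)).
  - unfold VK; rewrite gK_0; lra.
  - intros z Hz Hf; assert (Hg := gK_pos z Hz); assert (HV := VK_nonneg z ltac:(lra)).
    rewrite <- Rdiv_opp_l; apply barrier_sign; [exact Hz|].
    set (g := gK z) in *; set (V := VK z) in *; set (s := 2 * g + 4).
    assert (Hs : 0 < s) by (unfold s; lra).
    assert (HVs : V * s < g ^ 2) by (unfold s; lra).
    assert (HVs0 : 0 <= V * s) by (apply Rmult_le_pos; lra).
    apply Rmult_le_reg_r with (s ^ 2); [apply pow_lt; exact Hs|].
    replace (- (s * (g ^ 2 - (2 + 2 * g) * V) + 2 * V * (g - V) - 2 * g * (g - V)) * s ^ 2)
      with (- (g ^ 2 * (s ^ 2 * (s - 2)) - (V * s) * (s * (4 * g ^ 2 + 8 * g + 8)) - 2 * (V * s) ^ 2)) by (unfold s; field).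
    assert (Hg2 : 0 <= g ^ 2) by apply pow2_ge_0.
    assert (H1 : (V * s) * (s * (4 * g ^ 2 + 8 * g + 8)) <= g ^ 2 * (s * (4 * g ^ 2 + 8 * g + 8))).
    { apply Rmult_le_compat_r; [apply Rmult_le_pos; nra|lra]. }
    assert (H2 : (V * s) ^ 2 <= g ^ 2 * g ^ 2) by (cbn [pow] in *; nra).
    assert (H3 : 0 <= g ^ 2 * (s ^ 2 * (s - 2) - s * (4 * g ^ 2 + 8 * g + 8) - 2 * g ^ 2)).
    { replace (s ^ 2 * (s - 2) - s * (4 * g ^ 2 + 8 * g + 8) - 2 * g ^ 2) with (6 * g ^ 2 + 16 * g) by (unfold s; field).
      nra. }
    lra.
Qed.

(** [VK_nonneg] reads z <= g^2 + 3 g, which is at most (g + 3/2)^2. *)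
Lemma gK_lower (z : R) : 0 < z -> sqrt z - 3 / 2 <= gK z.
Proof.
  intro Hz; assert (Hg := gK_pos z Hz); assert (HV := VK_nonneg z ltac:(lra)); unfold VK in HV.
  assert (Hs := sqrt_sqrt z ltac:(lra)); assert (Hs0 := sqrt_pos z).
  apply Rnot_lt_le; intro H; nra.
Qed.

Definition LK (z : R) : R := ln (KB 2 z).
(** This is minus the second derivative of [LK]; [vK1] and [vK2] are its first two derivatives. *)
Definition vK (z : R) : R := VK z / z ^ 2.
Definition vK1 (z : R) : R := (gK z ^ 2 - (2 * gK z + 4) * VK z) / z ^ 3.
Definition vK2 (z : R) : R :=
  (2 * VK z ^ 2 + VK z * (4 * gK z ^ 2 + 14 * gK z + 20) - (2 * gK z + 5) * gK z ^ 2) / z ^ 4.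

Lemma is_derive_LK (z : R) : 0 < z -> is_derive LK z (gK z / z).
Proof.
  intro Hz; assert (H2 := KB_pos 2 z ltac:(lra)).
  unfold LK; auto_derive.
  - conjs; [eexists; apply is_derive_KB|exact H2].
  - replace (Derive (fun x => KB 2 x) z) with (KB 3 z) by (symmetry; exact (is_derive_unique _ _ _ (is_derive_KB 2 z))).
    unfold gK; field; split; lra.
Qed.

Lemma is_derive_LK1 (z : R) : 0 < z -> is_derive (fun z => gK z / z) z (- vK z).
Proof.
  intro Hz; assert (D := is_derive_gK z Hz).
  auto_derive; [conjs; [eexists; exact D|lra]|].
  replace (Derive (fun x => gK x) z) with ((gK z - VK z) / z) by (symmetry; exact (is_derive_unique _ _ _ D)).
  unfold vK; field; lra.
Qed.

Lemma is_derive_vK (z : R) : 0 < z -> is_derive vK z (vK1 z).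
Proof.
  intro Hz; assert (D := is_derive_VK z Hz).
  unfold vK; auto_derive; [conjs; [eexists; exact D|pown]|].
  replace (Derive (fun x => VK x) z) with ((gK z ^ 2 - (2 + 2 * gK z) * VK z) / z)
    by (symmetry; exact (is_derive_unique _ _ _ D)).
  unfold vK1; field; lra.
Qed.

Lemma is_derive_vK1 (z : R) : 0 < z -> is_derive vK1 z (vK2 z).
Proof.
  intro Hz; assert (D := is_derive_gK z Hz); assert (D' := is_derive_VK z Hz).
  unfold vK1; auto_derive; [conjs; try (eexists; eassumption); pown|].
  replace (Derive (fun x => gK x) z) with ((gK z - VK z) / z) by (symmetry; exact (is_derive_unique _ _ _ D)).
  replace (Derive (fun x => VK x) z) with ((gK z ^ 2 - (2 + 2 * gK z) * VK z) / z)
    by (symmetry; exact (is_derive_unique _ _ _ D')).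
  unfold vK2; field; lra.
Qed.

Lemma vK1_nonpos (z : R) : 0 < z -> vK1 z <= 0.
Proof.
  intro Hz; assert (H := VK_lower z ltac:(lra)); unfold vK1.
  apply barrier_sign; [apply pow_lt, Hz|lra].
Qed.

(** The purpose of [VK_upper]: a bound on the second derivative of [vK] by O(z^-2) times [vK]
    itself, a form that survives taking second differences. *)
Lemma vK2_le (z : R) : 0 < z -> vK2 z <= 15 / 2 / z ^ 2 * vK z.
Proof.
  intro Hz; assert (H := VK_upper z ltac:(lra)); assert (HV := VK_nonneg z ltac:(lra)).
  assert (Hg := gK_pos z Hz); unfold vK2, vK.
  replace (15 / 2 / z ^ 2 * (VK z / z ^ 2)) with (15 / 2 * VK z / z ^ 4) by (field; lra).
  unfold Rdiv at 1 2; apply Rmult_le_compat_r; [left; apply Rinv_0_lt_compat, pow_lt, Hz|].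
  set (g := gK z) in *; set (V := VK z) in *.
  assert (HVg : 2 * V <= g).
  { apply Rmult_le_reg_r with (2 * g + 5 / 2); [lra|nra]. }
  (* Subtracting 15/2 leaves 25/2, the constant term of (2 g + 5/2)(2 g + 5). The linear terms
     differ by g, which absorbs 2 V. *)
  assert (H1 : V * (2 * V + 4 * g ^ 2 + 14 * g + 20 - 15 / 2) <= V * ((2 * g + 5 / 2) * (2 * g + 5))).
  { apply Rmult_le_compat_l; [exact HV|]; nra. }
  assert (H2 : V * (2 * g + 5 / 2) * (2 * g + 5) <= g ^ 2 * (2 * g + 5)) by (apply Rmult_le_compat_r; lra).
  nra.
Qed.

Lemma vK_decr (a b : R) : 0 < a -> a <= b -> vK b <= vK a.
Proof.
  intros Ha [Hab | ->]; [|lra].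
  destruct (MVT_open vK vK1 a b Hab) as [c [E Hc]].
  - intros c Hc; apply is_derive_vK; lra.
  - assert (H := vK1_nonpos c ltac:(lra)); nra.
Qed.

Lemma vK_nonneg (z : R) : 0 < z -> 0 <= vK z.
Proof.
  intro Hz; unfold vK; apply Rmult_le_pos; [apply VK_nonneg; lra|left; apply Rinv_0_lt_compat, pow_lt, Hz].
Qed.

Lemma vK_lower (Y : R) : 3 / 2 <= Y -> (Y - 3 / 2) ^ 2 / ((2 * Y + 1) * Y ^ 4) <= vK (Y ^ 2).
Proof.
  intro HY; assert (Hz : 0 < Y ^ 2) by (apply pow_lt; lra).
  assert (Hg := gK_lower _ Hz); rewrite sqrt_pow2 in Hg by lra.
  assert (HV := VK_lower (Y ^ 2) ltac:(lra)); unfold vK.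
  assert (Hg0 := gK_pos _ Hz).
  set (g := gK (Y ^ 2)) in *; set (V := VK (Y ^ 2)) in *.
  replace ((Y ^ 2) ^ 2) with (Y ^ 4) by ring.
  assert (H4 : 0 < Y ^ 4) by (apply pow_lt; lra).
  unfold Rdiv; rewrite Rinv_mult, <- Rmult_assoc.
  apply Rmult_le_compat_r; [left; now apply Rinv_0_lt_compat|].
  apply Rmult_le_reg_r with (2 * Y + 1); [lra|].
  rewrite Rmult_assoc, Rinv_l, Rmult_1_r by lra.
  apply Rmult_le_reg_r with (2 * g + 4); [lra|].
  apply Rle_trans with (g ^ 2 * (2 * Y + 1)); [|nra].
  assert (0 <= g - (Y - 3 / 2)) by lra.
  set (d := Y - 3 / 2) in *; replace (2 * Y + 1) with (2 * d + 4) by (unfold d; field).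
  assert (0 <= d) by (unfold d; lra).
  assert (E : g ^ 2 * (2 * d + 4) - d ^ 2 * (2 * g + 4) = (g - d) * (2 * (g * d) + 4 * (g + d))) by ring.
  assert (0 <= g * d) by (apply Rmult_le_pos; lra).
  assert (0 <= (g - d) * (2 * (g * d) + 4 * (g + d))) by (apply Rmult_le_pos; lra); unfold Rdiv in d; fold d; lra.
Qed.

(** Integration of [gK_lower] from 1 to z, starting from [KB 2 1] >= 1/2. The power of [sqrt z] is
    not the sharp one but is harmless against the exponential error. *)
Lemma KB_growth (z : R) : 1 <= z -> exp (2 * sqrt z - 2) / (2 * (sqrt z) ^ 3) <= KB 2 z.
Proof.
  intro Hz.
  assert (Hs1 : 1 <= sqrt z) by (rewrite <- sqrt_1; now apply sqrt_le_1_alt).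
  set (f := fun u => LK u - 2 * sqrt u + 3 / 2 * ln u).
  assert (D : forall u, 1 <= u -> is_derive f u (gK u / u - / sqrt u + 3 / 2 / u)).
  { intros u Hu; assert (D := is_derive_LK u ltac:(lra)); unfold f.
    assert (Hsu : 0 < sqrt u) by (apply sqrt_lt_R0; lra).
    auto_derive; [conjs; try lra; eexists; exact D|].
    replace (Derive (fun x => LK x) u) with (gK u / u) by (symmetry; exact (is_derive_unique _ _ _ D)).
    field; split; lra. }
  assert (Hf : f 1 <= f z).
  { destruct (Req_dec z 1) as [->|Hne]; [lra|].
    destruct (MVT_open f (fun u => gK u / u - / sqrt u + 3 / 2 / u) 1 z ltac:(lra)) as [c [E Hc]].
    - intros c Hc; apply D; lra.
    - assert (Hg := gK_lower c ltac:(lra)).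
      assert (Hsc : 0 < sqrt c) by (apply sqrt_lt_R0; lra).
      assert (0 <= gK c / c - / sqrt c + 3 / 2 / c); [|nra].
      replace (gK c / c - / sqrt c + 3 / 2 / c) with ((gK c - sqrt c + 3 / 2) / c).
      + apply Rmult_le_pos; [lra|left; apply Rinv_0_lt_compat; lra].
      + replace (/ sqrt c) with (sqrt c / c); [field; lra|].
        rewrite <- (sqrt_sqrt c) at 2 by lra; field; lra. }
  unfold f, LK in Hf; rewrite sqrt_1, ln_1 in Hf.
  assert (H1 : / 2 <= KB 2 1).
  { eapply Rle_trans; [|apply (KB_lb 2 1 1); lra]; unfold kcoef; cbn; lra. }
  assert (Hl : ln (/ 2) <= ln (KB 2 1)).
  { destruct H1 as [H1|<-]; [left; apply ln_increasing; lra|lra]. }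
  assert (Hp := KB_pos 2 z ltac:(lra)).
  rewrite <- (exp_ln (KB 2 z)) by exact Hp.
  replace (exp (2 * sqrt z - 2) / (2 * sqrt z ^ 3)) with (exp (2 * sqrt z - 2 + ln (/ 2) - 3 / 2 * ln z)).
  - apply exp_le; lra.
  - replace (ln z) with (2 * ln (sqrt z)).
    + replace (2 * sqrt z - 2 + ln (/ 2) - 3 / 2 * (2 * ln (sqrt z)))
        with ((2 * sqrt z - 2) + (ln (/ 2) + - (INR 3 * ln (sqrt z)))) by (cbn; field).
      rewrite !exp_plus, exp_ln, exp_Ropp, <- exp_pow, exp_ln by lra.
      field; lra.
    + rewrite <- (sqrt_sqrt z) at 2 by lra; rewrite ln_mult by lra; ring.
Qed.

(** * Second differences *)

Lemma second_order_pos (f f1 f2 : R -> R) (A : R) : 0 < A ->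
  (forall k, 0 <= k <= A -> is_derive f k (f1 k)) ->
  (forall k, 0 <= k <= A -> is_derive f1 k (f2 k)) ->
  (forall k, 0 <= k <= A -> 0 <= f2 k) -> f 0 = 0 -> f1 0 = 0 -> 0 <= f A.
Proof.
  intros HA H1 H2 H3 H4 H5.
  assert (G : forall k, 0 < k <= A -> 0 <= f1 k).
  { intros k Hk; destruct (MVT_open f1 f2 0 k ltac:(lra)) as [c [E Hc]].
    - intros c Hc; apply H2; lra.
    - assert (0 <= f2 c) by (apply H3; lra); nra. }
  destruct (MVT_open f f1 0 A HA) as [c [E Hc]]; [exact H1|].
  assert (0 <= f1 c) by (apply G; lra); nra.
Qed.

Definition sdiff (f : R -> R) (A z : R) : R := f (z + A) + f (z - A) - 2 * f z.

(** As a function of the step, a symmetric second difference vanishes at 0 together with its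
    derivative, so an inequality of second derivatives passes to it. *)
Lemma sdiff_le (f f1 f2 h h1 h2 : R -> R) (A z : R) : 0 < A ->
  (forall u, z - A <= u <= z + A -> is_derive f u (f1 u)) ->
  (forall u, z - A <= u <= z + A -> is_derive f1 u (f2 u)) ->
  (forall u, z - A <= u <= z + A -> is_derive h u (h1 u)) ->
  (forall u, z - A <= u <= z + A -> is_derive h1 u (h2 u)) ->
  (forall u, z - A <= u <= z + A -> f2 u <= h2 u) -> sdiff f A z <= sdiff h A z.
Proof.
  intros HA D1 D2 D3 D4 Hle.
  assert (Hc : forall (u u' : R -> R) k, 0 <= k <= A ->
    (forall w, z - A <= w <= z + A -> is_derive u w (u' w)) ->
    is_derive (fun k => u (z + k)) k (u' (z + k)) /\ is_derive (fun k => u (z - k)) k (- u' (z - k))).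
  { intros u u' k Hk Du; assert (Da := Du (z + k) ltac:(lra)); assert (Db := Du (z - k) ltac:(lra)); split.
    - auto_derive; [eexists; exact Da|].
      replace (Derive (fun x => u x) (z + k)) with (u' (z + k)) by (symmetry; exact (is_derive_unique _ _ _ Da)); ring.
    - auto_derive; [eexists; exact Db|].
      replace (Derive (fun x => u x) (z + - k)) with (u' (z - k)) by (symmetry; exact (is_derive_unique _ _ _ Db)); ring. }
  assert (H : 0 <= (h (z + A) + h (z - A) - 2 * h z) - (f (z + A) + f (z - A) - 2 * f z)).
  { apply (second_order_pos (fun k => (h (z + k) + h (z - k) - 2 * h z) - (f (z + k) + f (z - k) - 2 * f z))
      (fun k => (h1 (z + k) - h1 (z - k)) - (f1 (z + k) - f1 (z - k)))
      (fun k => (h2 (z + k) + h2 (z - k)) - (f2 (z + k) + f2 (z - k))) A HA).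
    - intros k Hk; destruct (Hc _ _ k Hk D1) as [Ea Eb], (Hc _ _ k Hk D3) as [Ec Ed].
      eapply is_derive_eq; [exact (is_derive_minus _ _ _ _ _
        (is_derive_minus _ _ _ _ _ (is_derive_plus _ _ _ _ _ Ec Ed) (is_derive_const (2 * h z) k))
        (is_derive_minus _ _ _ _ _ (is_derive_plus _ _ _ _ _ Ea Eb) (is_derive_const (2 * f z) k)))|reflexivity|].
      unfold minus, plus, opp, zero; cbn; ring.
    - intros k Hk; destruct (Hc _ _ k Hk D2) as [Ea Eb], (Hc _ _ k Hk D4) as [Ec Ed].
      eapply is_derive_eq; [exact (is_derive_minus _ _ _ _ _ (is_derive_minus _ _ _ _ _ Ec Ed)
        (is_derive_minus _ _ _ _ _ Ea Eb))|reflexivity|].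
      unfold minus, plus, opp, zero; cbn; ring.
    - intros k Hk; assert (Ha := Hle (z + k) ltac:(lra)); assert (Hb := Hle (z - k) ltac:(lra)); lra.
    - rewrite Rplus_0_r, Rminus_0_r; ring.
    - rewrite Rplus_0_r, Rminus_0_r; ring. }
  unfold sdiff; lra.
Qed.

Lemma sdiff_sq (m A z : R) : sdiff (fun u => m / 2 * u ^ 2) A z = m * A ^ 2.
Proof. unfold sdiff; field. Qed.

Lemma is_derive_sq (m u : R) : is_derive (fun u => m / 2 * u ^ 2) u (m * u).
Proof. auto_derive; [exact I|field]. Qed.

Lemma is_derive_lin (m u : R) : is_derive (fun u => m * u) u m.
Proof. auto_derive; [exact I|ring]. Qed.

(** * The second-order gap of the main term *)

Section Gap.
Variable A : R.
Hypothesis A_pos : 0 < A.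

(** [A] is also the amount by which the argument of the main term grows when the index grows by 1,
    so exp (- pK) is the ratio of the outer product to the middle square of three consecutive main
    terms. *)
Definition pK (z : R) : R := - sdiff LK A z.

Lemma sdiff_opp (f : R -> R) (z : R) : sdiff (fun u => - f u) A z = - sdiff f A z.
Proof. unfold sdiff; ring. Qed.

Lemma is_derive_LKn (u : R) : 0 < u -> is_derive (fun u => - LK u) u (- (gK u / u)).
Proof. intro Hu; exact (is_derive_opp LK u _ (is_derive_LK u Hu)). Qed.

Lemma is_derive_LKn1 (u : R) : 0 < u -> is_derive (fun u => - (gK u / u)) u (vK u).
Proof.
  intro Hu; eapply is_derive_eq; [exact (is_derive_opp (fun u => gK u / u) u _ (is_derive_LK1 u Hu))|reflexivity|].
  unfold opp; cbn; ring.
Qed.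

(** Comparison with the parabola whose second derivative is the value of [vK] at the right end, its
    minimum on the interval. *)
Lemma pK_lower (z : R) : A < z -> A ^ 2 * vK (z + A) <= pK z.
Proof.
  intro Hz; unfold pK; rewrite <- sdiff_opp, Rmult_comm, <- (sdiff_sq (vK (z + A)) A z).
  apply (sdiff_le (fun u => vK (z + A) / 2 * u ^ 2) (fun u => vK (z + A) * u) (fun _ => vK (z + A))
    (fun u => - LK u) (fun u => - (gK u / u)) vK A z A_pos); intros u Hu.
  - apply is_derive_sq.
  - apply is_derive_lin.
  - apply is_derive_LKn; lra.
  - apply is_derive_LKn1; lra.
  - apply vK_decr; lra.
Qed.

(** The left side is the second derivative of [pK]. Since vK'' <= c vK and [vK] is the second
    derivative of - [LK], comparing - c [LK] with [vK] gives the bound. *)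
Lemma pK_sdiff (z : R) : A < z -> sdiff vK A z <= 15 / 2 / (z - A) ^ 2 * pK z.
Proof.
  intro Hz; set (c := 15 / 2 / (z - A) ^ 2).
  replace (c * pK z) with (sdiff (fun u => c * - LK u) A z) by (unfold pK, sdiff; ring).
  apply (sdiff_le vK vK1 vK2 (fun u => c * - LK u) (fun u => c * - (gK u / u)) (fun u => c * vK u) A z A_pos);
    intros u Hu.
  - apply is_derive_vK; lra.
  - apply is_derive_vK1; lra.
  - exact (is_derive_scal _ _ c _ (is_derive_LKn u ltac:(lra))).
  - exact (is_derive_scal _ _ c _ (is_derive_LKn1 u ltac:(lra))).
  - eapply Rle_trans; [apply vK2_le; lra|].
    apply Rmult_le_compat_r; [apply vK_nonneg; lra|].
    unfold c; apply Rmult_le_compat_l; [lra|].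
    apply Rinv_le_contravar; [apply pow_lt; lra|apply pow_incr; lra].
Qed.

Lemma is_derive_sdiff (f f' : R -> R) (z : R) :
  is_derive f z (f' z) -> is_derive f (z + A) (f' (z + A)) -> is_derive f (z - A) (f' (z - A)) ->
  is_derive (sdiff f A) z (sdiff f' A z).
Proof.
  intros D1 D2 D3; unfold sdiff.
  auto_derive; [conjs; eexists; eassumption|].
  replace (Derive (fun x => f x) (z + A)) with (f' (z + A)) by (symmetry; exact (is_derive_unique _ _ _ D2)).
  replace (Derive (fun x => f x) (z + - A)) with (f' (z - A)) by (symmetry; exact (is_derive_unique _ _ _ D3)).
  replace (Derive (fun x => f x) z) with (f' z) by (symmetry; exact (is_derive_unique _ _ _ D1)).
  ring.
Qed.

Lemma is_derive_pK (z : R) : A < z -> is_derive pK z (sdiff (fun u => - (gK u / u)) A z).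
Proof.
  intro Hz; eapply is_derive_eq.
  - apply (is_derive_sdiff (fun u => - LK u) (fun u => - (gK u / u))); apply is_derive_LKn; lra.
  - intro s; unfold pK; apply sdiff_opp.
  - reflexivity.
Qed.

Lemma is_derive_pK1 (z : R) : A < z -> is_derive (sdiff (fun u => - (gK u / u)) A) z (sdiff vK A z).
Proof. intro Hz; apply is_derive_sdiff; apply is_derive_LKn1; lra. Qed.

(** The logarithm of the relative size of a two-by-two minor of main terms. *)
Definition hK (z : R) : R := ln (1 - exp (- pK z)).

Lemma vK_pos (z : R) : 0 < z -> 0 < vK z.
Proof.
  intro Hz; assert (H := VK_lower z ltac:(lra)); assert (Hg := gK_pos z Hz).
  unfold vK; apply Rdiv_lt_0_compat; [|apply pow_lt, Hz]; nra.
Qed.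

Lemma pK_pos (z : R) : A < z -> 0 < pK z.
Proof.
  intro Hz; eapply Rlt_le_trans; [|now apply pK_lower].
  apply Rmult_lt_0_compat; [apply pow_lt, A_pos|apply vK_pos; lra].
Qed.

Lemma exp_pK (z : R) : A < z -> 1 + pK z < exp (pK z).
Proof. intro Hz; apply exp_ineq1; generalize (pK_pos z Hz); lra. Qed.

Definition hK1 (z : R) : R := sdiff (fun u => - (gK u / u)) A z / (exp (pK z) - 1).

Lemma is_derive_hK (z : R) : A < z -> is_derive hK z (hK1 z).
Proof.
  intro Hz; assert (D := is_derive_pK z Hz); assert (Hp := pK_pos z Hz); assert (He := exp_pK z Hz).
  assert (E : exp (- pK z) = / exp (pK z)) by apply exp_Ropp.
  unfold hK; auto_derive.
  - conjs; [eexists; exact D|].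
    rewrite E; assert (/ exp (pK z) < 1); [|lra].
    rewrite <- Rinv_1; apply Rinv_lt_contravar; lra.
  - replace (Derive (fun x => pK x) z) with (sdiff (fun u => - (gK u / u)) A z)
      by (symmetry; exact (is_derive_unique _ _ _ D)).
    unfold hK1; rewrite E; field; split; lra.
Qed.

Lemma is_derive_hK1 (z : R) : A < z -> is_derive hK1 z
  (sdiff vK A z / (exp (pK z) - 1)
   - sdiff (fun u => - (gK u / u)) A z ^ 2 * exp (pK z) / (exp (pK z) - 1) ^ 2).
Proof.
  intro Hz; assert (D := is_derive_pK z Hz); assert (D1 := is_derive_pK1 z Hz).
  assert (Hp := pK_pos z Hz); assert (He := exp_pK z Hz).
  set (q := sdiff (fun u => - (gK u / u)) A) in *; unfold hK1; fold q.
  auto_derive; [conjs; try (eexists; eassumption); lra|].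
  replace (Derive (fun x => pK x) z) with (q z) by (symmetry; exact (is_derive_unique _ _ _ D)).
  replace (Derive (fun x => q x) z) with (sdiff vK A z) by (symmetry; exact (is_derive_unique _ _ _ D1)).
  field; lra.
Qed.

(** The second derivative of log (1 - e^-p) is p'' / (e^p - 1) minus a nonnegative term. By
    [pK_sdiff] p'' <= c p, and p <= e^p - 1, so p itself disappears from the bound. *)
Lemma hK_sdiff (z : R) : 2 * A < z -> sdiff hK A z <= 15 / 2 / (z - 2 * A) ^ 2 * A ^ 2.
Proof.
  intro Hz; set (c := 15 / 2 / (z - 2 * A) ^ 2); rewrite <- (sdiff_sq c A z).
  assert (Hc : 0 < c) by (apply Rdiv_lt_0_compat; [lra|apply pow_lt; lra]).
  apply (sdiff_le hK hK1 (fun z => sdiff vK A z / (exp (pK z) - 1)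
   - sdiff (fun u => - (gK u / u)) A z ^ 2 * exp (pK z) / (exp (pK z) - 1) ^ 2)
   (fun u => c / 2 * u ^ 2) (fun u => c * u) (fun _ => c) A z A_pos); intros u Hu.
  - apply is_derive_hK; lra.
  - apply is_derive_hK1; lra.
  - apply is_derive_sq.
  - apply is_derive_lin.
  - assert (Hp := pK_pos u ltac:(lra)); assert (He := exp_pK u ltac:(lra)).
    assert (H1 := pK_sdiff u ltac:(lra)).
    assert (Hcu : 15 / 2 / (u - A) ^ 2 <= c).
    { unfold c; apply Rmult_le_compat_l; [lra|].
      apply Rinv_le_contravar; [apply pow_lt; lra|apply pow_incr; lra]. }
    assert (H2 : 0 <= sdiff (fun u => - (gK u / u)) A u ^ 2 * exp (pK u) / (exp (pK u) - 1) ^ 2).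
    { apply Rmult_le_pos; [apply Rmult_le_pos; [apply pow2_ge_0|left; apply exp_pos]|].
      left; apply Rinv_0_lt_compat, pow_lt; lra. }
    assert (H3 : sdiff vK A u / (exp (pK u) - 1) <= c); [|lra].
    apply Rmult_le_reg_r with (exp (pK u) - 1); [lra|].
    unfold Rdiv; rewrite Rmult_assoc, Rinv_l, Rmult_1_r by lra.
    apply Rle_trans with (c * pK u); [|apply Rmult_le_compat_l; lra].
    eapply Rle_trans; [exact H1|apply Rmult_le_compat_r; lra].
Qed.

(** The quotient (Y - 3/2)^2 / ((2 Y + 1) Y) increases to 1/2 and already exceeds 0.471 at Y =
    60. *)
Lemma pK_lower_Y (z Y : R) : 60 <= Y -> A < z -> z + A <= Y ^ 2 -> A ^ 2 * (471 / 1000) / Y ^ 3 <= pK z.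
Proof.
  intros HY Hz HzY; eapply Rle_trans; [|now apply pK_lower].
  replace (A ^ 2 * (471 / 1000) / Y ^ 3) with (A ^ 2 * (471 / 1000 / Y ^ 3)) by (field; lra).
  apply Rmult_le_compat_l; [apply pow2_ge_0|].
  apply Rle_trans with (vK (Y ^ 2)); [|apply vK_decr; lra].
  eapply Rle_trans; [|apply vK_lower; lra].
  assert (0 < Y ^ 3) by (apply pow_lt; lra).
  apply Rmult_le_reg_r with ((2 * Y + 1) * Y ^ 4); [apply Rmult_lt_0_compat; [|apply pow_lt]; lra|].
  replace (471 / 1000 / Y ^ 3 * ((2 * Y + 1) * Y ^ 4)) with (471 / 1000 * (2 * Y + 1) * Y) by (field; lra).
  replace ((Y - 3 / 2) ^ 2 / ((2 * Y + 1) * Y ^ 4) * ((2 * Y + 1) * Y ^ 4)) with ((Y - 3 / 2) ^ 2)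
    by (field; split; lra).
  nra.
Qed.

(** The second difference of [hK] has order Y^-4 and is at most 0.142 A^2 / Y^3 from Y = 60 on,
    against 2 * 0.471 A^2 / Y^3 from [pK]; the difference is 4/5. *)
Lemma gap_bound (z Y : R) : 60 <= Y -> A <= 4 -> z + A = Y ^ 2 ->
  A ^ 2 * (4 / 5) / Y ^ 3 <= 2 * pK z - sdiff hK A z.
Proof.
  intros HY HA Hz.
  assert (H1 := pK_lower_Y z Y HY ltac:(nra) ltac:(lra)).
  assert (H2 := hK_sdiff z ltac:(nra)).
  assert (H3 : 15 / 2 / (z - 2 * A) ^ 2 * A ^ 2 <= A ^ 2 * (142 / 1000) / Y ^ 3).
  { replace (z - 2 * A) with (Y ^ 2 - 3 * A) by lra.
    rewrite Rmult_comm; unfold Rdiv; rewrite !(Rmult_assoc (A ^ 2)); apply Rmult_le_compat_l; [apply pow2_ge_0|].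
    assert (0 < Y ^ 3) by (apply pow_lt; lra).
    assert (H4 : 0 < (Y ^ 2 - 3 * A) ^ 2) by (apply pow_lt; nra).
    apply Rmult_le_reg_r with ((Y ^ 2 - 3 * A) ^ 2); [exact H4|].
    rewrite (Rmult_assoc _ (/ _) (_ ^ 2)), Rinv_l, Rmult_1_r by lra.
    apply Rmult_le_reg_r with (Y ^ 3); [lra|].
    replace (142 * / 1000 * / Y ^ 3 * (Y ^ 2 - 3 * A) ^ 2 * Y ^ 3) with (142 / 1000 * (Y ^ 2 - 3 * A) ^ 2) by (field; lra).
    apply Rle_trans with (142 / 1000 * (Y ^ 2 - 12) ^ 2).
    - assert (H5 : 3600 <= Y ^ 2) by nra.
      replace (Y ^ 3) with (Y * Y ^ 2) by ring.
      set (s := Y ^ 2) in *; assert (Y * 60 <= s) by (unfold s; nra); nra.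
    - apply Rmult_le_compat_l; [lra|apply pow_incr; nra]. }
  assert (0 <= A ^ 2 / Y ^ 3) by (apply Rmult_le_pos; [apply pow2_ge_0|left; apply Rinv_0_lt_compat, pow_lt; lra]).
  unfold Rdiv in *; nra.
Qed.

End Gap.

(** * The circle method *)

Lemma LamI_bound (u : C) : 1 <= Re u -> Cmod (LamI u) <= 4 * exp (- Re u).
Proof.
  intro Hu; set (v := Re u) in *.
  assert (He1 : 2 <= exp 1) by (generalize (exp_ineq1_le 1); lra).
  assert (Hev : 2 <= exp v) by (apply Rle_trans with (exp 1); [lra|now apply exp_le]).
  replace (LamI u) with (LamI u - 0)%C by ring.
  apply (clim_Cmod_le (fun J => Lam J u) _ _ (fun _ => 4 * exp (- v))).
  - apply Lam_lim; fold v; lra.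
  - apply is_lim_seq_const.
  - exists O; intros J _; replace (Lam J u - 0)%C with (Lam J u) by ring.
    apply Rle_trans with (rsum (fun j => 2 * exp (- v) * (/ 2) ^ j) J).
    + apply Cmod_csum_le'; intros j _; assert (Hj := INR_S_pos j).
      assert (Hj1 : 1 <= INR (S j)) by (rewrite S_INR; generalize (pos_INR j); lra).
      assert (Hz : 0 < Re (INR (S j) * u)%C) by (rewrite re_scal_l; fold v; nra).
      rewrite Cmod_mult, Cmod_inv, Cmod_INR by auto.
      assert (Hb := bos_bound _ Hz); rewrite re_scal_l in Hb; fold v in Hb; rewrite <- exp_pow in Hb.
      assert (Hpow : 2 ^ j * exp v <= exp v ^ S j).
      { cbn [pow]; rewrite Rmult_comm; apply Rmult_le_compat_l; [lra|apply pow_incr; lra]. }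
      assert (H2j := pow2_pos j).
      assert (Hlow : 2 ^ j * exp v / 2 <= exp v ^ S j - 1).
      { assert (1 <= 2 ^ j) by (apply pow_R1_Rle; lra).
        assert (2 <= 2 ^ j * exp v) by nra; lra. }
      assert (H0 : 0 < 2 ^ j * exp v) by nra.
      apply Rle_trans with (1 * (2 * exp (- v) * (/ 2) ^ j)); [|lra].
      apply Rmult_le_compat; [left; now apply Rinv_0_lt_compat|apply Cmod_ge_0| |].
      * rewrite <- Rinv_1; apply Rinv_le_contravar; lra.
      * eapply Rle_trans; [exact Hb|].
        apply Rle_trans with (/ (2 ^ j * exp v / 2)); [apply Rinv_le_contravar; lra|].
        rewrite exp_Ropp, pow_inv; right; field; lra.
    + rewrite rsum_scal.
      assert (G : rsum (fun j => (/ 2) ^ j) J = 2 * (1 - (/ 2) ^ J)).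
      { induction J as [|J IH]; cbn [rsum]; [cbn; ring|rewrite IH; cbn; field]. }
      apply Rle_trans with (2 * exp (- v) * 2); [|lra].
      apply Rmult_le_compat_l; [generalize (exp_pos (- v)); lra|].
      eapply Rle_trans; [right; exact G|].
      assert (0 < (/ 2) ^ J) by (apply pow_lt; lra); lra.
Qed.

(** The argument u / (2D) decays slowest and dictates the exponent; 24 is 4 times the total weight 3
    + 1 + 1 + 1. *)
Lemma LG_bound (D : R) (u : C) : 1 <= D -> 2 * D <= Re u ->
  Cmod (LG D u) <= 24 * exp (- (Re u / (2 * D))).
Proof.
  intros HD Hu; set (v := Re u) in *; set (b := exp (- (v / (2 * D)))).
  assert (H1 : 1 <= v / (2 * D)).
  { apply Rmult_le_reg_r with (2 * D); [lra|].
    unfold Rdiv; rewrite Rmult_assoc, Rinv_l by lra; lra. }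
  assert (G : forall d, 1 <= d <= 2 * D -> Cmod (LamI (u / d)) <= 4 * b).
  { intros d Hd.
    assert (E : Re (u / d)%C = v / d).
    { unfold Cdiv; rewrite <- RtoC_inv by lra; apply re_scal_r. }
    assert (Hvd : v / (2 * D) <= v / d).
    { apply Rmult_le_compat_l; [lra|apply Rinv_le_contravar; lra]. }
    eapply Rle_trans; [apply LamI_bound; rewrite E; lra|].
    rewrite E; apply Rmult_le_compat_l; [lra|]; unfold b; apply exp_le; lra. }
  assert (G1 := G 1 ltac:(lra)); replace (u / 1)%C with u in G1 by (field; apply C_neq_R; lra).
  assert (G2 := G 2 ltac:(lra)); assert (G3 := G D ltac:(lra)); assert (G4 := G (2 * D) ltac:(lra)).
  unfold LG.
  replace (24 * b) with (3 * (4 * b) + 4 * b + 4 * b + 4 * b) by ring.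
  eapply Rle_trans; [apply Cmod_triangle|apply Rplus_le_compat; [|exact G4]].
  unfold Cminus; eapply Rle_trans; [apply Cmod_triangle|apply Rplus_le_compat; [|now rewrite Cmod_opp]].
  eapply Rle_trans; [apply Cmod_triangle|apply Rplus_le_compat; [|now rewrite Cmod_opp]].
  rewrite Cmod_mult, Cmod_R, Rabs_pos_eq by lra; lra.
Qed.

(** The comparison with 4 pi^2 / (2D) makes the decay of [LG] compensate the factor |exp (A / t)|
    near the real axis. For D = 5 both sides equal 2 pi^2 / 5. *)
Lemma cA_bounds (D : nat) : D = 3%nat \/ D = 5%nat ->
  383 / 100 <= cA (INR D) <= 395 / 100 /\ cA (INR D) <= (2 * PI) ^ 2 / (2 * INR D) /\
  0 <= cs (INR D) <= 1 / 4.
Proof.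
  intro HD; assert (HPI := PI_bounds).
  assert (H2 : 9.8695 <= PI ^ 2 <= 9.8697) by (split; cbn; nra).
  unfold cA, cs; destruct HD as [-> | ->]; cbn [INR]; repeat split; try lra.
Qed.

Lemma half_coth_lb (y : R) : 0 < y -> / y <= (exp y - exp (- y)) / (exp y + exp (- y) - 2) / 2.
Proof.
  intro Hy; assert (He := exp_ineq1 y ltac:(lra)).
  assert (E : exp (- y) = / exp y) by apply exp_Ropp.
  assert (H : 0 <= y * (exp y + 1) - 2 * (exp y - 1)).
  { apply (second_order_pos (fun y => y * (exp y + 1) - 2 * (exp y - 1)) (fun y => 1 + (y - 1) * exp y)
      (fun y => y * exp y) y Hy).
    - intros k _; auto_derive; [exact I|ring].
    - intros k _; auto_derive; [exact I|ring].
    - intros k Hk; apply Rmult_le_pos; [lra|left; apply exp_pos].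
    - rewrite exp_0; ring.
    - rewrite exp_0; ring. }
  replace ((exp y - exp (- y)) / (exp y + exp (- y) - 2) / 2) with ((exp y + 1) / (2 * (exp y - 1))).
  - apply Rmult_le_reg_r with (2 * (exp y - 1) * y); [nra|].
    replace (/ y * (2 * (exp y - 1) * y)) with (2 * (exp y - 1)) by (field; lra).
    replace ((exp y + 1) / (2 * (exp y - 1)) * (2 * (exp y - 1) * y)) with (y * (exp y + 1)) by (field; lra).
    lra.
  - rewrite E; set (e := exp y) in *; field; repeat split; try lra.
    apply Rgt_not_eq; nra.
Qed.

(** At th = 4 y the quotient in [re_bos_diff] tends to 16/17 as y tends to 0; 0.93 leaves room for
    all y up to 1/20. *)
Lemma minor_arc_saving (y th : R) : 0 < y <= 1 / 20 -> 4 * y <= Rabs th <= PI ->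
  93 / 100 / y <= Re (bos (RtoC y)) - Re (bos (y, th)).
Proof.
  intros Hy Hth; assert (HPI := PI_bounds).
  assert (Hcos : cos th <= 1 - 797 / 100 * y ^ 2).
  { apply Rle_trans with (cos (4 * y)).
    - replace (cos th) with (cos (Rabs th)).
      + destruct (Rle_lt_or_eq_dec _ _ (proj1 Hth)) as [H| <-]; [|lra].
        left; apply cos_decreasing_1; lra.
      + unfold Rabs; destruct (Rcase_abs th); [apply cos_neg|reflexivity].
    - destruct (pre_cos_bound (4 * y) 0 ltac:(lra) ltac:(lra)) as [_ H].
      replace (cos_approx (4 * y) (2 * (0 + 1))) with (1 - 8 * y ^ 2 + 32 / 3 * y ^ 2 * y ^ 2) in H
        by (unfold cos_approx, cos_term; simpl; field).
      assert (0 <= y ^ 2 <= / 400) by (split; [apply pow2_ge_0|nra]); nra. }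
  assert (Hch : exp y + exp (- y) - 2 <= 11 / 10 * y ^ 2).
  { assert (H : 0 <= 11 / 10 * y ^ 2 - (exp y + exp (- y) - 2)); [|lra].
    apply (second_order_pos (fun y => 11 / 10 * y ^ 2 - (exp y + exp (- y) - 2))
      (fun y => 11 / 5 * y - (exp y - exp (- y))) (fun y => 11 / 5 - (exp y + exp (- y))) y (proj1 Hy)).
    - intros k _; auto_derive; [exact I|field].
    - intros k _; auto_derive; [exact I|ring].
    - intros k Hk.
      assert (H1 : exp (- k) <= 1) by (rewrite <- exp_0; apply exp_le; lra).
      assert (H2 : exp k <= 20 / 19).
      { rewrite <- (Ropp_involutive k), exp_Ropp.
        replace (20 / 19) with (/ (19 / 20)) by field; apply Rinv_le_contravar; [lra|].
        generalize (exp_ineq1_le (- k)); lra. }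
      lra.
    - rewrite Ropp_0, exp_0; ring.
    - rewrite Ropp_0, exp_0; ring. }
  assert (Hy2 : 0 < y ^ 2) by (apply pow_lt; lra).
  rewrite re_bos_diff by lra.
  assert (H1 := half_coth_lb y ltac:(lra)).
  assert (Hch0 : 0 < exp y + exp (- y) - 2).
  { assert (E : exp y * exp (- y) = 1) by (rewrite <- exp_plus, Rplus_opp_r; apply exp_0).
    assert (H3 := exp_ineq1 y ltac:(lra)); assert (H4 := exp_pos (- y)).
    assert (H5 : exp (- y) < 1) by nra; nra. }
  assert (H2 : 93 / 100 <= (1 - cos th) / ((exp y + exp (- y)) / 2 - cos th)).
  { apply Rmult_le_reg_r with ((exp y + exp (- y)) / 2 - cos th); [lra|].
    replace ((1 - cos th) / ((exp y + exp (- y)) / 2 - cos th) * ((exp y + exp (- y)) / 2 - cos th))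
      with (1 - cos th) by (field; lra).
    lra. }
  unfold Rdiv at 1; rewrite Rmult_comm.
  apply Rmult_le_compat; try lra; left; apply Rinv_0_lt_compat; lra.
Qed.

(** Division by 1 - q^j is expressed by multiplying back, so the statement needs only shifts of real
    sequences and can be matched with any construction of the quotients. *)
Definition gen_step (D m : nat) (c c' : nat -> R) := exists v1 v2 v3 v4 v5 : nat -> R,
  (forall n, v1 n = c n - shift (2 * m) c n) /\ (forall n, v2 n = v1 n - shift (D * m) v1 n) /\
  (forall n, v3 n - shift m v3 n = v2 n) /\ (forall n, v4 n - shift m v4 n = v3 n) /\
  (forall n, v5 n - shift m v5 n = v4 n) /\ (forall n, c' n - shift (2 * D * m) c' n = v5 n).

Section Circle.
Variable D : nat.
Hypothesis HD : D = 3%nat \/ D = 5%nat.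
Variable c : nat -> nat -> R.
Hypothesis c_0 : forall n, c 0%nat n = if (n =? 0)%nat then 1 else 0.
Hypothesis c_S : forall N, gen_step D (S N) (c N) (c (S N)).

Lemma good_hprod (y : R) (N : nat) : 0 < y -> good y (fun th => hprod D N (y, th)) (c N).
Proof.
  intro Hy; induction N as [|N IH].
  - destruct (good_one y) as [H1 H2]; split; [exact H1|].
    intro n; cbn [hprod]; rewrite H2; unfold zext; destruct (n <? 0)%Z; [reflexivity|now rewrite c_0].
  - destruct (c_S N) as [v1 [v2 [v3 [v4 [v5 [E1 [E2 [E3 [E4 [E5 E6]]]]]]]]]].
    assert (HDN : (1 <= 2 * D * S N)%nat) by (apply (Nat.mul_le_mono 1 (2 * D) 1 (S N)); lia).
    cbn [hprod]; unfold Eq.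
    apply (good_div y Hy _ v5 _ (2 * D * S N) HDN); [|exact E6].
    apply (good_div y Hy _ v4 _ (S N) ltac:(lia)); [|exact E5].
    apply (good_div y Hy _ v3 _ (S N) ltac:(lia)); [|exact E4].
    apply (good_div y Hy _ v2 _ (S N) ltac:(lia)); [|exact E3].
    apply (good_mult y _ v1 _ (D * S N)); [|exact E2].
    apply (good_mult y _ (c N) _ (2 * S N)); [exact IH|exact E1].
Qed.

Variable a : nat -> R.
Hypothesis c_a : forall N n, (n <= N)%nat -> c N n = a n.

Let A := cA (INR D).
Let s := cs (INR D).

Variables (n : nat) (X : R).
Hypothesis X_large : 87 <= X.
Hypothesis X_sq : X ^ 2 = A * (INR n - s).

(** The saddle point of A/t + x t on the positive axis, where both terms equal [X]. *)
Let y := A / X.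
Let x := INR n - s.

Lemma A_bounds : 383 / 100 <= A <= 395 / 100.
Proof. apply (cA_bounds D HD). Qed.

Lemma y_bounds : 0 < y <= 1 / 20.
Proof.
  generalize A_bounds; intro HA; unfold y; split; [apply Rdiv_lt_0_compat; lra|].
  apply Rmult_le_reg_r with X; [lra|]; unfold Rdiv; rewrite Rmult_assoc, Rinv_l by lra; lra.
Qed.

Lemma Ay : A / y = X.
Proof. generalize A_bounds; intro HA; unfold y; field; lra. Qed.

Lemma xy : x * y = X.
Proof.
  generalize A_bounds; intro HA; unfold y, x.
  replace ((INR n - s) * (A / X)) with (A * (INR n - s) / X) by (field; lra).
  rewrite <- X_sq; field; lra.
Qed.

Lemma D_ge_1 : 1 <= INR D.
Proof. destruct HD as [-> | ->]; cbn; lra. Qed.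

Lemma exp_4_lb : 48 <= exp 4.
Proof.
  assert (H : 27 / 10 <= exp 1).
  { eapply Rle_trans; [|apply (exp_ge_taylor 1 4); lra]; cbn; lra. }
  replace 4 with (INR 4 * 1) by (cbn; ring); rewrite <- exp_pow.
  apply Rle_trans with ((27 / 10) ^ 4); [lra|apply pow_incr; lra].
Qed.

Lemma re_tdual_line (th : R) : Rabs th <= 4 * y ->
  (2 * PI) ^ 2 / (17 * y) <= Re (tdual (y, th)).
Proof.
  intro Hth; assert (Hy := y_bounds); assert (HPI := PI_bounds).
  rewrite re_tdual by (cbn; lra).
  unfold Rdiv at 1; apply Rmult_le_compat_l; [apply pow2_ge_0|].
  rewrite Cmod2_alt; cbn [Re Im fst snd].
  assert (Ht : th ^ 2 <= 16 * y ^ 2).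
  { apply Rabs_le_between in Hth; nra. }
  assert (H0 : 0 < y ^ 2 + th ^ 2) by nra.
  apply Rmult_le_reg_r with (17 * y * (y ^ 2 + th ^ 2)); [nra|].
  replace (/ (17 * y) * (17 * y * (y ^ 2 + th ^ 2))) with (y ^ 2 + th ^ 2) by (field; lra).
  replace (y / (y ^ 2 + th ^ 2) * (17 * y * (y ^ 2 + th ^ 2))) with (17 * y ^ 2) by (field; lra).
  lra.
Qed.

Lemma LG_small (th : R) : Rabs th <= 4 * y ->
  let v := Re (tdual (y, th)) / (2 * INR D) in
  exp (- v) <= / 48 /\ Cmod (LG (INR D) (tdual (y, th))) <= 24 * exp (- v).
Proof.
  intros Hth v; assert (Hy := y_bounds); assert (HPI := PI_bounds).
  assert (H := re_tdual_line th Hth).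
  assert (HD5 : INR D <= 5) by (destruct HD as [-> | ->]; cbn; lra).
  assert (HD1 := D_ge_1).
  (* Since y <= 1/20 the real part is at least 39 * 20 / 17 > 45, while 8 D is at most 40. *)
  assert (Hv : 4 * (2 * INR D) <= Re (tdual (y, th))).
  { eapply Rle_trans; [|exact H].
    apply Rle_trans with ((2 * PI) ^ 2 / (17 * (1 / 20))).
    - assert (39 <= (2 * PI) ^ 2) by nra; lra.
    - unfold Rdiv at 1 3; apply Rmult_le_compat_l; [apply pow2_ge_0|apply Rinv_le_contravar; lra]. }
  assert (Hv4 : 4 <= v).
  { unfold v; apply Rmult_le_reg_r with (2 * INR D); [lra|].
    unfold Rdiv; rewrite Rmult_assoc, Rinv_l by lra; lra. }
  split.
  - rewrite exp_Ropp; apply Rinv_le_contravar; [lra|].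
    eapply Rle_trans; [apply exp_4_lb|now apply exp_le].
  - apply LG_bound; lra.
Qed.

Lemma LF_line_real : exp (Re (LF (INR D) (RtoC y))) * exp (INR n * y) <= y / PI * exp (2 * X).
Proof.
  assert (Hy := y_bounds); assert (HPI := PI_bounds); assert (HD1 := D_ge_1).
  rewrite <- cexp_mod, LF_transform by (cbn; lra).
  rewrite !Cmod_mult, cexp_mod.
  fold A s.
  assert (E : (RtoC y) = (y, 0)) by reflexivity.
  destruct (LG_small 0) as [H1 H2]; [rewrite Rabs_R0; lra|]; rewrite <- E in H1, H2.
  set (b := exp _) in H1, H2.
  assert (H3 : Cmod (cexp (LG (INR D) (tdual y))) <= 2).
  { eapply Rle_trans; [apply cexp_mod_le|].
    apply Rle_trans with (exp (/ 2)); [apply exp_le; lra|].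
    apply Rsqr_incr_0_var; [|lra]; unfold Rsqr; rewrite <- exp_plus.
    replace (/ 2 + / 2) with 1 by field; generalize exp_le_3; lra. }
  replace (Re (A / y - s * y)%C) with (A / y - s * y)
    by (rewrite <- RtoC_div, <- RtoC_mult, <- RtoC_minus by lra; reflexivity).
  rewrite <- RtoC_div, Cmod_R, Rabs_pos_eq by (try apply Rlt_le, Rdiv_lt_0_compat; lra).
  replace (2 * X) with ((A / y - s * y) + INR n * y).
  - rewrite exp_plus.
    set (e1 := exp (A / y - s * y)); set (e2 := exp (INR n * y)).
    assert (0 < e1) by apply exp_pos; assert (0 < e2) by apply exp_pos.
    apply Rle_trans with (y / (2 * PI) * e1 * 2 * e2); [|right; field; lra].
    apply Rmult_le_compat_r; [lra|]; apply Rmult_le_compat_l; [|exact H3].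
    apply Rmult_le_pos; [left; apply Rdiv_lt_0_compat; lra|lra].
  - rewrite Ay; replace (X - s * y + INR n * y) with (X + x * y) by (unfold x; ring); rewrite xy; ring.
Qed.

(** The saving 2 * 0.93 / y equals 1.86 X / A, at least 0.47 X because A <= 3.95; hence the exponent
    1.53 = 2 - 0.47. *)
Lemma minor_arc_bound (th : R) : 4 * y <= Rabs th <= PI ->
  exp (Re (LF (INR D) (y, th))) * exp (INR n * y) <= y / PI * exp (153 / 100 * X).
Proof.
  intro Hth; assert (Hy := y_bounds); assert (HPI := PI_bounds); assert (HA := A_bounds).
  assert (H1 := re_LF_minor D (y, th) HD (proj1 Hy)); cbn [Re fst] in H1.
  assert (H2 := minor_arc_saving y th Hy Hth).
  assert (H3 := LF_line_real).
  set (P := Re (LF (INR D) (RtoC y))) in *.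
  assert (H4 : 47 / 100 * X <= 2 * (93 / 100 / y)).
  { rewrite <- Ay; unfold Rdiv; assert (0 < / y) by (apply Rinv_0_lt_compat; lra); nra. }
  apply Rle_trans with (exp (P - 47 / 100 * X) * exp (INR n * y)).
  - apply Rmult_le_compat_r; [left; apply exp_pos|apply exp_le; lra].
  - replace (153 / 100 * X) with (2 * X + - (47 / 100 * X)) by field.
    unfold Rminus; rewrite !exp_plus.
    assert (0 < exp (- (47 / 100 * X))) by apply exp_pos; nra.
Qed.

Lemma GG_line_transform (th : R) :
  (cexp (LF (INR D) (y, th)) * cexp (INR n * (y, th)))%C
  = (/ RtoC (2 * PI) * GG A x (y, th) * cexp (LG (INR D) (tdual (y, th))))%C.
Proof.
  assert (Hy := y_bounds); assert (HPI := PI_bounds); assert (HD1 := D_ge_1).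
  rewrite LF_transform by (cbn; lra); fold A s; unfold GG, x.
  replace (A / (y, th) - s * (y, th))%C with (A / (y, th) + - (s * (y, th)))%C by ring.
  replace ((INR n - s)%R * (y, th))%C with (- (s * (y, th)) + INR n * (y, th))%C by (rewrite RtoC_minus; ring).
  rewrite !cexp_add; field; apply C_neq_R; lra.
Qed.

(** With v = Re (tdual t) / (2D), the factor exp (A / t) is at most exp v by [cA_bounds], and exp
    (LG) - 1 is O(exp (-v)): the two cancel and only exp X remains. Here 144 = 2 * 24 * 3, 4.2
    exceeds sqrt 17, and 4.2 * 144 / 6.2 < 100. *)
Lemma main_arc_bound (th : R) : Rabs th <= 4 * y ->
  Cmod (cexp (LF (INR D) (y, th)) * cexp (INR n * (y, th)) - / RtoC (2 * PI) * GG A x (y, th))%C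
  <= 100 * y * exp X.
Proof.
  intro Hth; assert (Hy := y_bounds); assert (HPI := PI_bounds); assert (HD1 := D_ge_1); assert (HA := A_bounds).
  rewrite GG_line_transform.
  destruct (LG_small th Hth) as [H1 H2].
  set (v := Re (tdual (y, th)) / (2 * INR D)) in *; set (w := LG (INR D) (tdual (y, th))) in *.
  replace (/ RtoC (2 * PI) * GG A x (y, th) * cexp w - / RtoC (2 * PI) * GG A x (y, th))%C
    with (/ RtoC (2 * PI) * (GG A x (y, th) * (cexp w - 1)))%C by ring.
  rewrite Cmod_mult, <- RtoC_inv, Cmod_R, Rabs_pos_eq, Cmod_mult by (try (apply Rlt_le, Rinv_0_lt_compat); lra).
  assert (H3 : Cmod (cexp w - 1)%C <= 144 * exp (- v)).
  { eapply Rle_trans; [apply cexp_m1_bound|].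
    assert (H0 := Cmod_ge_0 w).
    apply Rle_trans with (2 * (24 * exp (- v)) * exp 1).
    - apply Rmult_le_compat; [lra|left; apply exp_pos|lra|apply exp_le; lra].
    - generalize exp_le_3 (exp_pos (- v)); intros; nra. }
  assert (H4 : Cmod (GG A x (y, th)) <= 42 / 10 * y * (exp X * exp v)).
  { unfold GG; rewrite !Cmod_mult, !cexp_mod, Rmult_assoc; apply Rmult_le_compat.
    - apply Cmod_ge_0.
    - apply Rmult_le_pos; left; apply exp_pos.
    - unfold Cmod; cbn [fst snd]; rewrite <- (sqrt_pow2 (42 / 10 * y)) by lra; apply sqrt_le_1_alt.
      apply Rabs_le_between in Hth; nra.
    - rewrite Rmult_comm; apply Rmult_le_compat; try (left; apply exp_pos); apply exp_le.
      + rewrite re_scal_l; cbn [Re fst]; rewrite xy; lra.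
      + assert (Hy0 : 0 < Re (y, th)) by (cbn; lra).
        unfold Cdiv; rewrite re_scal_l.
        assert (E : Re (/ (y, th))%C = Re (tdual (y, th)) / (2 * PI) ^ 2).
        { rewrite re_tdual, Cmod2_alt by exact Hy0; cbn; field; split; [nra|lra]. }
        rewrite E; unfold v.
        assert (Hp := re_tdual_pos (y, th) Hy0).
        assert (Hc := proj1 (proj2 (cA_bounds D HD))); fold A in Hc.
        set (q := Re (tdual (y, th))) in *.
        assert (H5 : 0 < (2 * PI) ^ 2) by nra.
        apply Rmult_le_reg_r with ((2 * PI) ^ 2); [exact H5|].
        replace (A * (q / (2 * PI) ^ 2) * (2 * PI) ^ 2) with (A * q) by (field; lra).
        replace (q / (2 * INR D) * (2 * PI) ^ 2) with ((2 * PI) ^ 2 / (2 * INR D) * q) by (field; lra).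
        apply Rmult_le_compat_r; lra. }
  assert (E : exp v * exp (- v) = 1) by (rewrite <- exp_plus, Rplus_opp_r; apply exp_0).
  assert (HeX := exp_pos X).
  apply Rle_trans with (/ (2 * PI) * (42 / 10 * y * (exp X * exp v) * (144 * exp (- v)))).
  - apply Rmult_le_compat_l; [left; apply Rinv_0_lt_compat; lra|].
    apply Rmult_le_compat; try apply Cmod_ge_0; assumption.
  - replace (42 / 10 * y * (exp X * exp v) * (144 * exp (- v)))
      with (42 / 10 * 144 * (y * exp X) * (exp v * exp (- v))) by ring.
    rewrite E.
    assert (0 < y * exp X) by (apply Rmult_lt_0_compat; lra).
    assert (/ (2 * PI) <= / 6) by (apply Rinv_le_contravar; lra).
    assert (0 < / (2 * PI)) by (apply Rinv_0_lt_compat; lra).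
    apply Rle_trans with (/ 6.2 * (42 / 10 * 144 * (y * exp X) * 1)); [|lra].
    apply Rmult_le_compat_r; [lra|apply Rinv_le_contravar; lra].
Qed.

(** The error from using N factors of the product. It disappears as N grows with [n] fixed, since
    the coefficient is already final once N >= n. *)
Definition herr (N : nat) : R :=
  let eta := 12 * exp (- (INR N * y)) / y in
  exp (Re (LF (INR D) (RtoC y))) * (4 * eta * exp (4 * eta)) * exp (INR n * y).

Lemma herr_lim : is_lim_seq herr 0.
Proof.
  assert (Hy := y_bounds).
  set (B := exp (Re (LF (INR D) (RtoC y))) * (48 / y) * exp (48 / y) * exp (INR n * y)).
  apply lim0_squeeze with (fun N => B * exp (- y) ^ N).
  - exists O; intros N _.
    assert (He : 0 < exp (- y) ^ N <= 1).
    { rewrite exp_pow; split; [apply exp_pos|rewrite <- exp_0; apply exp_le].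
      generalize (pos_INR N); nra. }
    unfold herr; replace (exp (- (INR N * y))) with (exp (- y) ^ N) by (rewrite exp_pow; f_equal; ring).
    set (r := exp (- y) ^ N) in *.
    assert (Hp1 := exp_pos (Re (LF (INR D) (RtoC y)))); assert (Hp2 := exp_pos (INR n * y)).
    assert (Hiy : 0 < / y) by (apply Rinv_0_lt_compat; lra).
    assert (Hp3 := exp_pos (4 * (12 * r / y))).
    assert (Hle : exp (4 * (12 * r / y)) <= exp (48 / y)).
    { apply exp_le; unfold Rdiv; nra. }
    assert (H0 : 0 < 48 * r * / y) by nra.
    split.
    + repeat apply Rmult_le_pos; lra || (unfold Rdiv; nra).
    + unfold B; replace (4 * (12 * r / y)) with (48 * r * / y) in * by (field; lra).
      replace (exp (Re (LF (INR D) y)) * (48 / y) * exp (48 / y) * exp (INR n * y) * r)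
        with (exp (Re (LF (INR D) y)) * (48 * r * / y * exp (48 / y)) * exp (INR n * y)) by (field; lra).
      apply Rmult_le_compat_r; [lra|]; apply Rmult_le_compat_l; [lra|].
      apply Rmult_le_compat_l; lra.
  - apply is_lim_seq_0_scal, is_lim_seq_geom.
    rewrite Rabs_pos_eq by (left; apply exp_pos); rewrite <- exp_0; apply exp_increasing; lra.
Qed.

Lemma hprod_line_err (N : nat) (th : R) :
  Cmod (hprod D N (y, th) * cexp (INR n * (y, th)) - cexp (LF (INR D) (y, th)) * cexp (INR n * (y, th)))%C
  <= herr N.
Proof.
  assert (Hy := y_bounds).
  assert (H := hprod_approx D N (y, th) ltac:(lia) (proj1 Hy)); cbv zeta in H; cbn [Re fst] in H.
  replace (hprod D N (y, th) * cexp (INR n * (y, th)) - cexp (LF (INR D) (y, th)) * cexp (INR n * (y, th)))%C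
    with ((hprod D N (y, th) - cexp (LF (INR D) (y, th))) * cexp (INR n * (y, th)))%C by ring.
  rewrite Cmod_mult, cexp_mod, re_scal_l; cbn [Re fst]; unfold herr.
  apply Rmult_le_compat_r; [left; apply exp_pos|].
  eapply Rle_trans; [exact H|].
  apply Rmult_le_compat_r.
  - assert (0 < 12 * exp (- (INR N * y)) / y).
    { apply Rdiv_lt_0_compat; [generalize (exp_pos (- (INR N * y))); lra|lra]. }
    apply Rmult_le_pos; [lra|left; apply exp_pos].
  - apply exp_le.
    assert (H1 := re_LF_minor D (y, th) HD (proj1 Hy)); cbn [Re fst] in H1.
    assert (H2 := re_bos_le (y, th) (proj1 Hy)); cbn [Re fst] in H2; lra.
Qed.

Theorem coef_estimate : Rabs (2 * PI * a n - A ^ 2 * KB 2 (X ^ 2)) <= 3 * y * exp (153 / 100 * X).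
Proof.
  assert (Hy := y_bounds); assert (HPI := PI_bounds); assert (HA := A_bounds).
  set (th0 := 4 * y).
  (* With tan phi = 4 the segment of the contour is exactly the range |th| <= 4 y of the main
     arc. *)
  set (phi := atan 4); set (r := sqrt 17 * y).
  assert (H17 : 0 < sqrt 17) by (apply sqrt_lt_R0; lra).
  assert (H17' : sqrt 17 * sqrt 17 = 17) by (apply sqrt_sqrt; lra).
  assert (Ec : r * cos phi = y).
  { unfold r, phi; rewrite cos_atan; replace (1 + 4²) with 17 by (unfold Rsqr; ring); field; lra. }
  assert (Es : r * sin phi = th0).
  { unfold r, phi, th0; rewrite sin_atan; replace (1 + 4²) with 17 by (unfold Rsqr; ring); field; lra. }
  assert (Hphi : 0 < phi < PI / 2).
  { unfold phi; split; [rewrite <- atan_0; apply atan_increasing; lra|apply atan_bound]. }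
  assert (Hr : 0 < r) by (apply Rmult_lt_0_compat; lra).
  assert (Hx : 0 < x).
  { assert (0 < x * y) by (rewrite xy; lra).
    apply Rnot_le_lt; intro; nra. }
  assert (Hseg := segment_integral r phi Hr Hphi A x ltac:(lra) Hx); rewrite Ec, Es in Hseg.
  replace (A * x) with (X ^ 2) in Hseg by (unfold x; rewrite X_sq; reflexivity).
  replace (A * y / r ^ 2 + x * y) with (X / 17 + X) in Hseg.
  2:{ rewrite xy; f_equal; unfold r; rewrite Rpow_mult_distr; replace (sqrt 17 ^ 2) with 17 by (cbn; lra).
      rewrite <- Ay at 1; field; lra. }
  set (GI := RInt (fun th => Re (GG A x (y, th))) (- th0) th0) in *.
  set (e1 := y / PI * exp (153 / 100 * X)); set (e2 := 100 * y * exp X).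
  assert (Step : forall N, (n <= N)%nat -> Rabs (2 * PI * a n - / (2 * PI) * GI)
     <= 2 * PI * e1 + 2 * th0 * e2 + 4 * PI * herr N).
  { intros N HN.
    destruct (good_hprod y N (proj1 Hy)) as [Sm Hco].
    specialize (Hco (Z.of_nat n)); unfold zext in Hco.
    replace (Z.of_nat n <? 0)%Z with false in Hco by (symmetry; apply Z.ltb_ge; lia).
    rewrite Nat2Z.id, (c_a N n HN) in Hco; rewrite <- Hco; unfold coef.
    rewrite <- INR_IZR_INZ.
    set (f := fun th => Re (hprod D N (y, th) * cexp (INR n * (y, th)))%C).
    assert (Hex : forall p q, ex_RInt f p q).
    { intros p q; unfold f; rewrite INR_IZR_INZ.
      apply (smooth_ex_RInt (fun th => hprod D N (y, th) * cexp (IZR (Z.of_nat n) * (y, th)))%C).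
      apply (smooth_kernel y (fun th => hprod D N (y, th))), Sm. }
    assert (Hch : RInt f (- PI) PI = RInt f (- PI) (- th0) + RInt f (- th0) th0 + RInt f th0 PI).
    { rewrite <- (RInt_Chasles f (- PI) (- th0) PI) by apply Hex.
      rewrite <- (RInt_Chasles f (- th0) th0 PI) by apply Hex.
      unfold plus; cbn; ring. }
    assert (Hherr : 0 <= herr N) by (eapply Rle_trans; [apply Cmod_ge_0|apply (hprod_line_err N 0)]).
    assert (Hth0 : 0 < th0 < PI) by (unfold th0; lra).
    assert (Hmin : forall th, th0 <= Rabs th <= PI -> Rabs (f th) <= e1 + herr N).
    { intros th Hth; unfold f; eapply Rle_trans; [apply re_le_Cmod|].
      assert (H1 := hprod_line_err N th).
      set (p := (hprod D N (y, th) * cexp (INR n * (y, th)))%C) in *.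
      set (q := (cexp (LF (INR D) (y, th)) * cexp (INR n * (y, th)))%C) in *.
      replace p with (q + (p - q))%C by ring.
      eapply Rle_trans; [apply Cmod_triangle|]; apply Rplus_le_compat; [|exact H1].
      unfold q; rewrite Cmod_mult, !cexp_mod, re_scal_l; cbn [Re fst].
      apply minor_arc_bound; exact Hth. }
    assert (I1 : Rabs (RInt f (- PI) (- th0)) <= (- th0 - - PI) * (e1 + herr N)).
    { apply abs_RInt_le_const; [lra|apply Hex|].
      intros th Hth; apply Hmin; rewrite Rabs_left by lra; lra. }
    assert (I3 : Rabs (RInt f th0 PI) <= (PI - th0) * (e1 + herr N)).
    { apply abs_RInt_le_const; [lra|apply Hex|].
      intros th Hth; apply Hmin; rewrite Rabs_pos_eq by lra; lra. }
    assert (I2 : Rabs (RInt f (- th0) th0 - / (2 * PI) * GI) <= (th0 - - th0) * (e2 + herr N)).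
    { assert (HexG : ex_RInt (fun th => Re (GG A x (y, th))) (- th0) th0).
      { rewrite <- Ec; apply (smooth_ex_RInt (fun th => GG A x (r * cos phi, th))).
        apply (smooth_GG_line r phi Hr Hphi). }
      assert (HexG' := ex_RInt_scal _ _ _ (/ (2 * PI)) HexG).
      assert (E1 : / (2 * PI) * GI = RInt (fun th => / (2 * PI) * Re (GG A x (y, th))) (- th0) th0).
      { symmetry; exact (RInt_scal (V := R_CompleteNormedModule) _ _ _ (/ (2 * PI)) HexG). }
      assert (E2 : RInt f (- th0) th0 - RInt (fun th => / (2 * PI) * Re (GG A x (y, th))) (- th0) th0
        = RInt (fun th => f th - / (2 * PI) * Re (GG A x (y, th))) (- th0) th0).
      { symmetry; exact (RInt_minus (V := R_CompleteNormedModule) _ _ _ _ (Hex _ _) HexG'). }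
      rewrite E1, E2.
      apply abs_RInt_le_const; [lra|exact (ex_RInt_minus _ _ _ _ (Hex _ _) HexG')|].
      intros th Hth.
      assert (H1 := hprod_line_err N th).
      assert (H2 := main_arc_bound th ltac:(apply Rabs_le; fold th0; lra)).
      set (p := (hprod D N (y, th) * cexp (INR n * (y, th)))%C) in *.
      set (q := (cexp (LF (INR D) (y, th)) * cexp (INR n * (y, th)))%C) in *.
      replace (f th - / (2 * PI) * Re (GG A x (y, th))) with (Re (p - / RtoC (2 * PI) * GG A x (y, th))%C).
      + eapply Rle_trans; [apply re_le_Cmod|].
        eapply Rle_trans; [apply (Cmod_minus_le _ q)|]; fold e2 in H2; lra.
      + rewrite <- RtoC_inv by lra; unfold Cminus; rewrite re_plus, re_opp, re_scal_l; reflexivity. }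
    rewrite Hch.
    replace (RInt f (- PI) (- th0) + RInt f (- th0) th0 + RInt f th0 PI - / (2 * PI) * GI)
      with (RInt f (- PI) (- th0) + (RInt f (- th0) th0 - / (2 * PI) * GI) + RInt f th0 PI) by ring.
    assert (He1 : 0 <= e1).
    { apply Rmult_le_pos; [left; apply Rdiv_lt_0_compat; lra|left; apply exp_pos]. }
    assert (He2 : 0 <= e2) by (unfold e2; generalize (exp_pos X); intro; nra).
    eapply Rle_trans; [apply Rabs_triang|eapply Rle_trans; [apply Rplus_le_compat_r, Rabs_triang|]].
    nra. }
  assert (Hlim : Rabs (2 * PI * a n - / (2 * PI) * GI) <= 2 * PI * e1 + 2 * th0 * e2).
  { apply (is_lim_seq_le_loc (fun _ => Rabs (2 * PI * a n - / (2 * PI) * GI))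
       (fun N => 2 * PI * e1 + 2 * th0 * e2 + 4 * PI * herr N)
       (Rabs (2 * PI * a n - / (2 * PI) * GI)) (2 * PI * e1 + 2 * th0 * e2)).
    - exists n; exact Step.
    - apply is_lim_seq_const.
    - replace (Finite (2 * PI * e1 + 2 * th0 * e2)) with (Finite (2 * PI * e1 + 2 * th0 * e2 + 0)) by (f_equal; ring).
      apply is_lim_seq_plus'; [apply is_lim_seq_const|apply is_lim_seq_0_scal, herr_lim]. }
  assert (Hseg' : Rabs (/ (2 * PI) * GI - A ^ 2 * KB 2 (X ^ 2)) <= 17 * y ^ 2 * exp (X / 17 + X)).
  { replace (/ (2 * PI) * GI - A ^ 2 * KB 2 (X ^ 2)) with (/ (2 * PI) * (GI - 2 * PI * A ^ 2 * KB 2 (X ^ 2)))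
      by (field; lra).
    rewrite Rabs_mult, Rabs_pos_eq by (left; apply Rinv_0_lt_compat; lra).
    apply Rmult_le_reg_l with (2 * PI); [lra|].
    rewrite <- Rmult_assoc, Rinv_r, Rmult_1_l by lra.
    eapply Rle_trans; [exact Hseg|right].
    replace (17 * y ^ 2) with (r * r) by (unfold r; rewrite <- H17' at 3; ring); ring. }
  replace (2 * PI * a n - A ^ 2 * KB 2 (X ^ 2))
    with ((2 * PI * a n - / (2 * PI) * GI) + (/ (2 * PI) * GI - A ^ 2 * KB 2 (X ^ 2))) by ring.
  eapply Rle_trans; [apply Rabs_triang|].
  set (E := exp (153 / 100 * X)) in *.
  (* The exponents differ by w > 0.47 X > 40, and already w^2 / 2 exceeds 100. *)
  assert (HX1 : 100 * exp (X / 17 + X) <= E).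
  { replace E with (exp (153 / 100 * X - (X / 17 + X)) * exp (X / 17 + X))
      by (unfold E; rewrite <- exp_plus; f_equal; ring).
    apply Rmult_le_compat_r; [left; apply exp_pos|].
    generalize (exp_ineq1_le (153 / 100 * X - (X / 17 + X))).
    intro Hq; eapply Rle_trans; [|apply (exp_ge_taylor _ 2); lra].
    cbn; set (w := 153 / 100 * X - (X / 17 + X)) in *.
    assert (40 <= w) by (unfold w; lra); nra. }
  assert (HX2 : exp X <= exp (X / 17 + X)) by (apply exp_le; lra).
  assert (HEp : 0 < E) by apply exp_pos.
  assert (F1 : 2 * PI * e1 = 2 * y * E) by (unfold e1; field; lra).
  assert (F2 : 2 * th0 * e2 <= 8 / 10 * (y * E)).
  { unfold th0, e2; replace (2 * (4 * y) * (100 * y * exp X)) with (8 * y * (y * (100 * exp X))) by ring.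
    assert (H1 : 100 * exp X <= E) by lra.
    assert (H2 : y * (100 * exp X) <= 1 / 20 * E).
    { apply Rmult_le_compat; try lra; generalize (exp_pos X); lra. }
    nra. }
  assert (F3 : 17 * y ^ 2 * exp (X / 17 + X) <= 1 / 10 * (y * E)).
  { replace (17 * y ^ 2 * exp (X / 17 + X)) with (17 / 100 * y * (y * (100 * exp (X / 17 + X)))) by field.
    assert (H2 : y * (100 * exp (X / 17 + X)) <= 1 / 20 * E).
    { apply Rmult_le_compat; try lra; generalize (exp_pos (X / 17 + X)); lra. }
    nra. }
  assert (0 < y * E) by (apply Rmult_lt_0_compat; lra); lra.
Qed.

End Circle.

(** * The determinant for large indices *)

Definition det3 (a0 a1 a2 a3 a4 : R) : R :=
  a2 ^ 3 - 2 * a1 * a2 * a3 + a1 ^ 2 * a4 + a0 * a3 ^ 2 - a0 * a2 * a4.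

Lemma det3_condensation (a0 a1 a2 a3 a4 : R) :
  a2 * det3 a0 a1 a2 a3 a4 = (a2 ^ 2 - a1 * a3) ^ 2 - (a1 ^ 2 - a0 * a2) * (a3 ^ 2 - a2 * a4).
Proof. unfold det3; ring. Qed.

(** Cancellation amplifies the relative error of the entries by 1 / (1 - q), which is why [eps] is
    compared with [eta * (1 - q)]. The 5 collects 5/2 from the square and 5/2 from the product. *)
Lemma perturbed_square (k m q eps eta e1 e2 e3 : R) : 0 < q < 1 -> 0 <= eps <= 1 / 2 ->
  5 * eps <= eta * (1 - q) -> Rabs e1 <= eps -> Rabs e2 <= eps -> Rabs e3 <= eps ->
  exists d, Rabs d <= eta /\
  (k * m * (1 + e2)) ^ 2 - k ^ 2 * m ^ 2 * q * ((1 + e1) * (1 + e3)) = k ^ 2 * m ^ 2 * (1 - q) * (1 + d).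
Proof.
  intros Hq He Heta H1 H2 H3.
  apply Rabs_le_between in H1; apply Rabs_le_between in H2; apply Rabs_le_between in H3.
  set (w := 2 * e2 + e2 ^ 2 - q * (e1 + e3 + e1 * e3)).
  exists (w / (1 - q)); split.
  - unfold Rdiv; rewrite Rabs_mult, (Rabs_pos_eq (/ (1 - q))) by (left; apply Rinv_0_lt_compat; lra).
    apply Rmult_le_reg_r with (1 - q); [lra|].
    rewrite Rmult_assoc, Rinv_l, Rmult_1_r by lra.
    assert (G2 : - (5 / 2 * eps) <= 2 * e2 + e2 ^ 2 <= 5 / 2 * eps) by nra.
    assert (G3 : - (5 / 2 * eps) <= e1 + e3 + e1 * e3 <= 5 / 2 * eps).
    { assert (- (eps / 2) <= e1 * e3 <= eps / 2) by nra; lra. }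
    apply Rle_trans with (5 * eps); [|exact Heta].
    apply Rabs_le; unfold w; set (u := e1 + e3 + e1 * e3) in *; nra.
  - unfold w; field; lra.
Qed.

(** A relative gap of [5 * eta] absorbs errors of size [eta] in three minors because (1 + 5 eta)(1 -
    eta)^2 - (1 + eta)^2 = eta (1 - 10 eta + 5 eta^2), positive for eta < 1/10. *)
Lemma det_perturbation (k m1 m2 m3 q1 q2 q3 eta d1 d2 d3 : R) :
  0 < k -> 0 < m1 -> 0 < m2 -> 0 < m3 -> 0 < q1 < 1 -> 0 < q2 < 1 -> 0 < q3 < 1 ->
  m1 * m3 = m2 ^ 2 * q2 ->
  0 < eta < 1 / 10 -> (1 + 5 * eta) * (q2 ^ 2 * ((1 - q1) * (1 - q3))) <= (1 - q2) ^ 2 ->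
  Rabs d1 <= eta -> Rabs d2 <= eta -> Rabs d3 <= eta ->
  0 < (k ^ 2 * m2 ^ 2 * (1 - q2) * (1 + d2)) ^ 2
      - (k ^ 2 * m1 ^ 2 * (1 - q1) * (1 + d1)) * (k ^ 2 * m3 ^ 2 * (1 - q3) * (1 + d3)).
Proof.
  intros Hk H1 H2 H3 Q1 Q2 Q3 Hm Heta Hgap D1 D2 D3.
  apply Rabs_le_between in D1; apply Rabs_le_between in D2; apply Rabs_le_between in D3.
  replace ((k ^ 2 * m1 ^ 2 * (1 - q1) * (1 + d1)) * (k ^ 2 * m3 ^ 2 * (1 - q3) * (1 + d3)))
    with (k ^ 4 * (m1 * m3) ^ 2 * ((1 - q1) * (1 - q3)) * ((1 + d1) * (1 + d3))) by ring.
  rewrite Hm.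
  replace ((k ^ 2 * m2 ^ 2 * (1 - q2) * (1 + d2)) ^ 2
    - k ^ 4 * (m2 ^ 2 * q2) ^ 2 * ((1 - q1) * (1 - q3)) * ((1 + d1) * (1 + d3)))
    with (k ^ 4 * m2 ^ 4 * ((1 - q2) ^ 2 * (1 + d2) ^ 2 - (q2 ^ 2 * ((1 - q1) * (1 - q3))) * ((1 + d1) * (1 + d3)))) by ring.
  set (B := q2 ^ 2 * ((1 - q1) * (1 - q3))) in *.
  assert (HB : 0 < B).
  { unfold B; apply Rmult_lt_0_compat; [apply pow_lt; lra|apply Rmult_lt_0_compat; lra]. }
  apply Rmult_lt_0_compat; [apply Rmult_lt_0_compat; apply pow_lt; lra|].
  assert (F1 : (1 - eta) ^ 2 <= (1 + d2) ^ 2) by (apply pow_incr; lra).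
  assert (F2 : (1 + d1) * (1 + d3) <= (1 + eta) ^ 2).
  { replace ((1 + eta) ^ 2) with ((1 + eta) * (1 + eta)) by ring; apply Rmult_le_compat; lra. }
  assert (F3 : (1 + 5 * eta) * B * (1 - eta) ^ 2 <= (1 - q2) ^ 2 * (1 + d2) ^ 2).
  { apply Rmult_le_compat; [nra|apply pow2_ge_0|exact Hgap|exact F1]. }
  assert (F4 : B * ((1 + d1) * (1 + d3)) <= B * (1 + eta) ^ 2) by (apply Rmult_le_compat_l; lra).
  assert (F5 : 0 < B * ((1 + 5 * eta) * (1 - eta) ^ 2 - (1 + eta) ^ 2)).
  { apply Rmult_lt_0_compat; [exact HB|].
    replace ((1 + 5 * eta) * (1 - eta) ^ 2 - (1 + eta) ^ 2) with (eta * (1 - 10 * eta + 5 * eta ^ 2)) by ring.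
    apply Rmult_lt_0_compat; nra. }
  lra.
Qed.

Lemma exp_1_lb : 27 / 10 <= exp 1.
Proof. eapply Rle_trans; [|apply (exp_ge_taylor 1 4); lra]; cbn; lra. Qed.

(** Beyond 87 the power X^8 grows at most like exp (8 (X - 87) / 87), slower than exp (0.47 X), so
    only the value at 87 matters. There 0.47 * 87 > 40, and 2.7^40 bounds exp 40 from below. *)
Lemma error_decay (X A : R) : 87 <= X -> 383 / 100 <= A ->
  6 * exp 2 / A * X ^ 2 * exp (- (47 / 100 * X)) <= 277 / 100 / X ^ 6.
Proof.
  intros HX HA.
  assert (He2 : exp 2 <= 9).
  { replace 2 with (1 + 1) by ring; rewrite exp_plus; generalize exp_le_3 (exp_pos 1); nra. }
  assert (Hp : 0 < X ^ 6) by (apply pow_lt; lra).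
  assert (HX8 : X ^ 8 <= 87 ^ 8 * exp (8 * ((X - 87) / 87))).
  { replace (8 * ((X - 87) / 87)) with (INR 8 * ((X - 87) / 87)) by (cbn; ring).
    rewrite <- exp_pow, <- Rpow_mult_distr; apply pow_incr; split; [lra|].
    generalize (exp_ineq1_le ((X - 87) / 87)); lra. }
  assert (H40 : (27 / 10) ^ 40 <= exp 40).
  { replace 40 with (INR 40 * 1) by (rewrite INR_IZR_INZ; cbn; ring).
    rewrite <- exp_pow; apply pow_incr; generalize exp_1_lb; lra. }
  assert (HE : exp 40 * exp (8 * ((X - 87) / 87)) <= exp (47 / 100 * X)).
  { rewrite <- exp_plus; apply exp_le; lra. }
  assert (Hn : 15 * 87 ^ 8 <= 277 / 100 * (27 / 10) ^ 40) by lra.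
  assert (HE0 := exp_pos (8 * ((X - 87) / 87))).
  assert (H15 : 15 * X ^ 8 <= 277 / 100 * exp (47 / 100 * X)).
  { set (E8 := exp (8 * ((X - 87) / 87))) in *.
    apply Rle_trans with (15 * 87 ^ 8 * E8); [lra|].
    apply Rle_trans with (277 / 100 * (exp 40 * E8)); [|lra].
    rewrite <- Rmult_assoc; apply Rmult_le_compat_r; [lra|].
    eapply Rle_trans; [exact Hn|]; apply Rmult_le_compat_l; [lra|exact H40]. }
  assert (Hc : 6 * exp 2 / A <= 15).
  { apply Rmult_le_reg_r with A; [lra|]; unfold Rdiv; rewrite Rmult_assoc, Rinv_l by lra; lra. }
  apply Rmult_le_reg_r with (X ^ 6); [exact Hp|].
  replace (277 / 100 / X ^ 6 * X ^ 6) with (277 / 100) by (field; lra).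
  rewrite exp_Ropp; set (E := exp (47 / 100 * X)) in *; assert (HEp : 0 < E) by apply exp_pos.
  apply Rmult_le_reg_r with E; [exact HEp|].
  replace (6 * exp 2 / A * X ^ 2 * / E * X ^ 6 * E) with (6 * exp 2 / A * X ^ 8) by (field; lra).
  apply Rle_trans with (15 * X ^ 8); [|unfold Rdiv in *; lra].
  apply Rmult_le_compat_r; [apply pow_le; lra|exact Hc].
Qed.

Section Large.
Variable D : nat.
Hypothesis HD : D = 3%nat \/ D = 5%nat.
Variable c : nat -> nat -> R.
Hypothesis c_0 : forall n, c 0%nat n = if (n =? 0)%nat then 1 else 0.
Hypothesis c_S : forall N, gen_step D (S N) (c N) (c (S N)).
Variable a : nat -> R.
Hypothesis c_a : forall N n, (n <= N)%nat -> c N n = a n.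

Let A := cA (INR D).
Let s := cs (INR D).
Let zz (n : nat) := A * (INR n - s).
Let kap := A ^ 2 / (2 * PI).

(** The origin of 87: 3.83 * 1999.75 exceeds 87^2 = 7569. *)
Lemma zz_large (n : nat) : (2000 <= n)%nat -> 87 ^ 2 <= zz n.
Proof.
  intro Hn; apply le_INR in Hn; rewrite (INR_IZR_INZ 2000) in Hn; change (IZR (Z.of_nat 2000)) with 2000 in Hn.
  destruct (cA_bounds D HD) as [H1 [_ H2]]; fold A in H1; fold s in H2; unfold zz; nra.
Qed.

Lemma relative_error (n : nat) : (2000 <= n)%nat ->
  exists e, Rabs e <= 277 / 100 / sqrt (zz n) ^ 6 /\ a n = kap * KB 2 (zz n) * (1 + e).
Proof.
  intro Hn; assert (Hz := zz_large n Hn); assert (HPI := PI_bounds).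
  assert (HA := proj1 (cA_bounds D HD)); fold A in HA.
  set (X := sqrt (zz n)).
  assert (HX2 : X ^ 2 = zz n) by (cbn; rewrite Rmult_1_r; apply sqrt_sqrt; lra).
  assert (HX : 87 <= X).
  { unfold X; rewrite <- (sqrt_pow2 87) by lra; now apply sqrt_le_1_alt. }
  assert (H := coef_estimate D HD c c_0 c_S a c_a n X HX HX2); fold A in H.
  assert (HK : 0 < KB 2 (zz n)) by (apply KB_pos; lra).
  assert (HG := KB_growth (zz n) ltac:(lra)); fold X in HG.
  rewrite HX2 in H.
  exists (a n / (kap * KB 2 (zz n)) - 1); split.
  - eapply Rle_trans; [|apply (error_decay X A HX); lra].
    replace (a n / (kap * KB 2 (zz n)) - 1) with ((2 * PI * a n - A ^ 2 * KB 2 (zz n)) / (A ^ 2 * KB 2 (zz n)))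
      by (unfold kap; field; repeat split; lra).
    unfold Rdiv at 1; rewrite Rabs_mult.
    assert (HA2 : 0 < A ^ 2) by (apply pow_lt; lra).
    rewrite (Rabs_pos_eq (/ _)) by (left; apply Rinv_0_lt_compat, Rmult_lt_0_compat; lra).
    assert (HX3 : 0 < X ^ 3) by (apply pow_lt; lra).
    assert (HE := exp_pos (2 * X - 2)).
    apply Rle_trans with (3 * (A / X) * exp (153 / 100 * X) * / (A ^ 2 * (exp (2 * X - 2) / (2 * X ^ 3)))).
    + apply Rmult_le_compat; [apply Rabs_pos| |exact H|].
      * left; apply Rinv_0_lt_compat, Rmult_lt_0_compat; lra.
      * apply Rinv_le_contravar; [apply Rmult_lt_0_compat; [lra|apply Rdiv_lt_0_compat; lra]|].
        apply Rmult_le_compat_l; lra.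
    + replace (exp (- (47 / 100 * X))) with (exp (153 / 100 * X) * / exp (2 * X - 2) * / exp 2).
      * right; field; repeat split; try lra; apply Rgt_not_eq, exp_pos.
      * rewrite <- !exp_Ropp, <- !exp_plus; f_equal; field.
  - field; split; [lra|unfold kap; apply Rgt_not_eq, Rdiv_lt_0_compat; [apply pow_lt; lra|lra]].
Qed.

Theorem det_pos_large (n : nat) : (2000 <= n)%nat ->
  0 < det3 (a n) (a (n + 1)%nat) (a (n + 2)%nat) (a (n + 3)%nat) (a (n + 4)%nat).
Proof.
  intro Hn; assert (HPI := PI_bounds).
  assert (HA := proj1 (cA_bounds D HD)); fold A in HA.
  assert (Hk : 0 < kap) by (unfold kap; apply Rdiv_lt_0_compat; [apply pow_lt; lra|lra]).
  assert (Hz : forall i, zz (n + i) = zz n + INR i * A).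
  { intro i; unfold zz; rewrite plus_INR; ring. }
  assert (Hz0 := zz_large n Hn).
  set (z := zz n + 2 * A).
  assert (Z0 : zz n = z - 2 * A) by (unfold z; ring).
  assert (Z1 : zz (n + 1) = z - A) by (rewrite Hz; unfold z; cbn; ring).
  assert (Z2 : zz (n + 2) = z) by (rewrite Hz; unfold z; cbn; ring).
  assert (Z3 : zz (n + 3) = z + A) by (rewrite Hz; unfold z; cbn; ring).
  assert (Z4 : zz (n + 4) = z + 2 * A) by (rewrite Hz; unfold z; cbn; ring).
  set (X0 := sqrt (zz n)).
  assert (HX0 : X0 ^ 2 = zz n) by (cbn; rewrite Rmult_1_r; apply sqrt_sqrt; lra).
  assert (HX0' : 87 <= X0) by (unfold X0; rewrite <- (sqrt_pow2 87) by lra; now apply sqrt_le_1_alt).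
  set (Yb := sqrt (z + 2 * A)).
  assert (HYb : Yb ^ 2 = z + 2 * A) by (cbn; rewrite Rmult_1_r; apply sqrt_sqrt; unfold z; lra).
  assert (HYbX : X0 <= Yb) by (apply sqrt_le_1_alt; unfold z; lra).
  set (Y := sqrt (z + A)).
  assert (HY : Y ^ 2 = z + A) by (cbn; rewrite Rmult_1_r; apply sqrt_sqrt; unfold z; lra).
  assert (HYX : X0 <= Y) by (apply sqrt_le_1_alt; unfold z; lra).
  assert (HYY : Y <= Yb) by (apply sqrt_le_1_alt; unfold z; lra).
  set (eps := 277 / 100 / X0 ^ 6).
  assert (HX6 : 0 < X0 ^ 6) by (apply pow_lt; lra).
  assert (Heps : 0 < eps) by (apply Rdiv_lt_0_compat; lra).
  assert (HE : forall i, exists e, Rabs e <= eps /\ a (n + i)%nat = kap * KB 2 (zz (n + i)) * (1 + e)).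
  { intro i; destruct (relative_error (n + i) ltac:(lia)) as [e [H1 H2]]; exists e; split; [|exact H2].
    eapply Rle_trans; [exact H1|]; unfold eps; apply Rmult_le_compat_l; [lra|].
    apply Rinv_le_contravar; [exact HX6|apply pow_incr; split; [lra|]].
    unfold X0; apply sqrt_le_1_alt; rewrite Hz; generalize (pos_INR i); nra. }
  destruct (HE 0%nat) as [e0 [B0 E0]]; rewrite Nat.add_0_r, Z0 in E0.
  destruct (HE 1%nat) as [e1 [B1 E1]]; rewrite Z1 in E1.
  destruct (HE 2%nat) as [e2 [B2 E2]]; rewrite Z2 in E2.
  destruct (HE 3%nat) as [e3 [B3 E3]]; rewrite Z3 in E3.
  destruct (HE 4%nat) as [e4 [B4 E4]]; rewrite Z4 in E4.
  set (M := fun u => KB 2 u) in *.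
  assert (HzA : 2 * A < z) by (unfold z; lra).
  (* [q u] is the ratio of [M (u - A) * M (u + A)] to [M u ^ 2], so the minors of main terms are
     [kap ^ 2 * M u ^ 2 * (1 - q u)]. *)
  set (p := pK A); set (q := fun u => exp (- p u)).
  assert (HM : forall u, A < u -> M (u - A) * M (u + A) = M u ^ 2 * q u).
  { intros u Hu; unfold M, q, p, pK, sdiff, LK.
    rewrite <- (exp_ln (KB 2 (u - A))) at 1 by (apply KB_pos; lra).
    rewrite <- (exp_ln (KB 2 (u + A))) at 1 by (apply KB_pos; lra).
    rewrite <- (exp_ln (KB 2 u)) at 1 by (apply KB_pos; lra).
    rewrite exp_pow, <- !exp_plus; f_equal; cbn; ring. }
  set (P0 := A ^ 2 * (471 / 1000) / Yb ^ 3).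
  assert (HYb3 : 87 ^ 3 <= Yb ^ 3) by (apply pow_incr; lra).
  assert (HA2 : 0 < A ^ 2 <= 16) by (split; [apply pow_lt; lra|nra]).
  assert (HP0 : 0 < P0 <= 1 / 10000).
  { unfold P0; split; [apply Rdiv_lt_0_compat; lra|].
    apply Rmult_le_reg_r with (Yb ^ 3); [lra|].
    unfold Rdiv; rewrite Rmult_assoc, Rinv_l, Rmult_1_r by lra; lra. }
  assert (Hp : forall u, A < u -> u <= z + A -> P0 <= p u).
  { intros u Hu Hu'; apply (pK_lower_Y A ltac:(lra) u Yb); lra. }
  assert (Hq : forall u, A < u -> u <= z + A -> 0 < q u < 1 /\ 9 / 10 * P0 <= 1 - q u).
  { intros u Hu Hu'; assert (H := Hp u Hu Hu').
    assert (Hq1 : q u <= / (1 + P0)).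
    { unfold q; rewrite exp_Ropp; apply Rinv_le_contravar; [lra|].
      generalize (exp_ineq1_le (p u)); lra. }
    assert (Hq2 : / (1 + P0) <= 1 - 9 / 10 * P0).
    { apply Rmult_le_reg_r with (1 + P0); [lra|]; rewrite Rinv_l by lra; nra. }
    split; [split; [apply exp_pos|]|]; lra. }
  (* Chosen so that [5 * eta] is the gap 4/5 A^2 / Y^3 of [gap_bound], with [Yb >= Y] in place of
     [Y]. *)
  set (eta := 16 / 100 * A ^ 2 / Yb ^ 3).
  assert (Heta : 0 < eta < 1 / 10).
  { unfold eta; split; [apply Rdiv_lt_0_compat; lra|].
    apply Rmult_lt_reg_r with (Yb ^ 3); [lra|].
    unfold Rdiv; rewrite Rmult_assoc, Rinv_l, Rmult_1_r by lra; lra. }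
  (* Here 0.067824 = 0.16 * 0.9 * 0.471. Passing from [Yb] to [X0] costs 1.007, as 4 A is at most
     0.21 percent of [zz n], and 215 * 0.067824 still exceeds 1.007 * 5 * 2.77. *)
  assert (Heps2 : 5 * eps <= eta * (9 / 10 * P0)).
  { unfold eps, eta, P0.
    replace (16 / 100 * A ^ 2 / Yb ^ 3 * (9 / 10 * (A ^ 2 * (471 / 1000) / Yb ^ 3)))
      with (A ^ 4 * (67824 / 1000000) / Yb ^ 6) by (field; lra).
    assert (HA4 : 215 <= A ^ 4).
    { replace (A ^ 4) with (A ^ 2 * A ^ 2) by ring; assert (14.6689 <= A ^ 2) by nra; nra. }
    assert (HYX6 : Yb ^ 6 <= X0 ^ 6 * (1007 / 1000)).
    { replace (Yb ^ 6) with ((Yb ^ 2) ^ 3) by ring; replace (X0 ^ 6) with ((X0 ^ 2) ^ 3) by ring.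
      rewrite HYb, HX0.
      apply Rle_trans with ((zz n * (1 + 21 / 10000)) ^ 3).
      - apply pow_incr; unfold z; nra.
      - rewrite Rpow_mult_distr; apply Rmult_le_compat_l; [apply pow_le; lra|lra]. }
    assert (HYb6 : 0 < Yb ^ 6) by (apply pow_lt; lra).
    apply Rmult_le_reg_r with (X0 ^ 6); [exact HX6|].
    replace (5 * (277 / 100 / X0 ^ 6) * X0 ^ 6) with (1385 / 100) by (field; lra).
    apply Rmult_le_reg_r with (Yb ^ 6); [exact HYb6|].
    replace (A ^ 4 * (67824 / 1000000) / Yb ^ 6 * X0 ^ 6 * Yb ^ 6) with (A ^ 4 * (67824 / 1000000) * X0 ^ 6) by (field; lra).
    assert (215 * X0 ^ 6 <= A ^ 4 * X0 ^ 6) by (apply Rmult_le_compat_r; lra).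
    lra. }
  assert (Hepshalf : 0 <= eps <= 1 / 2).
  { split; [lra|]; assert (eta * (9 / 10 * P0) <= 1) by nra; lra. }
  destruct (Hq (z - A) ltac:(lra) ltac:(lra)) as [Q1 R1].
  destruct (Hq z ltac:(lra) ltac:(lra)) as [Q2 R2].
  destruct (Hq (z + A) ltac:(lra) ltac:(lra)) as [Q3 R3].
  assert (Hle : forall w, 9 / 10 * P0 <= w -> 5 * eps <= eta * w).
  { intros w Hw; eapply Rle_trans; [exact Heps2|apply Rmult_le_compat_l; lra]. }
  destruct (perturbed_square kap (M (z - A)) _ eps eta e0 e1 e2 Q1 Hepshalf (Hle _ R1) B0 B1 B2) as [d1 [F1 G1]].
  destruct (perturbed_square kap (M z) _ eps eta e1 e2 e3 Q2 Hepshalf (Hle _ R2) B1 B2 B3) as [d2 [F2 G2]].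
  destruct (perturbed_square kap (M (z + A)) _ eps eta e2 e3 e4 Q3 Hepshalf (Hle _ R3) B2 B3 B4) as [d3 [F3 G3]].
  assert (HMp : forall u, 0 <= u -> 0 < M u) by (intros u Hu; now apply KB_pos).
  assert (M1 := HM (z - A) ltac:(lra)); replace (z - A - A) with (z - 2 * A) in M1 by ring;
    replace (z - A + A) with z in M1 by ring.
  assert (M2 := HM z ltac:(lra)).
  assert (M3 := HM (z + A) ltac:(lra)); replace (z + A - A) with z in M3 by ring;
    replace (z + A + A) with (z + 2 * A) in M3 by ring.
  assert (Hgap : (1 + 5 * eta) * (q z ^ 2 * ((1 - q (z - A)) * (1 - q (z + A)))) <= (1 - q z) ^ 2).
  { assert (Hg := gap_bound A ltac:(lra) z Y ltac:(lra) ltac:(lra) ltac:(lra)); fold p in Hg.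
    assert (HY3 : 0 < Y ^ 3) by (apply pow_lt; lra).
    assert (Hg5 : 5 * eta <= 2 * p z - sdiff (hK A) A z).
    { eapply Rle_trans; [|exact Hg]; unfold eta.
      replace (5 * (16 / 100 * A ^ 2 / Yb ^ 3)) with (A ^ 2 * (4 / 5) * / Yb ^ 3) by (field; lra).
      apply Rmult_le_compat_l; [lra|]; apply Rinv_le_contravar; [exact HY3|apply pow_incr; lra]. }
    apply Rle_trans with (exp (2 * p z - sdiff (hK A) A z) * (q z ^ 2 * ((1 - q (z - A)) * (1 - q (z + A))))).
    - apply Rmult_le_compat_r.
      + apply Rmult_le_pos; [apply pow2_ge_0|apply Rmult_le_pos; lra].
      + generalize (exp_ineq1_le (2 * p z - sdiff (hK A) A z)); lra.
    (* The exponential of the gap is exactly the quotient of (1 - q z)^2 by q(z)^2 (1 - q (z - A))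
       (1 - q (z + A)). *)
    - right; unfold sdiff, hK; fold p; fold (q (z - A)) (q (z + A)) (q z).
      rewrite <- (exp_ln (1 - q (z - A))) at 2 by lra.
      rewrite <- (exp_ln (1 - q (z + A))) at 2 by lra.
      rewrite <- (exp_ln (1 - q z)) at 2 by lra.
      unfold q at 4; rewrite !exp_pow, <- !exp_plus; f_equal; cbn [INR]; ring. }
  assert (Hpos := det_perturbation kap (M (z - A)) (M z) (M (z + A)) (q (z - A)) (q z) (q (z + A)) eta d1 d2 d3
    Hk (HMp (z - A) ltac:(lra)) (HMp z ltac:(lra)) (HMp (z + A) ltac:(lra)) Q1 Q2 Q3 M2 Heta Hgap F1 F2 F3).
  assert (Ha2 : 0 < a (n + 2)%nat).
  { rewrite E2; apply Rabs_le_between in B2.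
    apply Rmult_lt_0_compat; [apply Rmult_lt_0_compat; [exact Hk|apply HMp; lra]|lra]. }
  apply Rmult_lt_reg_l with (a (n + 2)%nat); [exact Ha2|].
  rewrite Rmult_0_r, det3_condensation.
  replace (a (n + 1)%nat ^ 2 - a n * a (n + 2)%nat)
    with (kap ^ 2 * M (z - A) ^ 2 * (1 - q (z - A)) * (1 + d1)).
  2:{ rewrite <- G1, E0, E1, E2.
      replace (kap ^ 2 * M (z - A) ^ 2 * q (z - A) * ((1 + e0) * (1 + e2)))
        with (kap ^ 2 * (M (z - A) ^ 2 * q (z - A)) * ((1 + e0) * (1 + e2))) by ring.
      rewrite <- M1; ring. }
  replace (a (n + 2)%nat ^ 2 - a (n + 1)%nat * a (n + 3)%nat)
    with (kap ^ 2 * M z ^ 2 * (1 - q z) * (1 + d2)).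
  2:{ rewrite <- G2, E1, E2, E3.
      replace (kap ^ 2 * M z ^ 2 * q z * ((1 + e1) * (1 + e3)))
        with (kap ^ 2 * (M z ^ 2 * q z) * ((1 + e1) * (1 + e3))) by ring.
      rewrite <- M2; ring. }
  replace (a (n + 3)%nat ^ 2 - a (n + 2)%nat * a (n + 4)%nat)
    with (kap ^ 2 * M (z + A) ^ 2 * (1 - q (z + A)) * (1 + d3)).
  2:{ rewrite <- G3, E2, E3, E4.
      replace (kap ^ 2 * M (z + A) ^ 2 * q (z + A) * ((1 + e2) * (1 + e4)))
        with (kap ^ 2 * (M (z + A) ^ 2 * q (z + A)) * ((1 + e2) * (1 + e4))) by ring.
      rewrite <- M3; ring. }
  exact Hpos.
Qed.

End Large.

(** * A rounded integer test for the determinant *)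

Open Scope Z_scope.

Definition zdet3 (a0 a1 a2 a3 a4 : Z) : Z :=
  a2 * a2 * a2 - a1 * a2 * a3 - a1 * a2 * a3 + a1 * a1 * a4 + a0 * a3 * a3 - a0 * a2 * a4.

Lemma IZR_zdet3 (a0 a1 a2 a3 a4 : Z) :
  IZR (zdet3 a0 a1 a2 a3 a4) = det3 (IZR a0) (IZR a1) (IZR a2) (IZR a3) (IZR a4).
Proof. unfold zdet3, det3; rewrite !minus_IZR, !plus_IZR, !minus_IZR, !mult_IZR; ring. Qed.

Definition zfloor (t x : Z) : Z := Z.shiftr x t.
Definition zceil (t x : Z) : Z := - Z.shiftr (- x) t.

Lemma zfloor_le (t x : Z) : 0 <= t -> zfloor t x * 2 ^ t <= x.
Proof.
  intro Ht; unfold zfloor; rewrite Z.shiftr_div_pow2 by exact Ht.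
  rewrite Z.mul_comm; apply Z.mul_div_le, Z.pow_pos_nonneg; lia.
Qed.

Lemma zceil_ge (t x : Z) : 0 <= t -> x <= zceil t x * 2 ^ t.
Proof. intro Ht; assert (H := zfloor_le t (- x) Ht); unfold zceil, zfloor in *; lia. Qed.

Lemma zfloor_nonneg (t x : Z) : 0 <= x -> 0 <= zfloor t x.
Proof. intro; now apply Z.shiftr_nonneg. Qed.

(** Interval arithmetic for y^2 - x z: the two bounds are in units of 2^(u + 2t). *)
Definition minor_bounds (t u x y z : Z) : Z * Z :=
  (zfloor u (zfloor t y * zfloor t y - zceil t x * zceil t z),
   zceil u (zceil t y * zceil t y - zfloor t x * zfloor t z)).

Lemma minor_bounds_correct (t u x y z : Z) : 0 <= t -> 0 <= u -> 0 <= x -> 0 <= y -> 0 <= z ->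
  let s := 2 ^ u * (2 ^ t * 2 ^ t) in
  fst (minor_bounds t u x y z) * s <= y * y - x * z <= snd (minor_bounds t u x y z) * s.
Proof.
  intros Ht Hu Hx Hy Hz s; cbn [fst snd minor_bounds].
  assert (Px := zfloor_nonneg t x Hx); assert (Py := zfloor_nonneg t y Hy); assert (Pz := zfloor_nonneg t z Hz).
  assert (Lx := zfloor_le t x Ht); assert (Ly := zfloor_le t y Ht); assert (Lz := zfloor_le t z Ht).
  assert (Ux := zceil_ge t x Ht); assert (Uy := zceil_ge t y Ht); assert (Uz := zceil_ge t z Ht).
  assert (L := zfloor_le u (zfloor t y * zfloor t y - zceil t x * zceil t z) Hu).
  assert (U := zceil_ge u (zceil t y * zceil t y - zfloor t x * zfloor t z) Hu).
  assert (HT : 0 < 2 ^ t) by (apply Z.pow_pos_nonneg; lia).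
  subst s; set (T := 2 ^ t) in *; rewrite !Z.mul_assoc.
  assert (Y1 : (zfloor t y * T) * (zfloor t y * T) <= y * y) by (apply Z.mul_le_mono_nonneg; nia).
  assert (Y2 : y * y <= (zceil t y * T) * (zceil t y * T)) by (apply Z.mul_le_mono_nonneg; nia).
  assert (X1 : (zfloor t x * T) * (zfloor t z * T) <= x * z) by (apply Z.mul_le_mono_nonneg; nia).
  assert (X2 : x * z <= (zceil t x * T) * (zceil t z * T)) by (apply Z.mul_le_mono_nonneg; nia).
  assert (HTT : 0 <= T * T) by nia.
  apply (Z.mul_le_mono_nonneg_r _ _ (T * T) HTT) in L; apply (Z.mul_le_mono_nonneg_r _ _ (T * T) HTT) in U.
  split; lia.
Qed.

(** The nonnegative lower bounds make multiplication of the intervals monotone; the strict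
    comparison is then the condensed form of the determinant inequality. *)
Definition minors_ok (p q r : Z * Z) : bool :=
  (0 <=? fst p) && (0 <=? fst q) && (0 <=? fst r) && (snd p * snd r <? fst q * fst q).

(* Dropping [t] bits of the entries and [u] bits of the minors keeps the
   verified computation short. *)
Lemma zdet3_pos (t u a0 a1 a2 a3 a4 : Z) : 0 <= t -> 0 <= u ->
  0 <= a0 -> 0 <= a1 -> 0 <= a2 -> 0 <= a3 -> 0 <= a4 ->
  minors_ok (minor_bounds t u a0 a1 a2) (minor_bounds t u a1 a2 a3) (minor_bounds t u a2 a3 a4) = true ->
  0 < zdet3 a0 a1 a2 a3 a4.
Proof.
  intros Ht Hu H0 H1 H2 H3 H4 H.
  assert (D1 := minor_bounds_correct t u a0 a1 a2 Ht Hu H0 H1 H2).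
  assert (D2 := minor_bounds_correct t u a1 a2 a3 Ht Hu H1 H2 H3).
  assert (D3 := minor_bounds_correct t u a2 a3 a4 Ht Hu H2 H3 H4).
  cbv zeta in D1, D2, D3.
  assert (Hs : 0 < 2 ^ u * (2 ^ t * 2 ^ t)) by (assert (0 < 2 ^ u) by (apply Z.pow_pos_nonneg; lia);
    assert (0 < 2 ^ t) by (apply Z.pow_pos_nonneg; lia); nia).
  set (s := 2 ^ u * (2 ^ t * 2 ^ t)) in *.
  unfold minors_ok in H; rewrite !Bool.andb_true_iff, !Z.leb_le, Z.ltb_lt in H.
  destruct H as [[[P1 P2] P3] Q].
  set (p := minor_bounds t u a0 a1 a2) in *; set (q := minor_bounds t u a1 a2 a3) in *;
    set (r := minor_bounds t u a2 a3 a4) in *.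
  assert (E1 : (a1 * a1 - a0 * a2) * (a3 * a3 - a2 * a4) <= (snd p * s) * (snd r * s))
    by (apply Z.mul_le_mono_nonneg; nia).
  assert (E2 : (fst q * s) * (fst q * s) <= (a2 * a2 - a1 * a3) * (a2 * a2 - a1 * a3))
    by (apply Z.mul_le_mono_nonneg; nia).
  assert (E3 : (snd p * s) * (snd r * s) < (fst q * s) * (fst q * s)) by nia.
  assert (E4 : 0 < a2 * zdet3 a0 a1 a2 a3 a4).
  { replace (a2 * zdet3 a0 a1 a2 a3 a4) with ((a2 * a2 - a1 * a3) * (a2 * a2 - a1 * a3)
      - (a1 * a1 - a0 * a2) * (a3 * a3 - a2 * a4)) by (unfold zdet3; ring); lia. }
  nia.
Qed.

End Analytic.

Import BinInt Reals FunctionalExtensionality Analytic.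
Require Import Defs.
From mathcomp Require Import all_boot all_order all_algebra.
From mathcomp Require Import ssrZ zify ring.

Set Implicit Arguments.
Unset Strict Implicit.
Unset Printing Implicit Defensive.

Import Order.TTheory GRing.Theory Num.Theory.
Local Open Scope ring_scope.

(** * The algebra of the generating function *)

Definition trunc (n : nat) (f : fps) : {poly int} := \poly_(i < n.+1) f i.

Lemma coef_trunc n f i : (i <= n)%N -> (trunc n f)`_i = f i.
Proof. by move=> le_in; rewrite coef_poly ltnS le_in. Qed.

(** One coefficient of a product sees only truncations, so the laws of [fps_mul] are inherited from
    polynomials. *)
Lemma fps_mul_coef n f g (p q : {poly int}) :
  (forall i, (i <= n)%N -> p`_i = f i) -> (forall i, (i <= n)%N -> q`_i = g i) ->
  fps_mul f g n = (p * q)`_n.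
Proof.
move=> pf qg; rewrite coefM; apply: eq_bigr => i _.
by rewrite pf ?qg ?leq_subr // -ltnS.
Qed.

Lemma fps_mulC : commutative fps_mul.
Proof.
move=> f g; apply: functional_extensionality => n.
have cf := @coef_trunc n f; have cg := @coef_trunc n g.
by rewrite (fps_mul_coef cf cg) mulrC -(fps_mul_coef cg cf).
Qed.

Lemma fps_mulA : associative fps_mul.
Proof.
move=> f g h; apply: functional_extensionality => n.
have cf := @coef_trunc n f; have cg := @coef_trunc n g; have ch := @coef_trunc n h.
have cM f' g' i : (i <= n)%N -> (trunc n f' * trunc n g')`_i = fps_mul f' g' i.
  move=> le_in; apply/esym/fps_mul_coef => j le_ji; apply: coef_trunc;
  exact: leq_trans le_ji le_in.
by rewrite (fps_mul_coef cf (cM g h)) mulrA -(fps_mul_coef (cM f g) ch).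
Qed.

Lemma fps_mul1 : left_id fps_one fps_mul.
Proof.
move=> f; apply: functional_extensionality => n.
rewrite /fps_mul big_ord_recl big1 ?addr0 /= => [|i _]; last by rewrite mul0r.
by rewrite mul1r subn0.
Qed.

(** Makes the big operator theory available, in particular [big_split], which separates the factors
    of the generating function. *)
HB.instance Definition _ :=
  Monoid.isComLaw.Build fps fps_one fps_mul fps_mulA fps_mulC fps_mul1.

Lemma fps_prodE F N : fps_prod F N = \big[fps_mul/fps_one]_(1 <= m < N.+1) F m.
Proof. by elim: N => [|N IHN]; [rewrite big_geq | rewrite big_nat_recr //= IHN]. Qed.

Lemma fps_prod_mul F G N :
  fps_prod (fun m => fps_mul (F m) (G m)) N = fps_mul (fps_prod F N) (fps_prod G N).
Proof. by rewrite !fps_prodE big_split. Qed.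

Lemma eq_fps_prod F G N : (forall m, (0 < m)%N -> F m = G m) -> fps_prod F N = fps_prod G N.
Proof. by move=> FG; rewrite !fps_prodE; apply: eq_big_nat => m /andP[/FG]. Qed.

Definition euler (d N : nat) : fps := fps_prod (fun m => fps_1subXn (d * m)) N.
Definition euler_inv (d N : nat) : fps := fps_prod (fun m => fps_geom (d * m)) N.

Lemma euler_invK d N : (0 < d)%N -> fps_mul (euler d N) (euler_inv d N) = fps_one.
Proof.
move=> d_gt0; rewrite -fps_prod_mul (@eq_fps_prod _ (fun=> fps_one)).
  by elim: N => //= N ->; rewrite fps_mul1.
by move=> m m_gt0; apply: functional_extensionality => n; apply: fps_geomK; rewrite muln_gt0 d_gt0.
Qed.

Lemma fps_mul_cancel e g b r : fps_mul e g = fps_one -> fps_mul e (fps_mul b (fps_mul g r)) = fps_mul b r.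
Proof. by move=> eg; rewrite fps_mulA (fps_mulC e) -fps_mulA (fps_mulA e) eg fps_mul1. Qed.

Definition bd_partial (k N : nat) : fps := fps_prod (broken_diamond_factor k) N.

(** Clearing denominators leaves only Euler products, which are sparse; the coefficients can then be
    found by one product and four divisions. *)
Lemma bd_partial_euler k N :
  fps_mul (euler 1 N) (fps_mul (euler 1 N) (fps_mul (euler 1 N)
    (fps_mul (euler (4 * k + 2) N) (bd_partial k N))))
  = fps_mul (euler 2 N) (euler (2 * k + 1) N).
Proof.
have -> : bd_partial k N = fps_mul (fps_mul (euler 2 N) (euler (2 * k + 1) N))
    (fps_mul (euler_inv (4 * k + 2) N)
       (fps_mul (euler_inv 1 N) (fps_mul (euler_inv 1 N) (fps_mul (euler_inv 1 N) fps_one)))).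
  rewrite /bd_partial /broken_diamond_factor !fps_prod_mul (fps_mulC _ fps_one) fps_mul1.
  rewrite (fps_mulC _ (fps_prod (fun m => fps_geom ((4 * k + 2) * m)) N)).
  by rewrite /euler_inv !(@eq_fps_prod (fun m => fps_geom (1 * m)) fps_geom) // => m _; rewrite mul1n.
have K1 := @euler_invK 1 N isT.
have K2 : fps_mul (euler (4 * k + 2) N) (euler_inv (4 * k + 2) N) = fps_one.
  by apply: euler_invK; rewrite addn2.
by rewrite (fps_mul_cancel _ _ K2) !(fps_mul_cancel _ _ K1) fps_mulC fps_mul1.
Qed.

Lemma fps_mul_1subXn f m n :
  fps_mul f (fps_1subXn m) n = f n - (if (m <= n)%N then f (n - m)%N else 0).
Proof.
rewrite fps_mulC /fps_mul /fps_1subXn.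
under eq_bigr => i _ do rewrite mulrBl.
rewrite sumrB big_ord_recl big1 ?addr0 => [|i _]; last by rewrite mul0r.
rewrite eqxx mul1r subn0; congr (_ - _).
case: leqP => [le_mn|lt_nm].
  have lt_mn1 : (m < n.+1)%N by [].
  rewrite (bigD1 (Ordinal lt_mn1)) //= eqxx mul1r big1 ?addr0 // => i ne_im.
  by rewrite -(inj_eq val_inj) /= in ne_im; rewrite (negPf ne_im) mul0r.
rewrite big1 // => i _; rewrite ltn_eqF ?mul0r //.
exact: leq_ltn_trans (ltn_ord i : (i <= n)%N) lt_nm.
Qed.

Lemma bd_partial_S k N : bd_partial k N.+1 = fps_mul (bd_partial k N) (broken_diamond_factor k N.+1).
Proof. by []. Qed.

(** * Coefficients below 2000 *)

Definition approx (N : nat) (s : seq Z) (f : fps) :=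
  size s = N /\ forall n, (n < N)%N -> nth Z0 s n = Z_of_int (f n).

(** The generalized pentagonal numbers s (3s - 1) / 2 and s (3s + 1) / 2, written so that the lower
    bound s^2 is visible. *)
Definition pent_exp (b : bool) (s : nat) : nat := s * s + (s * (if b then s.+1 else s.-1))./2.

(* Shanks' telescoping proof of the pentagonal number theorem: [pent_sum n] is
   the product [T n 0] plus terms divisible by [x^(n+1)]. *)
Section Pentagonal.
Variables (R : comNzRingType) (x : R).

Definition pent_sum n : R :=
  1 + \sum_(s < n) (-1) ^+ s.+1 * (x ^+ pent_exp false s.+1 + x ^+ pent_exp true s.+1).

Let T n s : R := \prod_(s <= r < n) (1 - x ^+ r.+1).
Let A n : R := \sum_(s < n.+1) (-1) ^+ s * T n s * x ^+ (s * n + 'C(s.+1, 2)).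

Lemma pent_sumE n : A n = pent_sum n.
Proof.
elim: n => [|n IHn].
  by rewrite /A /pent_sum big_ord0 addr0 big_ord1 /T big_geq // !mul1r.
rewrite /pent_sum big_ord_recr /= addrA -/(pent_sum n) -IHn.
rewrite {1}/A big_ord_recr /= {2}/T big_geq // mulr1.
(* Both the last factor of [T n.+1 s] and the new power x^s are expanded, with x^s written as 1 - (1
   - x^s): the first part is the old summand of [A n]. *)
have E s : (s <= n)%N -> (-1) ^+ s * T n.+1 s * x ^+ (s * n.+1 + 'C(s.+1, 2))
  = (-1) ^+ s * T n s * x ^+ (s * n + 'C(s.+1, 2))
    - ((-1) ^+ s * T n s * (1 - x ^+ s) * x ^+ (s * n + 'C(s.+1, 2))
      + (-1) ^+ s * T n s * x ^+ (s.+1 * n.+1 + 'C(s.+1, 2))).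
  move=> le_sn; rewrite {1}/T big_nat_recr //= -/(T n s).
  rewrite mulnS [(s.+1 * _)%N]mulSn !exprD mulnS !exprD; ring.
under eq_bigr => s _ do rewrite E -1?ltnS //.
rewrite sumrB -/(A n) big_split /= big_ord_recl /= expr0 subrr mulr0 mul0r add0r.
rewrite [X in _ - (_ + X)]big_ord_recr /=.
(* (1 - x^(s+1)) [T n s.+1] is [T n s], so consecutive summands telescope. What survives is the last
   of them and the new top summand, the two pentagonal powers of index n + 1. *)
have F s : (s < n)%N ->
  (-1) ^+ bump 0 s * T n (bump 0 s) * (1 - x ^+ bump 0 s) * x ^+ (bump 0 s * n + 'C((bump 0 s).+1, 2))
  = - ((-1) ^+ s * T n s * x ^+ (s.+1 * n.+1 + 'C(s.+1, 2))).
  move=> lt_sn; rewrite /bump /= add1n [in RHS]/T big_ltn // -/(T n s.+1).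
  rewrite binS bin1 mulnS !exprD exprS [x ^+ s.+1]exprS; ring.
under eq_bigr => s _ do rewrite F //.
rewrite sumrN {1 3}/T big_geq // mulr1 addrA addNr add0r /pent_exp /=.
rewrite -addrA; congr (_ + _); rewrite exprS mulN1r !mulNr -mulNr.
have -> : (n.+1 * n.+1 + 'C(n.+1, 2) = n.+1 * n.+1 + (n.+1 * n)./2)%N by rewrite bin2.
have -> : (n.+1 * n.+1 + 'C(n.+2, 2) = n.+1 * n.+1 + (n.+1 * n.+2)./2)%N by rewrite bin2 mulnC.
ring.
Qed.

End Pentagonal.

(** * Executable arithmetic on lists of coefficients *)

Definition zone (N : nat) : seq Z := Zpos xH :: nseq N.-1 Z0.

Lemma approx_one N : (0 < N)%N -> approx N (zone N) fps_one.
Proof.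
case: N => // N _; split=> [|[|n] lt_nN] //=; first by rewrite size_nseq.
by rewrite nth_nseq if_same.
Qed.

(** The first branch skips the multiplication for zero entries, which are the majority in a
    pentagonal series. *)
Fixpoint zdot (e a : seq Z) : Z :=
  match e, a with
  | Z0 :: e, _ :: a => zdot e a
  | x :: e, y :: a => Z.add (Z.mul x y) (zdot e a)
  | _, _ => Z0
  end.

(** The quotient so far is kept in reverse, so that its [zdot] with the tail of the divisor is the
    convolution in a_n = b_n - sum of e_i a_(n-i) over i >= 1. *)
Fixpoint zdiv_rec (e b r : seq Z) : seq Z :=
  if b is x :: b then zdiv_rec e b (Z.sub x (zdot e r) :: r) else rev r.

Definition zdiv (e b : seq Z) : seq Z := zdiv_rec (behead e) b [::].

Lemma zdotE e (g : nat -> Z) n :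
  zdot e (rev (mkseq g n)) = \sum_(i < n) nth Z0 e i * g (n - i.+1)%N.
Proof.
elim: n e => [|n IHn] [|x e].
- by rewrite big_ord0.
- by rewrite big_ord0; case: x.
- by rewrite big1 // => i _; rewrite nth_nil mul0r.
rewrite mkseqS rev_rcons big_ord_recl /= subn1 /=.
under eq_bigr => i _ do rewrite subSS.
rewrite -IHn; case: x => [|p|p] //=; by rewrite mul0r add0r.
Qed.

(** The coefficients of the identity [fps_mul fe fa = fb] are solved one after another for [fa],
    with leading coefficient 1. The invariant is that after m steps the accumulator holds the first
    m coefficients in reverse. *)
Lemma approx_zdiv N e b fe fa fb : fe 0%N = 1 -> fps_mul fe fa = fb ->
  approx N e fe -> approx N b fb -> approx N (zdiv e b) fa.
Proof.
move=> fe0 Efb [sz_e e_fe] [sz_b b_fb].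
pose g n := Z_of_int (fa n).
suff H m : (m <= N)%N -> zdiv_rec (behead e) (drop m b) (rev (mkseq g m)) = mkseq g N.
  have := H 0%N isT; rewrite drop0 /zdiv => ->.
  by split=> [|n lt_nN]; rewrite ?size_mkseq // nth_mkseq.
move=> le_mN; rewrite -(subKn le_mN); elim: (N - m)%N (leq_subr m N) => [_|j IHj lt_jN].
  by rewrite subn0 drop_oversize ?sz_b //= revK.
have lt_N : (N - j.+1 < N)%N by rewrite ltn_subrL (leq_trans _ lt_jN).
rewrite (drop_nth Z0) ?sz_b //=.
have -> : (N - j.+1).+1 = (N - j)%N by rewrite subnSK.
rewrite -[RHS]IHj ?(ltnW lt_jN) //; congr zdiv_rec.
have -> : (N - j = (N - j.+1).+1)%N by rewrite subnSK.
move: (N - j.+1)%N lt_N => n lt_nN.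
rewrite mkseqS rev_rcons; congr cons.
rewrite zdotE b_fb // -Efb /fps_mul big_ord_recl fe0 mul1r subn0 raddfD /=.
rewrite raddf_sum /= /g.
have -> : \sum_(i < n) Z_of_int (fe (bump 0 i) * fa (n - bump 0 i)%N)
   = \sum_(i < n) nth Z0 (behead e) i * Z_of_int (fa (n - i.+1)%N).
  apply: eq_bigr => i _; rewrite rmorphM /= nth_behead e_fe //.
  exact: leq_ltn_trans (ltn_ord i) lt_nN.
have subE (y z : Z) : Z.sub y z = y - z by [].
by rewrite subE addrK.
Qed.


Lemma approx_eq N s f g : (forall n, (n < N)%N -> f n = g n) -> approx N s f -> approx N s g.
Proof. by move=> fg [sz_s s_f]; split=> // n lt_nN; rewrite s_f // fg. Qed.

Fixpoint addat (e : nat) (c : Z) (l : seq Z) : seq Z :=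
  match l, e with
  | [::], _ => [::]
  | x :: l, O => Z.add x c :: l
  | x :: l, e.+1 => x :: addat e c l
  end.

Lemma size_addat e c l : size (addat e c l) = size l.
Proof. by elim: l e => [|x l IHl] [|e] //=; rewrite IHl. Qed.

Lemma nth_addat e c l n : (n < size l)%N ->
  nth Z0 (addat e c l) n = nth Z0 l n + (if n == e then c else 0).
Proof.
elim: l e n => [|x l IHl] [|e] [|n] //= lt_n; rewrite ?addr0 //.
by rewrite IHl // eqSS.
Qed.

Lemma approx_addat N s (p : {poly int}) e c : approx N s (fun n => p`_n) ->
  approx N (addat e (Z_of_int c) s) (fun n => (p + c *: 'X^e)`_n).
Proof.
move=> [sz_s s_p]; split=> [|n lt_nN]; first by rewrite size_addat.
rewrite nth_addat ?sz_s // s_p // coefD coefZ coefXn raddfD /=.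
by case: eqP; rewrite ?mulr1 ?mulr0.
Qed.

(** An exponent beyond the end of the list is dropped by [addat], so truncation is automatic. *)
Fixpoint pent_list (d S : nat) (l : seq Z) : seq Z :=
  if S is S'.+1 then
    let c := if odd S then Zneg xH else Zpos xH in
    addat (d * pent_exp false S) c (addat (d * pent_exp true S) c (pent_list d S' l))
  else l.

(** [r] is the reversed prefix of the second factor and [s] the reversed prefix of the product. *)
Fixpoint zmul_rec (e b r s : seq Z) : seq Z :=
  if b is x :: b then zmul_rec e b (x :: r) (zdot e (x :: r) :: s) else rev s.

Definition zmul (e b : seq Z) : seq Z := zmul_rec e b [::] [::].

Lemma zdot_prefix (fe fb : fps) N e b n : approx N e fe -> approx N b fb -> (n < N)%N ->
  zdot e (rev (mkseq (fun i => nth Z0 b i) n.+1)) = Z_of_int (fps_mul fe fb n).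
Proof.
move=> [_ e_fe] [_ b_fb] lt_nN; rewrite zdotE /fps_mul raddf_sum /=.
apply: eq_bigr => i _; rewrite subSS rmorphM /= e_fe ?b_fb //.
  exact: leq_ltn_trans (leq_subr _ _) lt_nN.
exact: leq_trans (ltn_ord i) lt_nN.
Qed.

Lemma approx_zmul N e b fe fb : approx N e fe -> approx N b fb ->
  approx N (zmul e b) (fps_mul fe fb).
Proof.
move=> e_fe b_fb; have [sz_b _] := b_fb.
pose g n := Z_of_int (fps_mul fe fb n); pose nb n := nth Z0 b n.
suff H m : (m <= N)%N ->
    zmul_rec e (drop m b) (rev (mkseq nb m)) (rev (mkseq g m)) = mkseq g N.
  have := H 0%N isT; rewrite drop0 /zmul => ->.
  by split=> [|n lt_nN]; rewrite ?size_mkseq // nth_mkseq.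
move=> le_mN; rewrite -(subKn le_mN); elim: (N - m)%N (leq_subr m N) => [_|j IHj lt_jN].
  by rewrite subn0 drop_oversize ?sz_b //= revK.
have lt_N : (N - j.+1 < N)%N by rewrite ltn_subrL (leq_trans _ lt_jN).
rewrite (drop_nth Z0) ?sz_b //=.
have Ej : (N - j = (N - j.+1).+1)%N by rewrite subnSK.
rewrite -[RHS]IHj ?(ltnW lt_jN) // Ej.
move: (N - j.+1)%N lt_N => n lt_nN.
have Eg : zdot e (nth Z0 b n :: rev (mkseq nb n)) = g n.
  by have := zdot_prefix e_fe b_fb lt_nN; rewrite mkseqS rev_rcons.
by rewrite Eg -!rev_rcons -!mkseqS.
Qed.

Lemma euler_poly d N n : euler d N n = (\prod_(0 <= r < N) (1 - ('X^d) ^+ r.+1) : {poly int})`_n.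
Proof.
elim: N n => [|N IHN] n; first by rewrite big_geq // coef1.
rewrite big_nat_recr //= /euler /=; apply: fps_mul_coef => i _; first by rewrite -IHN.
by rewrite -exprM coefB coef1 coefXn.
Qed.

Lemma approx_pent_list d S N : (0 < N)%N ->
  approx N (pent_list d S (zone N)) (fun n => (pent_sum ('X^d : {poly int}) S)`_n).
Proof.
move=> N_gt0; elim: S => [|S IHS].
  rewrite /pent_sum big_ord0 addr0; apply: approx_eq (approx_one N_gt0) => n _.
  by rewrite coef1.
have -> : pent_sum ('X^d : {poly int}) S.+1 = pent_sum 'X^d S
    + (-1) ^+ S.+1 *: 'X^(d * pent_exp true S.+1) + (-1) ^+ S.+1 *: 'X^(d * pent_exp false S.+1).
  rewrite /pent_sum big_ord_recr /= !exprM -!mul_polyC rmorphXn rmorphN1 mulrDr.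
  by rewrite addrA -[RHS]addrA [X in _ = _ + X]addrC.
have Ec : (if odd S.+1 then Zneg xH else Zpos xH) = Z_of_int ((-1) ^+ S.+1).
  by rewrite -signr_odd; case: (odd _).
by rewrite [pent_list _ _ _]/= Ec; do 2!apply: approx_addat.
Qed.

(** All later pentagonal exponents are at least (S + 1)^2, hence beyond n. *)
Lemma pent_sum_lt d S M n : (0 < d)%N -> (S <= M)%N -> (n < S.+1 * S.+1)%N ->
  (pent_sum ('X^d : {poly int}) M)`_n = (pent_sum ('X^d : {poly int}) S)`_n.
Proof.
move=> d_gt0 le_SM lt_n; rewrite -(subnKC le_SM); elim: (M - S)%N => [|j IHj]; first by rewrite addn0.
rewrite addnS [in LHS]/pent_sum big_ord_recr /= addrA -/(pent_sum 'X^d (S + j)) coefD IHj -!exprM.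
have H b : (n < d * pent_exp b (S + j).+1)%N.
  apply: leq_trans (leq_pmull _ d_gt0); apply: leq_trans lt_n _.
  by apply: leq_trans (leq_addr _ _); apply: leq_mul; rewrite ltnS leq_addr.
by rewrite -signr_odd; case: odd; rewrite ?mulN1r ?mul1r ?coefN [('X^_ + 'X^_)`_n]coefD !coefXn !ltn_eqF ?H // ?oppr0 !addr0.
Qed.

(** In the finite identity of Shanks the summand s = 0 is the whole product, and those with s >= 1
    start at exponent N + 1 or higher. *)
Lemma euler_pent_sum d N n : (0 < d)%N -> (n <= N)%N ->
  euler d N n = (pent_sum ('X^d : {poly int}) N)`_n.
Proof.
move=> d_gt0 le_nN; rewrite euler_poly -pent_sumE big_ord_recl expr0 mul1r mul0n.
rewrite add0n mulr1 coefD [X in _ + X](_ : _ = 0) ?addr0 //.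
rewrite coef_sum big1 // => i _; rewrite -exprM coefMXn.
case: leqP => // le_n; exfalso; move: le_n; rewrite leqNgt => /negP; apply.
apply: leq_ltn_trans le_nN _; apply: leq_trans (leq_pmull _ d_gt0).
by rewrite lift0 mulSn -addnA -addn1 leq_add // binS bin1 addnA addnS.
Qed.

Lemma approx_euler d S N : (0 < d)%N -> (0 < N)%N -> (N <= S.+1 * S.+1)%N -> (S <= N)%N ->
  approx N (pent_list d S (zone N)) (euler d N).
Proof.
move=> d_gt0 N_gt0 le_NS le_SN; apply: approx_eq (approx_pent_list d S N_gt0) => n lt_nN.
by rewrite euler_pent_sum ?(ltnW lt_nN) // (pent_sum_lt _ le_SN) // (leq_trans lt_nN).
Qed.

Definition bd_list (k S N : nat) : seq Z :=
  let e d := pent_list d S (zone N) in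
  let e1 := e 1%N in
  zdiv (e (4 * k + 2)%N) (zdiv e1 (zdiv e1 (zdiv e1 (zmul (e 2) (e (2 * k + 1)%N))))).

Lemma approx_bd_list k S N : (0 < N)%N -> (N <= S.+1 * S.+1)%N -> (S <= N)%N ->
  approx N (bd_list k S N) (broken_diamond k).
Proof.
move=> N_gt0 le_NS le_SN.
have e1 d : (0 < d)%N -> approx N (pent_list d S (zone N)) (euler d N).
  by move=> d_gt0; apply: approx_euler.
have e0 d : (0 < d)%N -> euler d N 0%N = 1.
  move=> d_gt0; rewrite /euler; elim: N {N_gt0 le_NS le_SN e1} => //= M IHM.
  by rewrite fps_mul_1subXn leqn0 muln_eq0 (gtn_eqF d_gt0) subr0; exact: IHM.
have d2 : (0 < 4 * k + 2)%N by rewrite addn2.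
have Hbd : approx N (bd_list k S N) (bd_partial k N).
  apply: (approx_zdiv (e0 _ d2) (erefl _) (e1 _ d2)).
  do 3![apply: (approx_zdiv (e0 1%N isT) (erefl _) (e1 1%N isT))].
  by rewrite bd_partial_euler; apply: approx_zmul; apply: e1; rewrite ?addn1.
by apply: approx_eq Hbd => n lt_nN; apply: broken_diamond_partial_prod; apply: ltnW.
Qed.

(** B consecutive determinants need B + 4 entries and B + 2 minors; the minors are tabulated because
    each serves three determinants. *)
Definition check_block (t u : Z) (b B : nat) (l : seq Z) : bool :=
  let a := take (B + 4) (drop b l) in
  let D := mkseq (fun i => minor_bounds t u (nth Z0 a i) (nth Z0 a i.+1) (nth Z0 a i.+2)) (B + 2) in
  [&& Z.leb Z0 t, Z.leb Z0 u, all (Z.leb Z0) a &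
    all (fun i => minors_ok (nth (Z0, Z0) D i) (nth (Z0, Z0) D i.+1) (nth (Z0, Z0) D i.+2)) (iota 0 B)].

Lemma check_block_correct t u b B l n : check_block t u b B l -> (b <= n < b + B)%N ->
  Z.lt Z0 (zdet3 (nth Z0 l n) (nth Z0 l (n + 1)) (nth Z0 l (n + 2)) (nth Z0 l (n + 3)) (nth Z0 l (n + 4))).
Proof.
case/and4P => /Z.leb_le t0 /Z.leb_le u0 a0 ok /andP[le_bn lt_nB].
pose i := (n - b)%N; have lt_iB : (i < B)%N by rewrite ltn_subLR.
have En j : (n + j = b + (i + j))%N by rewrite addnA subnKC.
set a := take _ _ in a0 ok.
have Ea j : (j <= 4)%N -> nth Z0 l (n + j) = nth Z0 a (i + j).
  by move=> le_j4; rewrite En /a nth_take ?nth_drop // -addSn leq_add.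
have pos j : Z.le Z0 (nth Z0 a j).
  have [le_sj|lt_js] := leqP (size a) j; first by rewrite nth_default //; exact: Z.le_refl.
  by apply/Z.leb_le; apply: (allP a0); apply: mem_nth.
rewrite -[n in nth _ _ n]addn0 !Ea // addn0.
have /(allP ok) : i \in iota 0 B by rewrite mem_iota.
rewrite !nth_mkseq ?addn2 ?ltnS ?leqW ?(ltnW lt_iB) // => H.
rewrite ?(addn1, addn2, addn3, addn4).
exact: (zdet3_pos _ _ _ _ _ _ _ t0 u0 (pos _) (pos _) (pos _) (pos _) (pos _) H).
Qed.

(* Rounding to about 49 leading bits and then dropping 44 bits of the minors
   leaves enough precision on blocks of 120 indices; the first block is exact. *)
Definition bd_check (k : nat) : bool :=
  let l := bd_list k 44 2004 in
  check_block Z0 Z0 18 302 l &&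
  all (fun j => let b := (320 + 120 * j)%N in
         check_block (Z.sub (Z.log2 (nth Z0 l b)) (Zpos 48)) (Zpos 44) b 120 l) (iota 0 14).

Lemma bd_check1 : bd_check 1.
Proof. vm_cast_no_check (erefl true). Qed.

Lemma bd_check2 : bd_check 2.
Proof. vm_cast_no_check (erefl true). Qed.

Lemma zdet3_pos_small k n : bd_check k -> (18 <= n < 2000)%N ->
  Z.lt Z0 (zdet3 (Z_of_int (broken_diamond k n)) (Z_of_int (broken_diamond k (n + 1)))
    (Z_of_int (broken_diamond k (n + 2))) (Z_of_int (broken_diamond k (n + 3)))
    (Z_of_int (broken_diamond k (n + 4)))).
Proof.
case/andP => small /allP large /andP[le_n lt_n].
(* The largest index is 1999 + 4, and 44 pentagonal pairs suffice because 45^2 = 2025 >= 2004. *)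
have [_ E] : approx 2004 (bd_list k 44 2004) (broken_diamond k) by apply: approx_bd_list.
have lt_nj j : (j <= 4)%N -> (n + j < 2004)%N.
  by move=> le_j; have := leq_add lt_n le_j; rewrite addSn.
rewrite -!E ?lt_nj //; last by rewrite -(addn0 n) lt_nj.
(* The blocks tile the range: 18 + 302 = 320 and 320 + 14 * 120 = 2000. *)
have [lt_n320|le_320n] := ltnP n 320; first by apply: (check_block_correct small); rewrite le_n.
pose j := ((n - 320) %/ 120)%N.
have lt_j : (j < 14)%N by rewrite ltn_divLR // ltn_subLR.
apply: (check_block_correct (large j _)); first by rewrite mem_iota.
apply/andP; split; first by rewrite -leq_subRL // mulnC leq_divM.
by rewrite -addnA -mulnSr -ltn_subLR // mulnC -ltn_divLR.
Qed.

(** * Transfer between [int], [Z] and the reals, and the conclusion *)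

Definition int_R (x : int) : Rdefinitions.R := IZR (Z_of_int x).

Lemma leb_leq m n : Nat.leb m n = (m <= n)%N.
Proof. by elim: m n => [|m IHm] [|n] //=; rewrite IHm. Qed.

Lemma int_R_1subXn f m n :
  int_R (fps_mul f (fps_1subXn m) n) = Rminus (int_R (f n)) (shift m (fun i => int_R (f i)) n).
Proof.
rewrite fps_mul_1subXn /int_R raddfB /= minus_IZR /shift leb_leq; congr Rminus.
by case: ifP => // _; rewrite minusE.
Qed.

Lemma fps_mul_geomK f m : (0 < m)%N -> fps_mul (fps_mul f (fps_geom m)) (fps_1subXn m) = f.
Proof.
move=> m_gt0; rewrite -fps_mulA [X in fps_mul f X]fps_mulC.
have -> : fps_mul (fps_1subXn m) (fps_geom m) = fps_one.
  by apply: functional_extensionality => n; apply: fps_geomK.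
by rewrite fps_mulC fps_mul1.
Qed.

(** The witnesses are the partial products of the new factor in the order of [gen_step]; each
    division is verified by multiplying back with [fps_mul_geomK]. *)
Lemma gen_step_bd_partial k N :
  gen_step (2 * k + 1) N.+1 (fun n => int_R (bd_partial k N n)) (fun n => int_R (bd_partial k N.+1 n)).
Proof.
pose w1 := fps_mul (bd_partial k N) (fps_1subXn (2 * N.+1)).
pose w2 := fps_mul w1 (fps_1subXn ((2 * k + 1) * N.+1)).
pose w3 := fps_mul w2 (fps_geom N.+1); pose w4 := fps_mul w3 (fps_geom N.+1).
pose w5 := fps_mul w4 (fps_geom N.+1).
have Ew : bd_partial k N.+1 = fps_mul w5 (fps_geom ((4 * k + 2) * N.+1)).
  by rewrite bd_partial_S /broken_diamond_factor /w5 /w4 /w3 /w2 /w1 !fps_mulA.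
have e4 : (2 * (2 * k + 1) * N.+1 = (4 * k + 2) * N.+1)%N by rewrite mulnDr mulnA.
exists (fun n => int_R (w1 n)), (fun n => int_R (w2 n)), (fun n => int_R (w3 n)),
  (fun n => int_R (w4 n)), (fun n => int_R (w5 n)).
repeat split; move=> n; rewrite ?multE ?e4 -int_R_1subXn ?fps_mul_geomK //.
by rewrite Ew fps_mul_geomK // muln_gt0 addn2.
Qed.

Lemma zdet3_pos_large k n : k = 1%N \/ k = 2%N -> (2000 <= n)%N ->
  Z.lt Z0 (zdet3 (Z_of_int (broken_diamond k n)) (Z_of_int (broken_diamond k (n + 1)))
    (Z_of_int (broken_diamond k (n + 2))) (Z_of_int (broken_diamond k (n + 3)))
    (Z_of_int (broken_diamond k (n + 4)))).
Proof.
move=> hk /ssrnat.leP hn; apply: lt_IZR; rewrite IZR_zdet3.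
apply: (det_pos_large (2 * k + 1) _ (fun N n => int_R (bd_partial k N n)) _ _
  (fun n => int_R (broken_diamond k n)) _ n hn).
- by case: hk => ->; [left | right].
- by case.
- exact: gen_step_bd_partial.
- by move=> N m /ssrnat.leP le_mN; rewrite /bd_partial broken_diamond_partial_prod.
Qed.

Lemma det_broken_diamond k n :
  Z_of_int (\det (\matrix_(i < 3, j < 3) broken_diamond k (n + 2 + j - i)%N)) =
  zdet3 (Z_of_int (broken_diamond k n)) (Z_of_int (broken_diamond k (n + 1)))
    (Z_of_int (broken_diamond k (n + 2))) (Z_of_int (broken_diamond k (n + 3)))
    (Z_of_int (broken_diamond k (n + 4))).
Proof.
rewrite (expand_det_row _ ord0) !big_ord_recl big_ord0 /cofactor !(expand_det_row _ ord0).
rewrite !big_ord_recl !big_ord0 /cofactor !det_mx11 !mxE /=.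
have bumpE : (((bump 0 0 = 1%N) * (bump 0 1 = 2%N) * (bump 1 0 = 0%N) * (bump 1 1 = 2%N)
  * (bump 2 0 = 0%N) * (bump 2 1 = 1%N)))%type by [].
(* The natural subtraction is never truncated, because the row index is at most 2. *)
have idxE : (((n + 2 + 0 - 0)%N = (n + 2)%N) * ((n + 2 + 0 - 1)%N = (n + 1)%N) * ((n + 2 + 0 - 2)%N = (n + 0)%N)
  * ((n + 2 + 1 - 0)%N = (n + 3)%N) * ((n + 2 + 1 - 1)%N = (n + 2)%N) * ((n + 2 + 1 - 2)%N = (n + 1)%N)
  * ((n + 2 + 2 - 0)%N = (n + 4)%N) * ((n + 2 + 2 - 1)%N = (n + 3)%N) * ((n + 2 + 2 - 2)%N = (n + 2)%N))%type.
  by repeat split; lia.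
rewrite !bumpE !idxE !addn0.
have zdet3E (a b c d e : Z) : zdet3 a b c d e =
  c * c * c - b * c * d - b * c * d + b * b * e + a * d * d - a * c * e by [].
rewrite zdet3E !(rmorphD, rmorphM, rmorphXn, rmorphN1, rmorph0).
ring.
Qed.

Lemma Z_of_int_gt0 (x : int) : Z.lt Z0 (Z_of_int x) -> 0 < x.
Proof. by case: x => [[|n]|n] //= H; exfalso; lia. Qed.

Theorem theorem5p1 (k n : nat) (hk : k = 1%N \/ k = 2%N) (hn : (18 <= n)%N) :
  0 < \det (\matrix_(i < 3, j < 3) broken_diamond k (n + 2 + j - i)%N).
Proof.
apply: Z_of_int_gt0; rewrite det_broken_diamond.
have [lt_n|le_n] := ltnP n 2000; last exact: zdet3_pos_large.
apply: zdet3_pos_small; last by rewrite hn.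
by case: hk => ->; [exact: bd_check1 | exact: bd_check2].
Qed.
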